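(* For every $X\in U_q^0(\mathfrak b_{\mathbb R})$, with $\mathbf X$ denoting the closure of $\pi(X)$ as an unbounded operator on $L^2_{\mathrm h,q}(B)$, one has $$\alpha(\mathbf X)=\text{closure of }(\pi\otimes\pi_\rhd)(\alpha(X))\text{ on }L^2_{\mathrm h,q}(B)_0\otimes L^2_{q,+}(AK)_0,$$ where on the left $\alpha=\mathrm{Ad}_\gamma$ is the adjoint coaction of $\mathscr R_q^+(B_{\mathbb R})$ on $\mathscr R_q^0(B_{\mathbb R})=L^\infty_{q,0}(AK)\cong B(L^2_{\mathrm h,q}(B))$ (extended to affiliated operators) and on the right $\alpha:U_q^0(\mathfrak b_{\mathbb R})\to U_q^0(\mathfrak b_{\mathbb R})\otimes U_q^+(\mathfrak b_{\mathbb R})$ is the algebraic coaction.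
   Context: LIE DATA. $\mathfrak g$ complex semisimple Lie algebra with Cartan subalgebra $\mathfrak h$, simple roots $\alpha_r$ ($r\in I$), positive roots $\Delta^+$, $\rho=\frac12\sum_{\alpha\in\Delta^+}\alpha$, weight lattice $P$, dominant weights $P^+$, fundamental weights $\varpi_r$, simple reflections $s_r$, longest Weyl group element $w_0=s_{r_1}\cdots s_{r_M}$ (fixed reduced expression); $(\cdot,\cdot)$ is the multiple of the Killing-induced form on $\mathfrak h^*$ with shortest roots of length $\sqrt2$; $\check\alpha=2\alpha/(\alpha,\alpha)$. $0<q<1$, $q_r=q^{(\alpha_r,\alpha_r)/2}$, $[n]_q=(q^{-n}-q^n)/(q^{-1}-q)$. $U_q(\mathfrak g)$: generators $K_\omega$ ($\omega\in P$), $E_r,F_r$; relations $K_0=1$, $K_\omega K_\chi=K_{\omega+\chi}$, $K_\omega E_r=q^{(\omega,\alpha_r)}E_rK_\omega$, $K_\omega F_r=q^{-(\omega,\alpha_r)}F_rK_\omega$, quantum Serre relations, $E_rF_s-F_sE_r=\delta_{rs}(K_{\alpha_r}-K_{\alpha_r}^{-1})/(q_r-q_r^{-1})$; coproduct $\hat\Delta(K_\omega)=K_\omega\otimes K_\omega$, $\hat\Delta(E_r)=E_r\otimes K_{\alpha_r}+1\otimes E_r$, $\hat\Delta(F_r)=F_r\otimes1+K_{\alpha_r}^{-1}\otimes F_r$; antipode $\hat S$. $U_q(\mathfrak k)$: same with $K_\omega^*=K_\omega$, $E_r^*=F_rK_{\alpha_r}$. $U_q(\mathfrak b)$ (resp.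 $U_q(\mathfrak b^-)$): Hopf subalgebra generated by $K_\omega,E_r$ (resp. $K_\omega,F_r$); in $U_q(\mathfrak b^-)$ write $L_\omega$ for $K_\omega$. $U_q^+(\mathfrak b_{\mathbb R})$: Hopf $*$-algebra generated by copies of the Hopf algebras $U_q(\mathfrak b)$, $U_q(\mathfrak b^-)$ with $K_\omega^*=L_\omega$, $E_r^*=F_rL_{\alpha_r}$, $K_\omega L_\chi=L_\chi K_\omega$, $K_\omega F_r=q^{-(\omega,\alpha_r)}F_rK_\omega$, $L_\omega E_r=q^{(\omega,\alpha_r)}E_rL_\omega$, $E_rF_s-F_sE_r=\delta_{rs}(K_{\alpha_r}-L_{\alpha_r}^{-1})/(q_r-q_r^{-1})$. $U_q^0(\mathfrak b_{\mathbb R})$: $*$-algebra generated by copies of the algebras $U_q(\mathfrak b)$, $U_q(\mathfrak b^-)$ with $K_\omega^*=L_\omega$, $E_r^*=F_rL_{\alpha_r}$, $K_\omega L_\chi=q^{-2(\omega,\chi)}L_\chi K_\omega$, $L_\omega E_r=q^{(\omega,\alpha_r)}E_rL_\omega$, $K_\omega F_r=q^{(\omega,\alpha_r)}F_rK_\omega$, $E_rF_s-F_sE_r=-\delta_{rs}L_{\alpha_r}^{-1}/(q_r-q_r^{-1})$; its right coaction $\alpha:U_q^0(\mathfrak b_{\mathbb R})\to U_q^0(\mathfrak b_{\mathbb R})\otimes U_q^+(\mathfrak b_{\mathbb R})$ restricts to $\hat\Delta$ on $U_q(\mathfrak b)$ and $U_q(\mathfrak b^-)$. $\mathrm{Pol}_q(K)$: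 for $\varpi\in P^+$, $V_\varpi$ is the irreducible Hilbert space $*$-representation of $U_q(\mathfrak k)$ with unit highest weight vector $\xi_\varpi$ of weight $\varpi$; $K_\omega\xi=q^{(\omega,\mathrm{wt}(\xi))}\xi$. $\mathrm{Pol}_q(K)$ is spanned by $U_\varpi(\xi,\eta)(x)=\langle\xi,x\eta\rangle$, Hopf $*$-algebra dual to $U_q(\mathfrak k)$ with $U_\varpi(\xi,\eta)^*(x)=\langle\eta,\hat S(x)\xi\rangle$, $\mathrm{lwt}(U_\varpi(\xi,\eta))=\mathrm{wt}(\xi)$, $\mathrm{rwt}(U_\varpi(\xi,\eta))=\mathrm{wt}(\eta)$; $\psi$ is its Haar state. Lusztig operators: $T_r\xi=\sum_{-a+b-c=(\mathrm{wt}(\xi),\check\alpha_r)}\frac{(-1)^bq_r^{b-ac}}{[a]_{q_r}![b]_{q_r}![c]_{q_r}!}E_r^aF_r^bE_r^c\xi$, $T_{w_0}=T_{r_1}\cdots T_{r_M}$, $\eta_{w_0\varpi}=q^{-(\rho,\varpi)}T_{w_0}\xi_\varpi$ (unit lowest weight vector), $b_\varpi=U_\varpi(\xi_\varpi,\eta_{w_0\varpi})$. $\mathrm{Pol}_q(K)_{\mathrm{ext}}$ is the $*$-algebra generated by $\mathrm{Pol}_q(K)$, central $u_\omega$ ($\omega\in P$) with $u_\omega^*=u_{-\omega}$, $u_0=1$, $u_\omega u_\chi=u_{\omega+\chi}$, and self-adjoint $|b|_\omega$ with $|b|_0=1$, $|b|_\omega|b|_\chi=|b|_{\omega+\chi}$,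 $|b|_\omega x=q^{(\omega,\mathrm{lwt}(x)-w_0\mathrm{rwt}(x))}x|b|_\omega$ for $x\in\mathrm{Pol}_q(K)$, and $b_\varpi=u_\varpi|b|_\varpi$ for $\varpi\in P^+$. Gradings extend by $\mathrm{lwt}(|b|_\omega)=\mathrm{rwt}(|b|_\omega)=0$, $\mathrm{lwt}(u_\omega)=\omega$, $\mathrm{rwt}(u_\omega)=w_0\omega$. AMPLIFICATIONS. $\mathrm{Fun}(P,\mathbb C)$: functions on $P$; $\mathrm{Fun}_c$: finite support; $f_\omega(\chi)=f(\chi-\omega)$. $\mathscr F_q^+(AK)$, $\mathscr F_q^0(AK)$, $\mathscr F_q^0(AK)_{\mathrm{ext}}$ are generated by $\mathrm{Fun}(P,\mathbb C)$ and $\mathrm{Pol}_q(K)$, $\mathrm{Pol}_q(K)$, $\mathrm{Pol}_q(K)_{\mathrm{ext}}$ with relations $fx=xf_{\mathrm{lwt}(x)-\mathrm{rwt}(x)}$, $fx=xf_{\mathrm{lwt}(x)}$, $fx=xf_{\mathrm{lwt}(x)}$ respectively; $\mathscr F^\epsilon_{q,c}(AK)$ ($\epsilon\in\{+,0\}$) is the span of $xf$, $x\in\mathrm{Pol}_q(K)$, $f\in\mathrm{Fun}_c(P,\mathbb C)$. With $\Delta(f)(\omega,\chi)=f(\omega+\chi)$, $xf\mapsto\Delta(x)\Delta(f)$ defines the comultiplication $\Delta$ on $\mathscr F^+_{q,c}(AK)$ and the left coaction $\gamma:\mathscr F^0_{q,c}(AK)\to M(\mathscr F^+_{q,c}(AK)\otimes\mathscr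 F^0_{q,c}(AK))$. THE MAP $\pi$. Put $z_\omega(\chi)=q^{(\omega,\chi)}$, $k_\omega=q^{-\frac12(\omega,\omega)}z_\omega u_{-\omega}$, $l_\omega=q^{-\frac12(\omega,\omega)}u_\omega z_\omega$, $e_r=(1-q_r^2)^{-1}b_{\varpi_r}^{-1}(b_{\varpi_r}\lhd E_r)$, where $U_\varpi(\xi,\eta)\lhd X=U_\varpi(X^*\xi,\eta)$, and $f_r=e_r^*l_{\alpha_r}^{-1}$. Then $\pi:U_q^0(\mathfrak b_{\mathbb R})\to\mathscr F_q^0(AK)_{\mathrm{ext}}$ is the $*$-homomorphism $K_\omega\mapsto k_\omega$, $L_\omega\mapsto l_\omega$, $E_r\mapsto e_r$, $F_r\mapsto f_r$. REPRESENTATION. $\theta$ is the $*$-representation of $\mathrm{Pol}_q(SU(2))$ (generators $a,b$ with $\begin{pmatrix} a & -qb^* \\ b & a^* \end{pmatrix}$ unitary corepresentation, paired by $K\mapsto\mathrm{diag}(q^{-1},q)$, $E\mapsto q^{1/2}e_{21}$, $F\mapsto q^{-1/2}e_{12}$) on $\mathbb C[\mathbb N]$: $ae_n=(1-q^{2n})^{1/2}e_{n-1}$, $be_n=q^ne_n$. $\theta_r$ is its composition (at $q_r$) with $\mathrm{Pol}_q(K)\to\mathrm{Pol}_{q_r}(SU(2))$ dual to $E,F,K\mapsto E_r,F_r,K_{\alpha_r}$, and $\theta_{w_0}=(\theta_{r_1}\otimes\cdots\otimes\theta_{r_M})\Delta^{(M)}$. $L^2_{\mathrm h,q}(B)_0=\mathbb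 C[P]\otimes\mathbb C[\mathbb N]^{\otimes M}$, with completion $L^2_{\mathrm h,q}(B)$ and $\xi_\chi=e_\chi\otimes\xi$, carries the $*$-representation of $\mathscr F_q^0(AK)_{\mathrm{ext}}$: $x\xi_\chi=(\theta_{w_0}(x)\xi)_{\chi+\mathrm{lwt}(x)}$ ($x\in\mathrm{Pol}_q(K)$ left homogeneous), $f\xi_\chi=f(-\chi)\xi_\chi$, $u_\omega\xi_\chi=\xi_{\chi+\omega}$, $|b|_\omega(e_{n_1}\otimes\cdots\otimes e_{n_M})_\chi=q^{\sum_in_i(\omega,\beta_i)}(e_{n_1}\otimes\cdots\otimes e_{n_M})_\chi$, $\beta_i=s_{r_1}\cdots s_{r_{i-1}}\alpha_{r_i}$. Via $\pi$, $U_q^0(\mathfrak b_{\mathbb R})$ acts on $L^2_{\mathrm h,q}(B)_0$. COMPLETIONS. $\psi^\epsilon(xf)=\psi(x)\sum_\omega f(\omega)$; $L^2_{q,\epsilon}(AK)_0=\mathscr F^\epsilon_{q,c}(AK)$ with $\langle x,y\rangle=\psi^\epsilon(x^*y)$, completion $L^2_{q,\epsilon}(AK)$, embedding $\Gamma^\epsilon$; $L^\infty_{q,\epsilon}(AK)=\mathscr F^\epsilon_{q,c}(AK)''$ acting by left multiplication. $L^\infty_{q,+}(AK)$ is a quantum group von Neumann algebra with $\Delta(x)=V(x\otimes1)V^*$, $V(\Gamma^+(x)\otimes\Gamma^+(y))=(\Gamma^+\otimes\Gamma^+)(\Delta(x)(1\otimes y))$. $(\mathscr R_q^+(B_{\mathbb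 R}),\hat\Delta)$ is the commutant of its Pontryagin dual: the von Neumann algebra $\{(\mathrm{id}\otimes\omega)(V)\}''$ on $L^2_{q,+}(AK)$ with $\hat\Delta(x)=V^*(1\otimes x)V$. $U_q^+(\mathfrak b_{\mathbb R})$ acts on $L^2_{q,+}(AK)_0$ by $\pi_\rhd(X)\Gamma^+(xf)=\sum_i\Gamma^+\big(x_{(1)}(Y_i,x_{(2)})f_{-\omega_i}\big)$ where $\pi_{\mathfrak k}(X_{(1)})\otimes\pi_{\mathfrak a}(X_{(2)})=\sum_iY_i\otimes U_{\omega_i}$, with $\pi_{\mathfrak k}:E_r,F_r,K_\omega,L_\omega\mapsto E_r,F_r,K_\omega,K_\omega\in U_q(\mathfrak k)$ and $\pi_{\mathfrak a}:E_r,F_r\mapsto0$, $K_\omega\mapsto U_\omega$, $L_\omega\mapsto U_{-\omega}$ in the group algebra of $P$. The identification $L^\infty_{q,0}(AK)\cong B(L^2_{\mathrm h,q}(B))$ is the normal extension of the representation of $\mathscr F^0_{q,c}(AK)$ on $L^2_{\mathrm h,q}(B)$ given by $x\xi_\chi=(\theta_{w_0}(x)\xi)_{\chi+\mathrm{lwt}(x)}$ for left homogeneous $x\in\mathrm{Pol}_q(K)$ and $f\xi_\chi=f(-\chi)\xi_\chi$ for $f\in\mathrm{Fun}_c(P,\mathbb C)$. With $\mathcal V:L^2_{q,0}(AK)\otimes L^2_{q,0}(AK)\to L^2_{q,+}(AK)\otimes L^2_{q,0}(AK)$, $\Gamma^0(x)\otimes\Gamma^0(y)\mapsto(\Gamma^+\otimes\Gamma^0)(\gamma(x)(1\otimes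 y))$, one has $\mathcal V\in B(L^2_{q,0}(AK),L^2_{q,+}(AK))\bar\otimes L^\infty_{q,0}(AK)$, so $\mathcal V$ may be viewed as a unitary $L^2_{q,0}(AK)\otimes L^2_{\mathrm h,q}(B)\to L^2_{q,+}(AK)\otimes L^2_{\mathrm h,q}(B)$, and $\mathrm{Ad}_\gamma(x)=\Sigma\mathcal V(1\otimes x)\mathcal V^*\Sigma$ with $\Sigma$ the flip; the same formula is used for affiliated (unbounded) operators.
   Formalization: The action of u_ω is taken as ±ξ_{χ+ω}, with a sign depending only on ω and forced by b_ϖ = u_ϖ|b|_ϖ; the literal formula u_ωξ_χ = ξ_{χ+ω} contradicts that relation already for SU(2), where b_ϖ = −b. *)

(* Defs.v *)
(* Scalars are C = R[i] for R : realType.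

   Objects given by generators and relations, by a duality, or as a completion
   are packaged as records stating their defining universal property, so that
   the theorem is about every model of them (any two models are isomorphic).
   Inner products are linear in the second variable.

     uqK, uqZero, uqPlus      U_q(k), U_q^0(b_R), U_q^+(b_R)
     polK, polExt             Pol_q(K), Pol_q(K)_ext
     funPlus, funZero, funExt F_q^+(AK), F_q^0(AK), F_q^0(AK)_ext
     ampc F                   the part of F spanned by x f, f of finite support
     Lh0, L2h                 L^2_(h,q)(B)_0 and its completion
     L2plus, L2zero           L^2_(q,+)(AK), L^2_(q,0)(AK)
     Linf0                    L^infty_(q,0)(AK) = R_q^0(B_R) *)
From HB Require Import structures.
From mathcomp Require Import all_boot all_order all_algebra.
From mathcomp Require Import finmap monalg complex.
From mathcomp Require Import all_classical all_reals all_analysis.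
Import Order.TTheory GRing.Theory Num.Theory numFieldNormedType.Exports.

Set Implicit Arguments.
Unset Strict Implicit.
Unset Printing Implicit Defensive.

Local Open Scope classical_set_scope.
Local Open Scope ring_scope.

Section LinearAlgebra.
Variable R : realType.
Local Notation C := R[i].

Definition lspan (V : lmodType C) (S : set V) : set V :=
  [set v | exists n (c : 'I_n -> C) (u : 'I_n -> V),
     (forall i, S (u i)) /\ v = \sum_(i < n) c i *: u i].

Definition linear_on (V W : lmodType C) (S : set V) (f : V -> W) : Prop :=
  forall c x y, S x -> S y -> f (c *: x + y) = c *: f x + f y.

Definition is_inner (V : lmodType C) (ip : V -> V -> C) : Prop :=
  [/\ forall x, scalar (ip x),
      forall x y, ip y x = (ip x y)^*,
      forall x, 0 <= ip x x
    & forall x, ip x x = 0 -> x = 0].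

(* An element of the algebraic tensor product A (x) B is written, as in Sweedler
   notation, as a finite family of elementary tensors; two families represent
   the same element when no bilinear map separates them. *)
Definition tsum (A B V : lmodType C) (f : A -> B -> V) (s : seq (A * B)) : V :=
  \sum_(p <- s) f p.1 p.2.

Definition tens_eq (A B : lmodType C) (s t : seq (A * B)) : Prop :=
  forall (V : lmodType C) (f : {bilinear A -> B -> V}), tsum f s = tsum f t.

Definition tens_hom (A B D : algType C) (f : A -> seq (B * D)) : Prop :=
  [/\ forall c x y,
        tens_eq (f (c *: x + y)) ([seq (c *: p.1, p.2) | p <- f x] ++ f y),
      tens_eq (f 1) [:: (1, 1)]
    & forall x y,
        tens_eq (f (x * y)) [seq (p.1 * r.1, p.2 * r.2) | p <- f x, r <- f y]].

Definition alg_hom (A B : algType C) (f : A -> B) : Prop :=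
  [/\ linear f, f 1 = 1 & forall x y, f (x * y) = f x * f y].

Definition is_rep (A : algType C) (M : lmodType C) (a : A -> M -> M) : Prop :=
  [/\ forall v, linear (fun x => a x v), forall x, linear (a x),
      forall v, a 1 v = v & forall x y v, a (x * y) v = a x (a y v)].

Record starAlg := StarAlg {
  sa_alg :> algType C;
  star : sa_alg -> sa_alg;
  starL : forall (c : C) x y, star (c *: x + y) = c^* *: star x + star y;
  starM : forall x y, star (x * y) = star y * star x;
  starK : involutive star }.

Definition star_hom (A B : starAlg) (f : A -> B) : Prop :=
  alg_hom f /\ forall x, f (star x) = star (f x).

Definition presents (G : Type) (rel : forall B : algType C, (G -> B) -> Prop)
    (A : algType C) (gen : G -> A) : Prop :=
  rel A gen /\
  forall (B : algType C) (b : G -> B), rel B b ->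
    exists h : A -> B, [/\ alg_hom h, forall g, h (gen g) = b g
      & forall h' : A -> B, alg_hom h' -> (forall g, h' (gen g) = b g) -> h' =1 h].

Definition star_presents (G : Type) (rel : forall B : starAlg, (G -> B) -> Prop)
    (A : starAlg) (gen : G -> A) : Prop :=
  rel A gen /\
  forall (B : starAlg) (b : G -> B), rel B b ->
    exists h : A -> B, [/\ star_hom h, forall g, h (gen g) = b g
      & forall h' : A -> B, star_hom h' -> (forall g, h' (gen g) = b g) -> h' =1 h].

Record hopfStar := HopfStar {
  hs_alg :> starAlg;
  cop : hs_alg -> seq (hs_alg * hs_alg);
  counit : hs_alg -> C;
  antipode : hs_alg -> hs_alg;
  cop_hom : tens_hom cop;
  cop_star : forall x,
    tens_eq (cop (star x)) [seq (star p.1, star p.2) | p <- cop x];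
  coassoc : forall (x : hs_alg) (V : lmodType C) (f : hs_alg -> hs_alg -> hs_alg -> V),
    (forall y z, linear (fun u => f u y z)) ->
    (forall y z, linear (fun u => f y u z)) ->
    (forall y z, linear (f y z)) ->
    \sum_(p <- cop x) \sum_(r <- cop p.1) f r.1 r.2 p.2 =
    \sum_(p <- cop x) \sum_(r <- cop p.2) f p.1 r.1 r.2;
  counit_hom : [/\ scalar counit, counit 1 = 1
                 & forall x y, counit (x * y) = counit x * counit y];
  counit_star : forall x, counit (star x) = (counit x)^*;
  counitl : forall x, \sum_(p <- cop x) counit p.1 *: p.2 = x;
  counitr : forall x, \sum_(p <- cop x) counit p.2 *: p.1 = x;
  antipode_lin : linear antipode;
  antipodel : forall x, \sum_(p <- cop x) antipode p.1 * p.2 = counit x *: 1;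
  antipoder : forall x, \sum_(p <- cop x) p.1 * antipode p.2 = counit x *: 1 }.

(* (x y, X) = (x, X_(1)) (y, X_(2)) and (x, X Y) = (x_(1), X) (x_(2), Y). *)
Definition hopf_pairing (A U : hopfStar) (pr : A -> U -> C) : Prop :=
  [/\ (forall X, scalar (pr ^~ X)) /\ (forall x, scalar (pr x)),
      (forall x y X, pr (x * y) X = \sum_(p <- cop X) pr x p.1 * pr y p.2) /\
        (forall X, pr 1 X = counit X),
      (forall x X Y, pr x (X * Y) = \sum_(p <- cop x) pr p.1 X * pr p.2 Y) /\
        (forall x, pr x 1 = counit x)
    & forall x X, pr (star x) X = (pr x (star (antipode X)))^*].

Definition separating (A U : lmodType C) (pr : A -> U -> C) : Prop :=
  forall x, (forall X, pr x X = 0) -> x = 0.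

Definition cpow (q x : R) : C := (q `^ x)%:C%C.

End LinearAlgebra.

Section RootData.
Variable R : realType.

Definition srefl n (sr : 'I_n -> 'rV[int]_n) (r : 'I_n) (w : 'rV[int]_n) :=
  w - w ord0 r *: sr r.

Definition wact n (sr : 'I_n -> 'rV[int]_n) (s : seq 'I_n) (w : 'rV[int]_n) :=
  foldr (srefl sr) w s.

(* The Lie algebra g, with its Cartan subalgebra and simple roots, enters only
   through the following data.  P = Z^n in the basis of fundamental weights, so
   the r-th coordinate of w is (w, coroot of alpha_r), and the coordinates of
   the simple roots form the Cartan matrix; wip is the form on P.  The roots are
   the Weyl conjugates of the simple ones.  On the Cartan subalgebra the Killing
   form is \sum_alpha alpha (x) alpha, so rd_killing says that wip is
   proportional to the form that it induces on the dual. *)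
Record rootDatum := RootDatum {
  rk : nat;
  sroot : 'I_rk -> 'rV[int]_rk;
  wip : 'rV[int]_rk -> 'rV[int]_rk -> R;
  roots : seq 'rV[int]_rk;
  wipC : forall v w : 'rV[int]_rk, wip v w = wip w v;
  wipD : forall u v w : 'rV[int]_rk, wip u (v + w) = wip u v + wip u w;
  wip_gt0 : forall w : 'rV[int]_rk, w != 0 -> 0 < wip w w;
  wip_coroot : forall (w : 'rV[int]_rk) r,
    (w ord0 r)%:~R = 2 * wip w (sroot r) / wip (sroot r) (sroot r);
  sroot_le0 : forall r s, r != s -> sroot s ord0 r <= 0;
  roots_uniq : uniq roots;
  rootsP : forall a, a \in roots <-> exists s r, a = wact sroot s (sroot r);
  rd_killing : exists c : R, forall v w : 'rV[int]_rk,
    \sum_(a <- roots) wip v a * wip a w = c * wip v w;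
  rd_short : (forall a, a \in roots -> 2 <= wip a a) /\
    ((0 < rk)%N -> exists2 a, a \in roots & wip a a = 2) }.

Variable L : rootDatum.
Local Notation P := 'rV[int]_(rk L).
Local Notation I := 'I_(rk L).

Definition pos_root (a : P) : Prop :=
  a \in roots L /\ exists c : I -> nat, a = \sum_r sroot r *+ c r.

(* (rho, w) *)
Definition rho_ip (w : P) : R :=
  (\sum_(a <- roots L | `[< pos_root a >]) wip a w) / 2.

Definition dominant (w : P) : bool := [forall r, 0 <= w ord0 r].
Definition domw := {w : P | dominant w}.

Lemma fundw_dominant (r : I) : dominant (delta_mx ord0 r).
Proof. by apply/forallP => s; rewrite mxE ler0n. Qed.
Definition fundw (r : I) : domw := exist (fun w => dominant w) _ (fundw_dominant r).

Record longestWord := LongestWord {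
  lw_word :> seq I;
  lw_reduced : forall s, wact (@sroot L) s =1 wact (@sroot L) lw_word ->
    (size lw_word <= size s)%N;
  lw_longest : forall s, exists2 s', wact (@sroot L) s' =1 wact (@sroot L) s
    & (size s' <= size lw_word)%N }.

(* beta_i = s_(r_1) ... s_(r_(i-1)) alpha_(r_i) *)
Fixpoint betas (s : seq I) : seq P :=
  if s is r :: s' then sroot r :: map (srefl (@sroot L) r) (betas s') else [::].

Variable q : R.
Definition qr (r : I) : R := q `^ (wip (sroot r) (sroot r) / 2).

Definition qint (p : R) (n : nat) : R := (p ^- n - p ^+ n) / (p^-1 - p).
Definition qfact (p : R) (n : nat) : R := \prod_(i < n) qint p i.+1.
Definition qbin (p : R) (n k : nat) : R := qfact p n / (qfact p k * qfact p (n - k)).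

End RootData.
Arguments sroot {R} _ _.
Arguments qr {R} _ _ _.

Section Enveloping.
Variables (R : realType) (q : R) (L : rootDatum R).
Local Notation C := R[i].
Local Notation P := 'rV[int]_(rk L).
Local Notation I := 'I_(rk L).
Local Notation qp x := (cpow q x).

Definition serre (B : algType C) (e : I -> B) : Prop :=
  forall r s, r != s ->
    let N := `|1 - sroot L s ord0 r|%N in
    \sum_(k < N.+1) ((-1) ^+ k * qbin (qr L q r) N k)%:C%C
      *: (e r ^+ (N - k) * e s * e r ^+ k) = 0.

Definition qdenom (r : I) : C := ((qr L q r - (qr L q r)^-1)^-1)%:C%C.

Inductive gen_g := gK of P | gE of I | gF of I.

Definition rel_g (B : algType C) (g : gen_g -> B) : Prop :=
  let K w := g (gK w) in let E r := g (gE r) in let F r := g (gF r) in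
  [/\ K 0 = 1 /\ (forall v w, K v * K w = K (v + w)),
      forall w r, K w * E r = qp (wip w (sroot L r)) *: (E r * K w),
      forall w r, K w * F r = qp (- wip w (sroot L r)) *: (F r * K w),
      serre E /\ serre F
    & forall r s, E r * F s - F s * E r =
        if r == s then qdenom r *: (K (sroot L r) - K (- sroot L r)) else 0].

Record uqK := UqK {
  uk :> hopfStar R;
  uk_gen : gen_g -> uk;
  uk_presents : presents rel_g uk_gen;
  uk_cop : (forall w, tens_eq (cop (uk_gen (gK w))) [:: (uk_gen (gK w), uk_gen (gK w))]) /\
    forall r,
      tens_eq (cop (uk_gen (gE r)))
        [:: (uk_gen (gE r), uk_gen (gK (sroot L r))); (1, uk_gen (gE r))] /\
      tens_eq (cop (uk_gen (gF r)))
        [:: (uk_gen (gF r), 1); (uk_gen (gK (- sroot L r)), uk_gen (gF r))];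
  uk_star : (forall w, star (uk_gen (gK w)) = uk_gen (gK w)) /\
    forall r, star (uk_gen (gE r)) = uk_gen (gF r) * uk_gen (gK (sroot L r)) }.

Inductive gen_b := bK of P | bL of P | bE of I | bF of I.

(* U_q(b) and U_q(b^-) are entered through their own presentations. *)
Definition rel_borels (B : algType C) (g : gen_b -> B) : Prop :=
  let K w := g (bK w) in let L' w := g (bL w) in
  let E r := g (bE r) in let F r := g (bF r) in
  [/\ K 0 = 1 /\ (forall v w, K v * K w = K (v + w)),
      L' 0 = 1 /\ (forall v w, L' v * L' w = L' (v + w)),
      forall w r, K w * E r = qp (wip w (sroot L r)) *: (E r * K w),
      forall w r, L' w * F r = qp (- wip w (sroot L r)) *: (F r * L' w)
    & serre E /\ serre F].

Definition rel_plus (B : algType C) (g : gen_b -> B) : Prop :=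
  let K w := g (bK w) in let L' w := g (bL w) in
  let E r := g (bE r) in let F r := g (bF r) in
  rel_borels g /\
  [/\ forall v w, K v * L' w = L' w * K v,
      forall w r, K w * F r = qp (- wip w (sroot L r)) *: (F r * K w),
      forall w r, L' w * E r = qp (wip w (sroot L r)) *: (E r * L' w)
    & forall r s, E r * F s - F s * E r =
        if r == s then qdenom r *: (K (sroot L r) - L' (- sroot L r)) else 0].

Definition rel_zero (B : algType C) (g : gen_b -> B) : Prop :=
  let K w := g (bK w) in let L' w := g (bL w) in
  let E r := g (bE r) in let F r := g (bF r) in
  rel_borels g /\
  [/\ forall v w, K v * L' w = qp (- (2 * wip v w)) *: (L' w * K v),
      forall w r, L' w * E r = qp (wip w (sroot L r)) *: (E r * L' w),
      forall w r, K w * F r = qp (wip w (sroot L r)) *: (F r * K w)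
    & forall r s, E r * F s - F s * E r =
        if r == s then - (qdenom r *: L' (- sroot L r)) else 0].

Definition star_borel (A : starAlg R) (g : gen_b -> A) : Prop :=
  (forall w, star (g (bK w)) = g (bL w)) /\
  forall r, star (g (bE r)) = g (bF r) * g (bL (sroot L r)).

Definition cop_borel (A B D : algType C) (a : gen_b -> A) (b : gen_b -> B)
    (d : gen_b -> D) (f : A -> seq (B * D)) : Prop :=
  [/\ forall w, tens_eq (f (a (bK w))) [:: (b (bK w), d (bK w))],
      forall w, tens_eq (f (a (bL w))) [:: (b (bL w), d (bL w))],
      forall r, tens_eq (f (a (bE r)))
        [:: (b (bE r), d (bK (sroot L r))); (1, d (bE r))]
    & forall r, tens_eq (f (a (bF r)))
        [:: (b (bF r), 1); (b (bL (- sroot L r)), d (bF r))]].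

Record uqPlus := UqPlus {
  up :> hopfStar R;
  up_gen : gen_b -> up;
  up_presents : presents rel_plus up_gen;
  up_star : star_borel up_gen;
  up_cop : cop_borel up_gen up_gen up_gen (@cop R up) }.

Record uqZero := UqZero {
  uz :> starAlg R;
  uz_gen : gen_b -> uz;
  uz_presents : presents rel_zero uz_gen;
  uz_star : star_borel uz_gen }.

Record rightCoaction (U0 : uqZero) (Up : uqPlus) := RightCoaction {
  rca :> U0 -> seq (U0 * Up);
  rca_hom : tens_hom rca;
  rca_gen : cop_borel (@uz_gen U0) (@uz_gen U0) (@up_gen Up) rca }.

Variable U : uqK.
Local Notation uK w := (uk_gen U (gK w)).
Local Notation uE r := (uk_gen U (gE r)).
Local Notation uF r := (uk_gen U (gF r)).

Definition is_pik (Up : uqPlus) (f : Up -> U) : Prop :=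
  [/\ alg_hom f, forall r, f (up_gen Up (bE r)) = uE r /\ f (up_gen Up (bF r)) = uF r
    & forall w, f (up_gen Up (bK w)) = uK w /\ f (up_gen Up (bL w)) = uK w].

(* The group algebra of P, with basis U_w = << w >>. *)
Definition conv (x y : {malg C[P]}) : {malg C[P]} :=
  \sum_(v <- msupp x) \sum_(w <- msupp y) (x@_v * y@_w) *: << v + w >>.

Definition is_pia (Up : uqPlus) (f : Up -> {malg C[P]}) : Prop :=
  [/\ linear f, f 1 = << 0 >> /\ (forall x y, f (x * y) = conv (f x) (f y)),
      forall r, f (up_gen Up (bE r)) = 0 /\ f (up_gen Up (bF r)) = 0
    & forall w, f (up_gen Up (bK w)) = << w >> /\ f (up_gen Up (bL w)) = << - w >>].

Record irrep (w : P) := Irrep {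
  ir :> vectType C;
  ir_ip : ir -> ir -> C;
  ir_act : U -> ir -> ir;
  ir_hw : ir;
  ir_inner : is_inner ir_ip;
  ir_rep : is_rep ir_act;
  ir_star : forall X v u, ir_ip (ir_act X v) u = ir_ip v (ir_act (star X) u);
  ir_irreducible : forall W : {vspace ir},
    (forall X v, v \in W -> ir_act X v \in W) -> W = 0%VS \/ W = fullv;
  ir_hw_unit : ir_ip ir_hw ir_hw = 1;
  ir_hw_E : forall r, ir_act (uE r) ir_hw = 0;
  ir_hw_K : forall v, ir_act (uK v) ir_hw = qp (wip v w) *: ir_hw }.

Definition has_wt (w : P) (V : irrep w) (v : V) (m : P) : Prop :=
  forall w', ir_act (uK w') v = qp (wip w' m) *: v.

Variable V : forall w : domw L, irrep (val w).

(* mcoef v u = U_w(v, u) *)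
Record polK := PolK {
  pk :> hopfStar R;
  pk_pair : pk -> U -> C;
  mcoef : forall w : domw L, V w -> V w -> pk;
  pk_pairing : hopf_pairing pk_pair;
  pk_sep : separating pk_pair;
  mcoefE : forall w (v u : V w) X, pk_pair (mcoef v u) X = ir_ip v (ir_act X u);
  pk_span : lspan [set x | exists w (v u : V w), x = mcoef v u] = setT }.

Variable A : polK.

(* The span of U_w(v, u) with wt v = l (and wt u = m). *)
Definition bihomog (l m : P) : set A :=
  lspan [set x | exists w (v u : V w), [/\ has_wt v l, has_wt u m & x = mcoef A v u]].
Definition lhomog (l : P) : set A :=
  lspan [set x | exists w (v u : V w), has_wt v l /\ x = mcoef A v u].

Record haar := Haar {
  hs :> A -> C;
  hs_lin : scalar hs;
  hs1 : hs 1 = 1;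
  hs_ge0 : forall x, 0 <= hs (star x * x);
  hs_left : forall x, \sum_(p <- cop x) hs p.1 *: p.2 = hs x *: 1;
  hs_right : forall x, \sum_(p <- cop x) hs p.2 *: p.1 = hs x *: 1 }.

(* The sum defining T_r is finite on each vector; its terms vanish for large
   indices, so it is truncated at every large enough N. *)
Record lusztigT := LusztigT {
  lT : I -> forall w : domw L, V w -> V w;
  lT_lin : forall r w, linear (@lT r w);
  lT_spec : forall r w (v : V w) (m : P), has_wt v m ->
    exists N0, forall N, (N0 <= N)%N ->
      lT r v = \sum_(a < N) \sum_(b < N)
        \sum_(c < N | (b%:Z - a%:Z - c%:Z) == m ord0 r)
          ((-1) ^+ b * (qr L q r) ^ (b%:Z - (a * c)%N%:Z)
             / (qfact (qr L q r) a * qfact (qr L q r) b * qfact (qr L q r) c))%:C%C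
          *: ir_act (uE r ^+ a * uF r ^+ b * uE r ^+ c) v }.

Variables (T : lusztigT) (w0 : longestWord L).

Definition eta (w : domw L) : V w :=
  qp (- rho_ip (val w)) *: foldr (fun r v => lT T r v) (ir_hw (V w)) w0.

Definition bpol (w : domw L) : A := mcoef A (ir_hw (V w)) (eta w).

Inductive gen_ext := xPol of A | xU of P | xB of P.

Definition rel_ext (B : starAlg R) (g : gen_ext -> B) : Prop :=
  let u w := g (xU w) in let b w := g (xB w) in
  [/\ star_hom (fun x => g (xPol x)),
      [/\ u 0 = 1, forall v w, u v * u w = u (v + w), forall w, star (u w) = u (- w),
          forall w x, u w * g (xPol x) = g (xPol x) * u w
        & forall v w, u v * b w = b w * u v],
      [/\ b 0 = 1, forall v w, b v * b w = b (v + w) & forall w, star (b w) = b w],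
      forall w l m x, bihomog l m x ->
        b w * g (xPol x) =
          qp (wip w (l - wact (sroot L) w0 m)) *: (g (xPol x) * b w)
    & forall w : domw L, g (xPol (bpol w)) = u (val w) * b (val w)].

Record polExt := PolExt {
  pe :> starAlg R;
  pe_gen : gen_ext -> pe;
  pe_presents : star_presents rel_ext pe_gen }.

Inductive ext_lhomog (B : polExt) : P -> pe B -> Prop :=
| elh_pol l x : lhomog l x -> ext_lhomog l (pe_gen B (xPol x))
| elh_u w : ext_lhomog w (pe_gen B (xU w))
| elh_b w : ext_lhomog 0 (pe_gen B (xB w))
| elh_1 : ext_lhomog 0 1
| elh_0 l : ext_lhomog l 0
| elh_lin l c x y : ext_lhomog l x -> ext_lhomog l y -> ext_lhomog l (c *: x + y)
| elh_mul l m x y : ext_lhomog l x -> ext_lhomog m y -> ext_lhomog (l + m) (x * y).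

Inductive gen_amp (B : starAlg R) := aX of B | aF of (P -> C).

Definition wshift (m : P) (f : P -> C) : P -> C := fun x => f (x - m).

Definition rel_amp (B : starAlg R) (homog : P -> B -> Prop) (D : starAlg R)
    (g : gen_amp B -> D) : Prop :=
  [/\ star_hom (fun x => g (aX x)),
      [/\ forall c f h, g (aF B (fun x => c * f x + h x)) = c *: g (aF B f) + g (aF B h),
          forall f h, g (aF B (fun x => f x * h x)) = g (aF B f) * g (aF B h),
          g (aF B (fun=> 1)) = 1
        & forall f, g (aF B (fun x => (f x)^*)) = star (g (aF B f))]
    & forall m x f, homog m x -> g (aF B f) * g (aX x) = g (aX x) * g (aF B (wshift m f))].

(* Algebras generated by B and Fun(P, C) with f x = x f_(deg x). *)
Record amplif (B : starAlg R) (homog : P -> B -> Prop) := Amplif {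
  am :> starAlg R;
  am_gen : gen_amp B -> am;
  am_presents : star_presents (@rel_amp B homog) am_gen }.

Definition xf (B : starAlg R) homog (F : @amplif B homog) (x : B) (f : P -> C) : F :=
  am_gen F (aX x) * am_gen F (aF B f).

Definition homog_plus (m : P) (x : A) : Prop :=
  exists l l', bihomog l l' x /\ m = l - l'.

Definition funPlus := amplif homog_plus.
Definition funZero := amplif lhomog.    
Definition funExt (B : polExt) := amplif (@ext_lhomog B).

Definition finsupp_fun (f : P -> C) : Prop := finite_set [set x | f x != 0].

Definition ampc homog (F : @amplif A homog) : set F :=
  lspan [set y | exists x f, finsupp_fun f /\ y = xf F x f].

Variable psi : haar.

Record ampState homog (F : @amplif A homog) := AmpState {
  as_fun :> F -> C;
  as_lin : forall c x y, ampc x -> ampc y ->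
    as_fun (c *: x + y) = c * as_fun x + as_fun y;
  as_xf : forall x f, finsupp_fun f ->
    as_fun (xf F x f) = psi x * \sum_(m \in [set: P]) f m }.

Record pirhd (Fp : funPlus) (Up : uqPlus) := Pirhd {
  pr_pik : Up -> U;
  pr_pia : Up -> {malg C[P]};
  pr_act :> Up -> Fp -> Fp;
  pr_pikP : is_pik pr_pik;
  pr_piaP : is_pia pr_pia;
  pr_lin : forall X, linear_on (@ampc _ Fp) (pr_act X);
  pr_xf : forall X x f, finsupp_fun f ->
    pr_act X (xf Fp x f) =
      \sum_(p <- cop X) \sum_(m <- msupp (pr_pia p.2)) (pr_pia p.2)@_m *:
        \sum_(s <- cop x) pk_pair s.2 (pr_pik p.1) *: xf Fp s.1 (wshift (- m) f) }.

End Enveloping.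

Section SU2.
Variables (R : realType) (p : R).
Local Notation C := R[i].

Inductive gen_su2 := sK | sKi | sE | sF.

Definition rel_su2 (B : algType C) (g : gen_su2 -> B) : Prop :=
  [/\ g sK * g sKi = 1 /\ g sKi * g sK = 1,
      g sK * g sE = (p ^+ 2)%:C%C *: (g sE * g sK),
      g sK * g sF = (p ^- 2)%:C%C *: (g sF * g sK)
    & g sE * g sF - g sF * g sE = ((p - p^-1)^-1)%:C%C *: (g sK - g sKi)].

Record uqSu2 := UqSu2 {
  us :> hopfStar R;
  us_gen : gen_su2 -> us;
  us_presents : presents rel_su2 us_gen;
  us_cop : [/\ tens_eq (cop (us_gen sK)) [:: (us_gen sK, us_gen sK)],
    tens_eq (cop (us_gen sE)) [:: (us_gen sE, us_gen sK); (1, us_gen sE)]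
    & tens_eq (cop (us_gen sF)) [:: (us_gen sF, 1); (us_gen sKi, us_gen sF)]];
  us_star : star (us_gen sK) = us_gen sK /\ star (us_gen sE) = us_gen sF * us_gen sK }.

Definition spin_half (g : gen_su2) : 'M[C]_2 :=
  match g with
  | sK => (p^-1)%:C%C *: delta_mx 0 0 + p%:C%C *: delta_mx 1 1
  | sKi => p%:C%C *: delta_mx 0 0 + (p^-1)%:C%C *: delta_mx 1 1
  | sE => cpow p (2^-1) *: delta_mx 1 0
  | sF => cpow p (- 2^-1) *: delta_mx 0 1
  end.

Inductive gen_ab := ga | gb.

Definition umat (B : starAlg R) (g : gen_ab -> B) : 'M[B]_2 :=
  \matrix_(i, j)
    if i == 0 then (if j == 0 then g ga else - (p%:C%C *: star (g gb)))
    else (if j == 0 then g gb else star (g ga)).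

Definition rel_ab (B : starAlg R) (g : gen_ab -> B) : Prop :=
  let u := umat g in
  u *m (map_mx (@star R B) u)^T = 1%:M /\ (map_mx (@star R B) u)^T *m u = 1%:M.

Record polSu2 (U : uqSu2) := PolSu2 {
  ps :> hopfStar R;
  ps_gen : gen_ab -> ps;
  ps_pair : ps -> U -> C;
  ps_presents : star_presents rel_ab ps_gen;
  ps_cop : forall i j, tens_eq (cop (umat ps_gen i j))
    [seq (umat ps_gen i k, umat ps_gen k j) | k <- enum 'I_2];
  ps_pairing : hopf_pairing ps_pair;
  ps_sep : separating ps_pair;
  ps_pairE : forall i j g, ps_pair (umat ps_gen i j) (us_gen U g) = spin_half g i j }.

Definition fip (K : choiceType) (v w : {malg C[K]}) : C :=
  \sum_(k <- msupp v) (v@_k)^* * w@_k.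

(* For n = 0 the scalar in th_a is 0, so the value of n.-1 is irrelevant. *)
Record thetaRep (U : uqSu2) (A : polSu2 U) := ThetaRep {
  th :> A -> {malg C[nat]} -> {malg C[nat]};
  th_rep : is_rep th;
  th_star : forall x v w, fip (th x v) w = fip v (th (star x) w);
  th_a : forall n : nat, th (ps_gen A ga) << n >> =
    (Num.sqrt (1 - p ^+ (2 * n)))%:C%C *: << n.-1 >>;
  th_b : forall n : nat, th (ps_gen A gb) << n >> = (p ^+ n)%:C%C *: << n >> }.

End SU2.

Section Fock.
Variables (R : realType) (q : R) (L : rootDatum R) (U : uqK q L).
Variables (V : forall w : domw L, irrep U (val w)) (A : polK V).
Variables (T : lusztigT V) (w0 : longestWord L).
Local Notation C := R[i].
Local Notation P := 'rV[int]_(rk L).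
Local Notation I := 'I_(rk L).
Local Notation qp x := (cpow q x).

(* theta_r, i.e. theta at q_r composed with the restriction map sr_res. *)
Record su2Restriction (r : I) := Su2Restriction {
  sr_U : uqSu2 (qr L q r);
  sr_P : polSu2 sr_U;
  sr_theta : thetaRep sr_P;
  sr_iota : sr_U -> U;
  sr_res : A -> sr_P;
  sr_iota_hom : alg_hom sr_iota;
  sr_iota_gen : [/\ sr_iota (us_gen sr_U sE) = uk_gen U (gE r),
    sr_iota (us_gen sr_U sF) = uk_gen U (gF r)
    & sr_iota (us_gen sr_U sK) = uk_gen U (gK (sroot L r))];
  sr_resE : forall x X, ps_pair (sr_res x) X = pk_pair x (sr_iota X) }.

Variable S : forall r, su2Restriction r.

Definition theta_r (r : I) (x : A) : {malg C[nat]} -> {malg C[nat]} :=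
  sr_theta (S r) (sr_res (S r) x).

(* C[N]^(x)n is the free module on n.-tuple nat. *)
Definition tcons n (v : {malg C[nat]}) (w : {malg C[n.-tuple nat]}) :
    {malg C[n.+1.-tuple nat]} :=
  \sum_(i <- msupp v) \sum_(t <- msupp w) (v@_i * w@_t) *: << [tuple of i :: t] >>.

(* (theta_(r_1) (x) ... (x) theta_(r_n)) Delta^(n), with Delta^(0) the counit. *)
Fixpoint theta_word (s : seq I) :
    A -> {malg C[(size s).-tuple nat]} -> {malg C[(size s).-tuple nat]} :=
  match s return A -> {malg C[(size s).-tuple nat]} -> {malg C[(size s).-tuple nat]} with
  | [::] => fun x v => counit x *: v
  | r :: s' => fun x v => \sum_(t <- msupp v) v@_t *:
      \sum_(p <- cop x) tcons (theta_r r p.1 << thead t >>)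
                              (theta_word p.2 << behead_tuple t >>)
  end.

(* L^2_(h,q)(B)_0, and v_chi = e_chi (x) v in it. *)
Definition Lh0 := {malg C[(P * (size w0).-tuple nat)%type]}.
Definition vat (chi : P) (v : {malg C[(size w0).-tuple nat]}) : Lh0 :=
  \sum_(t <- msupp v) v@_t *: << (chi, t) >>.

Variables (Pe : polExt A T w0) (Fe : funExt Pe).

Definition ext_x (x : A) : Fe := am_gen Fe (aX _ (pe_gen Pe (xPol x))).
Definition ext_u (w : P) : Fe := am_gen Fe (aX _ (pe_gen Pe (xU _ w))).
Definition ext_b (w : P) : Fe := am_gen Fe (aX _ (pe_gen Pe (xB _ w))).
Definition ext_f (f : P -> C) : Fe := am_gen Fe (aF _ f).

(* The sign er_sgn is forced by b_w = u_w |b|_w: with the factor (-1)^b in the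
   Lusztig operators, theta_(w0)(b_w) is (-1)^(w, 2 rho^vee) times the positive
   operator by which |b|_w acts (already for SU(2), where b_w = - b).  Hence
   er_sgn w is the parity of (w, 2 rho^vee); it vanishes identically whenever
   all these numbers are even. *)
Record extRep := ExtRep {
  er :> Fe -> Lh0 -> Lh0;
  er_sgn : P -> bool;
  er_rep : is_rep er;
  er_star : forall y v w, fip (er y v) w = fip v (er (star y) w);
  er_x : forall l x chi v, lhomog l x ->
    er (ext_x x) (vat chi v) = vat (chi + l) (theta_word x v);
  er_f : forall f chi v, er (ext_f f) (vat chi v) = f (- chi) *: vat chi v;
  er_u : forall w chi v, er (ext_u w) (vat chi v) = (-1) ^+ er_sgn w *: vat (chi + w) v;
  er_b : forall w chi (t : (size w0).-tuple nat),
    er (ext_b w) << (chi, t) >> =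
      qp (\sum_(c <- zip t (betas w0)) c.1%:R * wip w c.2) *: << (chi, t) >> }.

Record zeroRep (F0 : funZero A) := ZeroRep {
  zr :> F0 -> Lh0 -> Lh0;
  zr_rep : is_rep zr;
  zr_x : forall l x chi v, lhomog l x ->
    zr (am_gen F0 (aX _ x)) (vat chi v) = vat (chi + l) (theta_word x v);
  zr_f : forall f chi v,
    zr (am_gen F0 (aF _ f)) (vat chi v) = f (- chi) *: vat chi v }.

Definition zfun (w : P) : P -> C := fun chi => qp (wip w chi).

Definition k_ext (w : P) : Fe :=
  qp (- (wip w w / 2)) *: (ext_f (zfun w) * ext_u (- w)).
Definition l_ext (w : P) : Fe :=
  qp (- (wip w w / 2)) *: (ext_u w * ext_f (zfun w)).

(* b_w is invertible, as u_w and |b|_w are. *)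
Definition binv (w : P) : Fe := ext_b (- w) * ext_u (- w).

Definition e_ext (r : I) : Fe :=
  ((1 - qr L q r ^+ 2)^-1)%:C%C *:
    (binv (val (fundw r)) *
     ext_x (mcoef A (ir_act (star (uk_gen U (gE r))) (ir_hw (V (fundw r))))
                    (eta T w0 (fundw r)))).

(* l_w is invertible with inverse l_(-w). *)
Definition f_ext (r : I) : Fe := star (e_ext r) * l_ext (- sroot L r).

Record piMap (U0 : uqZero q L) := PiMap {
  pm :> U0 -> Fe;
  pm_hom : star_hom pm;
  pm_K : forall w, pm (uz_gen U0 (bK w)) = k_ext w;
  pm_L : forall w, pm (uz_gen U0 (bL w)) = l_ext w;
  pm_E : forall r, pm (uz_gen U0 (bE r)) = e_ext r;
  pm_F : forall r, pm (uz_gen U0 (bF r)) = f_ext r }.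

End Fock.

Section Hilbert.
Variable R : realType.
Local Notation C := R[i].

Record hilbert := Hilbert {
  hil :> completeNormedModType C;
  hip : hil -> hil -> C;
  hip_inner : is_inner hip;
  hip_norm : forall x, hip x x = `|x| ^+ 2 }.

(* Hilbert space completion of the subspace S of W for the form ip. *)
Record completion (W : lmodType C) (S : set W) (ip : W -> W -> C) := Completion {
  cpl :> hilbert;
  emb : W -> cpl;
  emb_lin : linear_on S emb;
  emb_ip : forall x y, S x -> S y -> hip (emb x) (emb y) = ip x y;
  emb_dense : closure (emb @` S) = setT }.

Record htensor (H1 H2 : hilbert) := Htensor {
  ht :> hilbert;
  tn : H1 -> H2 -> ht;
  tn_linl : forall y, linear (fun x => tn x y);
  tn_linr : forall x, linear (tn x);
  tn_ip : forall x y x' y', hip (tn x y) (tn x' y') = hip x x' * hip y y';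
  tn_dense : closure (lspan [set z | exists x y, z = tn x y]) = setT }.

Definition bounded_op (H1 H2 : hilbert) (T : H1 -> H2) : Prop :=
  linear T /\ continuous T.

Definition adjoint_of (H1 H2 : hilbert) (T : H1 -> H2) (T' : H2 -> H1) : Prop :=
  forall x y, hip (T x) y = hip x (T' y).

Definition unitary (H1 H2 : hilbert) (T : H1 -> H2) : Prop :=
  [/\ linear T, forall x y, hip (T x) (T y) = hip x y & forall y, exists x, T x = y].

Record flip (H1 H2 : hilbert) (T : htensor H1 H2) (T' : htensor H2 H1) := Flip {
  fl :> T -> T';
  fl_unitary : unitary fl;
  fl_tn : forall x y, fl (tn T x y) = tn T' y x }.

Section VonNeumann.
Variable H : hilbert.

(* The commutant; only applied to *-stable sets of operators. *)
Definition commutant (S : set (H -> H)) : set (H -> H) :=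
  [set T | bounded_op T /\ forall T', S T' -> forall x, T (T' x) = T' (T x)].

Definition op_le (S T : H -> H) : Prop := forall x, hip x (S x) <= hip x (T x).

Definition is_lub_op (M D : set (H -> H)) (T : H -> H) : Prop :=
  [/\ M T, forall S, D S -> op_le S T
    & forall T', M T' -> (forall S, D S -> op_le S T') -> op_le T T'].

Definition directed_pos (D : set (H -> H)) : Prop :=
  [/\ exists S, D S, forall S, D S -> op_le (fun=> 0) S
    & forall S T, D S -> D T -> exists T', [/\ D T', op_le S T' & op_le T T']].

End VonNeumann.

(* Phi is only meaningful on M; its last clause says that it preserves suprema
   of directed sets of positive operators. *)
Definition normal_iso (H K : hilbert) (M : set (H -> H))
    (Phi : (H -> H) -> (K -> K)) : Prop :=
  [/\ set_bij M [set T : K -> K | bounded_op T] Phi,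
      forall (c : C) S T, M S -> M T ->
        Phi (fun x => c *: S x + T x) = (fun x => c *: Phi S x + Phi T x),
      Phi id = id /\ (forall S T, M S -> M T -> Phi (S \o T) = Phi S \o Phi T),
      forall S T, M S -> M T -> adjoint_of S T -> adjoint_of (Phi S) (Phi T)
    & forall (D : set (H -> H)) T, D `<=` M -> directed_pos D -> is_lub_op M D T ->
        is_lub_op [set S : K -> K | bounded_op S] (Phi @` D) (Phi T)].

(* Unbounded operators are represented by their graphs; the closure of an
   operator is the topological closure of its graph. *)
Definition is_operator (H : hilbert) (G : set (H * H)%type) : Prop :=
  forall x y y', G (x, y) -> G (x, y') -> y = y'.

(* 1 (x) X for a closed operator X: the closure of the algebraic one. *)
Definition one_tensor (H1 H2 : hilbert) (T : htensor H1 H2) (G : set (H2 * H2)%type) :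
    set (T * T)%type :=
  closure (lspan [set z : (T * T)%type | exists x v w, G (v, w) /\ z = (tn T x v, tn T x w)]).

Definition conj_graph (H K : hilbert) (W : H -> K) (W' : K -> H) (G : set (H * H)%type) :
    set (K * K)%type :=
  [set z | exists v, G (W' z.1, v) /\ z.2 = W v].

End Hilbert.
Arguments one_tensor {R H1 H2} T G _.

Section Main.
Variables (R : realType) (q : R) (L : rootDatum R) (U : uqK q L).
Variables (V : forall w : domw L, irrep U (val w)) (A : polK V) (psi : haar A).
Variables (T : lusztigT V) (w0 : longestWord L) (S : forall r, su2Restriction A r).
Local Notation C := R[i].
Local Notation P := 'rV[int]_(rk L).
Local Notation Lh0' := (Lh0 w0).

Variables (Fp : funPlus A) (psip : ampState psi Fp).
Variables (F0 : funZero A) (psi0 : ampState psi F0).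

Definition L2plus := completion (@ampc _ _ _ _ _ _ _ Fp) (fun x y => psip (star x * y)).
Definition L2zero := completion (@ampc _ _ _ _ _ _ _ F0) (fun x y => psi0 (star x * y)).
Definition L2h := completion [set: Lh0'] (@fip R _).

Variables (Hp : L2plus) (H0 : L2zero) (Hh : L2h).

Definition delta_fun (chi : P) : P -> C := fun x => (x == chi)%:R.

(* gamma(x f) (1 (x) y delta_chi), for y left homogeneous of weight l.  As
   Delta(f) (1 (x) y) = (1 (x) y) Delta(f)_(0,l), with Delta(f)(m, n) = f(m + n),
   the first leg is multiplied on the right by the finitely supported function
   m |-> Delta(f)(m, chi - l).  Such y delta_chi span F_(q,c)^0(AK). *)
Definition gamma1 (x : A) (f : P -> C) (l : P) (y : A) (chi : P) : seq (Fp * F0) :=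
  [seq (xf Fp p.1 (fun m => f (m + (chi - l))), xf F0 (p.2 * y) (delta_fun chi))
     | p <- cop x].

Variables (T00 : htensor H0 H0) (Tp0 : htensor Hp H0).
Variables (T0h : htensor H0 Hh) (Tph : htensor Hp Hh).

Record gammaUnitary := GammaUnitary {
  gv :> T00 -> Tp0;
  gv_unitary : unitary gv;
  gvE : forall x f l y chi, finsupp_fun f -> lhomog l y ->
    gv (tn T00 (emb H0 (xf F0 x f)) (emb H0 (xf F0 y (delta_fun chi)))) =
    \sum_(p <- gamma1 x f l y chi) tn Tp0 (emb Hp p.1) (emb H0 p.2) }.

Definition is_lmul (y : F0) (Y : H0 -> H0) : Prop :=
  bounded_op Y /\ forall z, ampc z -> Y (emb H0 z) = emb H0 (y * z).

Definition Linf0 : set (H0 -> H0) :=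
  commutant (commutant [set Y | exists y, ampc y /\ is_lmul y Y]).

Record identLinf (rho0 : zeroRep w0 S F0) := IdentLinf {
  il :> (H0 -> H0) -> (Hh -> Hh);
  il_normal : normal_iso Linf0 il;
  il_ext : forall y Y, ampc y -> is_lmul y Y ->
    forall v, il Y (emb Hh v) = emb Hh (rho0 y v) }.

(* V viewed on L^2_(q,0)(AK) (x) L^2_(h,q)(B): the identification is applied to
   the slices of V, which lie in L^infty_(q,0)(AK). *)
Record coactUnitary (W : gammaUnitary) rho0 (Phi : identLinf rho0) := CoactUnitary {
  cu :> T0h -> Tph;
  cu_adj : Tph -> T0h;
  cu_unitary : unitary cu;
  cu_adjP : adjoint_of cu cu_adj;
  cu_slice : forall (x : H0) (z : Hp), exists Y, [/\ Linf0 Y,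
    forall y y', hip y (Y y') = hip (tn Tp0 z y) (W (tn T00 x y'))
    & forall y y', hip y (Phi Y y') = hip (tn Tph z y) (cu (tn T0h x y'))] }.

Variables (Thp : htensor Hh Hp) (sg : flip Tph Thp) (sg' : flip Thp Tph).

(* Ad_gamma(X) = Sigma V (1 (x) X) V^* Sigma *)
Definition Ad_gamma W rho0 (Phi : identLinf rho0) (Vh : coactUnitary W Phi)
    (X : set (Hh * Hh)%type) : set (Thp * Thp)%type :=
  conj_graph (fun v => sg (Vh v)) (fun v => cu_adj Vh (sg' v)) (one_tensor T0h X).

Variables (Pe : polExt A T w0) (Fe : funExt Pe) (rho : extRep S Fe).
Variables (U0 : uqZero q L) (Up : uqPlus q L) (pi : piMap Fe U0).
Variables (alpha : rightCoaction U0 Up) (prhd : pirhd Fp Up).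

Definition graph_pi (X : U0) : set (Hh * Hh)%type :=
  [set z | exists v, z = (emb Hh v, emb Hh (rho (pi X) v))].

(* Its domain is the span of the v (x) y, i.e. the algebraic tensor product of
   L^2_(h,q)(B)_0 and L^2_(q,+)(AK)_0. *)
Definition graph_alpha (X : U0) : set (Thp * Thp)%type :=
  lspan [set z : (Thp * Thp)%type | exists v y, ampc y /\
    z = (tn Thp (emb Hh v) (emb Hp y),
         \sum_(p <- alpha X) tn Thp (emb Hh (rho (pi p.1) v)) (emb Hp (prhd p.2 y)))].

End Main.
Arguments graph_pi {R q L U V A T w0 S} Hh {Pe Fe} rho {U0} pi X _.
Arguments graph_alpha {R q L U V A psi T w0 S Fp psip Hp Hh} Thp {Pe Fe} rho {U0 Up} pi alpha prhd X _.

(* Main.v *)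
(** The unitary [Vh] restricts to a bijection between algebraic cores: it sends
    x f (x) v to sum x_(1) f' (x) x_(2) v, because its slices are left
    multiplications, and the antipode gives the inverse.  Both sides of the
    theorem are therefore closures of operators on one core, and it remains to
    intertwine 1 (x) pi(X) with (pi (x) pi_rhd) alpha(X), which is multiplicative
    in X and thus a question about generators.

    For E_r it is the identity x e_r = e_r (x <| K) + x <| E_r, obtained by
    letting E_r act on the q-commutation b_w x = q^c x b_w; the case of F_r
    follows by applying the star.  The q-commutation has to hold in Pol_q(K)
    itself, whereas the relations of Pol_q(K)_ext only give it up to the kernel
    of Pol_q(K) -> Pol_q(K)_ext.  That kernel contains no nonzero combination of
    the b_w, and the b_w span the elements of Pol_q(K) killed by all F_r on both
    sides; since F_r, acting from either side, maps a failure of q-commutation to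
    another one, with shifted weights, there is none.  This needs eta_w to be a
    lowest weight vector, hence some theory of the Weyl group, which is read off
    the weights of the irreducible modules. *)
Require Import Defs.
From HB Require Import structures.
From mathcomp Require Import all_boot all_order all_algebra.
From mathcomp Require Import finmap monalg complex.
From mathcomp Require Import ring lra zify.
From mathcomp Require Import all_classical all_reals all_analysis.
Import Order.TTheory GRing.Theory Num.Theory numFieldNormedType.Exports.

Set Implicit Arguments.
Unset Strict Implicit.
Unset Printing Implicit Defensive.

Local Open Scope classical_set_scope.
Local Open Scope ring_scope.

(** * Linear algebra and presentations *)

(** The right-hand operator is prescribed on expressions v (x) y, and nothing assumed says that
    equal vectors of the Hilbert space have equal images. It is therefore handled through its graph.
    That this graph is single-valued is transported by the isometry [Vh] from 1 (x) pi(X), which has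
    a densely defined formal adjoint; the same fact allows two intertwining relations to be
    composed, so that the good X form a subalgebra. A second difficulty is the degree in P. Since f
    acts on the component of degree chi through f(-chi), an operator pi(X) of degree d translates by
    d the function that accompanies a vector. For the generators this translation is the one that
    pi_a prescribes in pi_rhd, which is why the degrees of k_w, l_w, e_r and f_r are computed on
    their own. The normalisation (1 - q_r^2)^-1 of e_r is forced: 1 - q_r^2 is the coefficient with
    which x <| E_r appears when E_r acts on the q-commutation of x with b at the r-th fundamental
    weight. *)

Section Linear.
Variable R : realType.
Local Notation C := R[i].
Implicit Types U V W : lmodType C.

Lemma linD U V (f : U -> V) : linear f -> {morph f : x y / x + y}.
Proof. by move=> fl x y; have := fl 1 x y; rewrite !scale1r. Qed.

Lemma lin0 U V (f : U -> V) : linear f -> f 0 = 0.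
Proof. by move=> fl; have := fl (-1) 0 0; rewrite scaler0 addr0 scaleN1r addNr. Qed.

Lemma linZ U V (f : U -> V) : linear f -> forall c, {morph f : x / c *: x}.
Proof. by move=> fl c x; have := fl c x 0; rewrite !addr0 (lin0 fl) addr0. Qed.

Lemma linN U V (f : U -> V) : linear f -> {morph f : x / - x}.
Proof. by move=> fl x; rewrite -scaleN1r (linZ fl) scaleN1r. Qed.

Lemma linB U V (f : U -> V) : linear f -> {morph f : x y / x - y}.
Proof. by move=> fl x y; rewrite (linD fl) (linN fl). Qed.

Lemma lin_sum U V (f : U -> V) (J : Type) (s : seq J) (P : pred J) (F : J -> U) :
  linear f -> f (\sum_(j <- s | P j) F j) = \sum_(j <- s | P j) f (F j).
Proof. by move=> fl; rewrite (big_morph f (linD fl) (lin0 fl)). Qed.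

Lemma lin_comp U V W (f : V -> W) (g : U -> V) :
  linear f -> linear g -> linear (fun x => f (g x)).
Proof. by move=> fl gl c x y; rewrite gl fl. Qed.

Lemma lin_sumf U V (J : Type) (s : seq J) (F : J -> U -> V) :
  (forall j, linear (F j)) -> linear (fun x => \sum_(j <- s) F j x).
Proof.
move=> Fl c x y; rewrite scaler_sumr -big_split.
by apply: eq_bigr => j _; rewrite Fl.
Qed.

Lemma lin_addf U V (f g : U -> V) : linear f -> linear g -> linear (fun x => f x + g x).
Proof. by move=> fl gl c x y; rewrite fl gl scalerDr addrACA. Qed.

Lemma lin_scalef U V (a : C) (f : U -> V) : linear f -> linear (fun x => a *: f x).
Proof. by move=> fl c x y; rewrite fl scalerDr !scalerA mulrC. Qed.

Lemma lin_coef U V (f : U -> C) (v : V) : scalar f -> linear (fun x => f x *: v).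
Proof. by move=> fl c x y; rewrite fl scalerDl scalerA. Qed.

Lemma lin_id U : linear (fun x : U => x).
Proof. by []. Qed.

Definition bilin U V W (f : U -> V -> W) :=
  (forall y, linear (f ^~ y)) /\ (forall x, linear (f x)).

Lemma tens_eq_bilin U V W (s t : seq (U * V)) (f : U -> V -> W) :
  bilin f -> tens_eq s t ->
  \sum_(p <- s) f p.1 p.2 = \sum_(p <- t) f p.1 p.2.
Proof.
move=> [fl fr] st.
have fb : bilinear_for *:%R *:%R f by split=> x c y z; [exact: fl|exact: fr].
pose g : {bilinear U -> V -> W} := HB.pack f (bilinear_isBilinear.Build _ _ _ _ _ _ f fb).
exact: (st W g).
Qed.

Section TensHom.
Variables (A B D : algType C) (a : A -> seq (B * D)).
Hypothesis ah : tens_hom a.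

Lemma tens_lin V (f : B -> D -> V) : bilin f -> linear (fun x => \sum_(p <- a x) f p.1 p.2).
Proof.
move=> fb c x y; have [al _ _] := ah.
rewrite (tens_eq_bilin fb (al c x y)) big_cat big_map /= scaler_sumr.
by congr (_ + _); apply: eq_bigr => p _; rewrite (linZ (fb.1 _)).
Qed.

Lemma tens_one V (f : B -> D -> V) : bilin f -> \sum_(p <- a 1) f p.1 p.2 = f 1 1.
Proof. by move=> fb; have [_ a1 _] := ah; rewrite (tens_eq_bilin fb a1) big_seq1. Qed.

Lemma tens_mul V (f : B -> D -> V) x y : bilin f ->
  \sum_(p <- a (x * y)) f p.1 p.2 =
  \sum_(p <- a x) \sum_(r <- a y) f (p.1 * r.1) (p.2 * r.2).
Proof.
by move=> fb; have [_ _ am] := ah; rewrite (tens_eq_bilin fb (am x y)) big_allpairs_dep.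
Qed.
End TensHom.

Section Span.
Variables (V : lmodType C) (S : set V).

Lemma lspan_in v : S v -> lspan S v.
Proof.
move=> Sv; exists 1%N, (fun=> 1), (fun=> v); split=> //.
by rewrite big_ord_recl big_ord0 addr0 scale1r.
Qed.

Lemma lspan_ind (P : V -> Prop) : (forall v, S v -> P v) -> P 0 ->
  (forall c x y, P x -> P y -> P (c *: x + y)) -> forall v, lspan S v -> P v.
Proof.
move=> PS P0 PL v [n [c [u [Su ->]]]]; elim: n c u Su => [|n IHn] c u Su.
  by rewrite big_ord0.
by rewrite big_ord_recl; apply: PL; [exact: PS|exact: IHn].
Qed.

Lemma lspan0 : lspan S 0.
Proof. by exists 0%N, (fun=> 0), (fun=> 0); split; [case|rewrite big_ord0]. Qed.

Lemma lspan_lin c x y : lspan S x -> lspan S y -> lspan S (c *: x + y).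
Proof.
move=> [n [a [u [Su ->]]]] [m [b [v [Sv ->]]]].
exists (n + m)%N, (fun i => match fintype.split i with inl j => c * a j | inr j => b j end).
exists (fun i => match fintype.split i with inl j => u j | inr j => v j end); split.
  by move=> i; case: fintype.split.
rewrite big_split_ord /= scaler_sumr; congr (_ + _); apply: eq_bigr => i _.
  by rewrite -[lshift m i]/(unsplit (inl i)) unsplitK scalerA.
by rewrite -[rshift n i]/(unsplit (inr i)) unsplitK.
Qed.

Lemma lspanD x y : lspan S x -> lspan S y -> lspan S (x + y).
Proof. by move=> Sx Sy; rewrite -[x]scale1r; exact: lspan_lin. Qed.

Lemma lspanZ c x : lspan S x -> lspan S (c *: x).
Proof. by move=> Sx; rewrite -[_ *: _]addr0; apply: lspan_lin => //; exact: lspan0. Qed.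

Lemma lspan_sum (J : Type) (s : seq J) (P : pred J) (F : J -> V) :
  (forall j, P j -> lspan S (F j)) -> lspan S (\sum_(j <- s | P j) F j).
Proof. by move=> SF; elim/big_ind: _ => //; [exact: lspan0|exact: lspanD]. Qed.

End Span.

Lemma linear_on_lspan (V W : lmodType C) (S : set V) (f : V -> W) :
  linear_on (lspan S) f ->
  [/\ f 0 = 0, forall c x, lspan S x -> f (c *: x) = c *: f x
    & forall (J : Type) (s : seq J) (P : pred J) (F : J -> V),
      (forall j, P j -> lspan S (F j)) ->
      f (\sum_(j <- s | P j) F j) = \sum_(j <- s | P j) f (F j)].
Proof.
move=> fl; have f0 : f 0 = 0.
  by have := fl (-1) 0 0 (lspan0 S) (lspan0 S); rewrite scaler0 addr0 scaleN1r addNr.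
split=> // [c x Sx|J s P F SF].
  by have := fl c x 0 Sx (lspan0 S); rewrite !addr0 f0 addr0.
suff [] : f (\sum_(j <- s | P j) F j) = \sum_(j <- s | P j) f (F j) /\
  lspan S (\sum_(j <- s | P j) F j) by [].
elim: s => [|j s [IHs1 IHs2]]; first by rewrite !big_nil f0; split=> //; exact: lspan0.
rewrite !big_cons; case: ifP => // Pj.
by have := fl 1 _ _ (SF j Pj) IHs2; rewrite !scale1r => ->; rewrite IHs1; split=> //;
  apply: lspanD => //; exact: SF.
Qed.

End Linear.

(** * Induction over algebras given by generators and relations *)

Section Subalgebra.
Variables (R : realType) (A : algType R[i]) (Q : A -> Prop).
Local Notation C := R[i].

Definition subalg_prop :=
  [/\ Q 1, forall c x y, Q x -> Q y -> Q (c *: x + y) & forall x y, Q x -> Q y -> Q (x * y)].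

Hypothesis Qc : subalg_prop.

Let subp : A -> bool := fun x => `[< Q x >].

Let subpP : subalg_closed subp.
Proof.
have [Q1 QL QM] := Qc; split=> [|c x y|x y]; rewrite -!topredE /=; first exact/asboolP.
  by move=> Qx Qy; apply/asboolP; apply: QL; apply/asboolP.
by move=> Qx Qy; apply/asboolP; apply: QM; apply/asboolP.
Qed.

HB.instance Definition _ := GRing.isSubalgClosed.Build C A subp (GRing.subalg_closed_semi subpP).

Let sub_of := {x : A | x \in subp}.
HB.instance Definition _ := SubChoice.on sub_of.
HB.instance Definition _ := [SubChoice_isSubAlgebra of sub_of by <:].

(** Presentations allow arbitrary predicates as relations; this is the condition under which a
    relation descends to the subalgebra cut out by [Q]. *)
Definition transfers (G : Type) (rel : forall B : algType C, (G -> B) -> Prop) :=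
  forall (B B' : algType C) (i : B -> B') (b : G -> B),
    alg_hom i -> injective i -> rel B' (fun g => i (b g)) -> rel B b.

(** The generators satisfy the relations inside the subalgebra of elements with [Q], so the
    universal property maps [A] into it. Followed by the inclusion, this map is the identity by
    uniqueness. *)
Lemma presents_ind (G : Type) (rel : forall B : algType C, (G -> B) -> Prop)
    (gen : G -> A) : transfers rel -> presents rel gen ->
  (forall g, Q (gen g)) -> forall x, Q x.
Proof.
move=> trel [genP genU] Qg x.
have mem g : gen g \in subp by apply/asboolP.
pose i : sub_of -> A := val.
have ih : alg_hom i by split=> *; rewrite /i ?linearP ?rmorph1 ?rmorphM.
pose b g : sub_of := exist _ (gen g) (mem g).
have [|h [hh hg _]] := genU sub_of b; first by apply: (trel _ _ i) => //; exact: val_inj.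
have [k [_ _ ku]] := genU A gen genP.
have [hl h1 hM] := hh.
have e1 : (fun x => i (h x)) =1 k.
  apply: ku => [|g]; last by rewrite hg.
  by split=> [c y z||y z]; rewrite ?hl ?h1 ?hM ?/i ?linearP ?rmorph1 ?rmorphM.
have e2 : id =1 k by apply: ku.
have -> : x = i (h x) by rewrite e1 -e2.
by apply/asboolP; exact: (valP (h x)).
Qed.

End Subalgebra.

Section MalgExt.
Variables (R : realType) (K : choiceType).
Local Notation C := R[i].
Variables (W : lmodType C) (F : K -> W).

Definition mext (x : {malg C[K]}) : W := \sum_(k <- msupp x) x@_k *: F k.

(** Supports vary with the element, so linearity is checked over one finite set containing all of
    them. *)
Lemma mextEw (D : {fset K}) (x : {malg C[K]}) : (msupp x `<=` D)%fset ->
  mext x = \sum_(k <- D) x@_k *: F k.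
Proof.
move=> xD; apply: big_fset_incl => // k _ /mcoeff_outdom ->; exact: scale0r.
Qed.

Lemma mext_lin : linear mext.
Proof.
move=> c x y; pose D := (msupp (c *: x + y) `|` (msupp x `|` msupp y))%fset.
rewrite !(@mextEw D) ?fsubsetUl // /D; last 2 first.
- by rewrite fsubsetU // fsubsetUr orbT.
- by rewrite fsubsetU // fsubsetUl orbT.
rewrite scaler_sumr -big_split; apply: eq_bigr => k _.
by rewrite mcoeffD mcoeffZ scalerDl scalerA.
Qed.

Lemma mextU k : mext << k >> = F k.
Proof. by rewrite /mext msuppU oner_eq0 big_seq_fset1 mcoeffUU scale1r. Qed.

End MalgExt.

Lemma malg_basis (R : realType) (K : choiceType) (x : {malg R[i][K]}) :
  x = \sum_(k <- msupp x) x@_k *: << k >>.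
Proof.
rewrite {1}[x]monalgE; apply: eq_bigr => k _; apply/malgP => k'.
by rewrite mcoeffZ !mcoeffU mulr_natr.
Qed.

Lemma malg_ind (R : realType) (K : choiceType) (Q : {malg R[i][K]} -> Prop) :
  (forall k, Q << k >>) -> Q 0 -> (forall c x y, Q x -> Q y -> Q (c *: x + y)) ->
  forall x, Q x.
Proof.
move=> Qk Q0 QL x; rewrite [x]malg_basis; elim/big_rec: _ => // k y _ Qy.
exact: QL.
Qed.

Lemma malg_lin_eq (R : realType) (K : choiceType) (W : lmodType R[i])
    (f g : {malg R[i][K]} -> W) : linear f -> linear g ->
  (forall k, f << k >> = g << k >>) -> f =1 g.
Proof.
move=> fl gl fg; apply: malg_ind => // [|c x y]; first by rewrite (lin0 fl) (lin0 gl).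
by rewrite fl gl => -> ->.
Qed.

Section AlgHom.
Variables (R : realType) (A B : algType R[i]) (h : A -> B).
Hypothesis hh : alg_hom h.

Lemma alg_hom_lin : linear h. Proof. by case: hh. Qed.
Lemma alg_hom1 : h 1 = 1. Proof. by case: hh. Qed.
Lemma alg_homM x y : h (x * y) = h x * h y. Proof. by case: hh. Qed.
Lemma alg_homX x n : h (x ^+ n) = h x ^+ n.
Proof. by elim: n => [|n IHn]; rewrite ?expr0 ?alg_hom1 // !exprS alg_homM IHn. Qed.
End AlgHom.

Section RelTransfer.
Variables (R : realType) (q : R) (L : rootDatum R).
Local Notation C := R[i].

Lemma serre_transfers (B B' : algType C) (h : B -> B') (e : 'I_(rk L) -> B) :
  alg_hom h -> injective h -> serre q (fun r => h (e r)) -> serre q e.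
Proof.
move=> hh hi se r s rs N; apply: hi; rewrite (lin0 (alg_hom_lin hh)).
rewrite (lin_sum _ _ _ (alg_hom_lin hh)) -[RHS](se r s rs).
apply: eq_bigr => k _.
by rewrite (linZ (alg_hom_lin hh)) !(alg_homM hh) !(alg_homX hh).
Qed.

Lemma rel_g_transfers : transfers (@rel_g R q L).
Proof.
move=> B B' h b hh hi [[K0 KK] KE KF [sE sF] EF].
have hM := alg_homM hh; have hZ := linZ (alg_hom_lin hh).
split.
- by split=> [|v w]; apply: hi; rewrite ?hM ?KK // (alg_hom1 hh).
- by move=> w r; apply: hi; rewrite hZ !hM KE.
- by move=> w r; apply: hi; rewrite hZ !hM KF.
- by split; apply: serre_transfers hh hi _.
- move=> r s; apply: hi; rewrite (linB (alg_hom_lin hh)) !hM EF.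
  by case: ifP => _; rewrite ?(lin0 (alg_hom_lin hh)) // hZ (linB (alg_hom_lin hh)).
Qed.

Lemma rel_zero_transfers : transfers (@rel_zero R q L).
Proof.
move=> B B' h b hh hi [[[K0 KK] [L0 LL] KE LF [sE sF]] [KL LE KF EF]].
have hM := alg_homM hh; have hZ := linZ (alg_hom_lin hh).
split; split.
- by split=> [|v w]; apply: hi; rewrite ?hM ?KK // (alg_hom1 hh).
- by split=> [|v w]; apply: hi; rewrite ?hM ?LL // (alg_hom1 hh).
- by move=> w r; apply: hi; rewrite hZ !hM KE.
- by move=> w r; apply: hi; rewrite hZ !hM LF.
- by split; apply: serre_transfers hh hi _.
- by move=> v w; apply: hi; rewrite hZ !hM KL.
- by move=> w r; apply: hi; rewrite hZ !hM LE.
- by move=> w r; apply: hi; rewrite hZ !hM KF.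
- move=> r s; apply: hi; rewrite (linB (alg_hom_lin hh)) !hM EF.
  by case: ifP => _; rewrite ?(lin0 (alg_hom_lin hh)) // (linN (alg_hom_lin hh)) hZ.
Qed.
End RelTransfer.

(** A finite sequence from [S] whose span has maximal dimension absorbs every further element of
    [S]. *)
Lemma lspan_seq (R : realType) (V : vectType R[i]) (S : set V) :
  exists s : seq V, (forall v, v \in s -> S v) /\
    forall v, (v \in span s) <-> lspan S v.
Proof.
pose D n := `[< exists s : seq V, (forall v, v \in s -> S v) /\ \dim (span s) = n >].
have [|n|n] := @ex_maxnP D (dim V).
- by exists 0%N; apply/asboolP; exists [::]; split=> //; rewrite span_nil dimv0.
- by move=> /asboolP [s [_ <-]]; rewrite -dimvf dimvS ?subvf.
move=> /asboolP [s [Ss ds]] nmax; exists s; split=> // v; split.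
  move=> /(@coord_span _ _ _ (in_tuple s)) ->; apply: lspan_sum => i _.
  by apply/lspanZ/lspan_in/Ss/mem_nth.
move: v; apply: (@lspan_ind _ _ S (fun v => v \in span s : Prop)) => [v Sv||c x y xs ys];
  last 2 first.
- exact: mem0v.
- by rewrite memvD ?memvZ.
have sub : (span s <= span (v :: s))%VS by apply: sub_span => x; rewrite inE orbC => ->.
have /eqP -> : (span s == span (v :: s))%VS; last by rewrite memv_span ?mem_head.
rewrite eqEdim sub ds; apply: nmax; apply/asboolP; exists (v :: s); split=> // u.
by rewrite inE => /predU1P [->|/Ss].
Qed.

Lemma lspan_vspace (R : realType) (V : vectType R[i]) (S : set V) :
  exists W : {vspace V}, forall v, (v \in W) <-> lspan S v.
Proof. by have [s [_ sP]] := lspan_seq S; exists (span s). Qed.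

Section Cpow.
Variables (R : realType) (q : R).
Hypothesis q_gt0 : 0 < q.

Lemma cpow0 : cpow q 0 = 1.
Proof. by rewrite /cpow powRr0. Qed.

Lemma cpowD x y : cpow q (x + y) = cpow q x * cpow q y.
Proof. by rewrite /cpow powRD ?rmorphM //= (gt_eqF q_gt0) implybT. Qed.

Lemma cpow_conj x : (cpow q x)^* = cpow q x.
Proof. by rewrite /cpow conj_Creal // complex_real. Qed.

Lemma cpow_neq0 x : cpow q x != 0.
Proof.
by rewrite /cpow (inj_eq (@complexI R)) /= gt_eqF // powR_gt0.
Qed.

Lemma cpow_inj : q != 1 -> injective (cpow q).
Proof.
move=> q1 x y /complexI; rewrite /powR (gt_eqF q_gt0) => /expR_inj.
by apply: mulIf; rewrite ln_eq0.
Qed.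

End Cpow.

Section InnerProduct.
Variables (R : realType) (V : lmodType R[i]) (ip : V -> V -> R[i]).
Hypothesis ipI : is_inner ip.
Local Notation C := R[i].

Lemma inner_linr x : scalar (ip x). Proof. by case: ipI. Qed.
Lemma innerC x y : ip y x = (ip x y)^*. Proof. by case: ipI. Qed.
Lemma inner_eq0 x : ip x x = 0 -> x = 0. Proof. by case: ipI => _ _ _; apply. Qed.

Lemma inner0r x : ip x 0 = 0. Proof. exact: (lin0 (V := C^o) (inner_linr x)). Qed.
Lemma inner0l x : ip 0 x = 0. Proof. by rewrite innerC inner0r conjC0. Qed.

Lemma inner_linl c x y z : ip (c *: x + y) z = c^* * ip x z + ip y z.
Proof. by rewrite innerC inner_linr rmorphD rmorphM /= -!innerC. Qed.

Lemma innerZr c x y : ip x (c *: y) = c * ip x y.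
Proof. exact: (linZ (V := C^o) (inner_linr x)). Qed.

Lemma innerZl c x y : ip (c *: x) y = c^* * ip x y.
Proof. by rewrite -[_ *: x]addr0 inner_linl inner0l addr0. Qed.

Lemma innerBr x y z c : ip x (y - c *: z) = ip x y - c * ip x z.
Proof. by rewrite addrC -scaleNr inner_linr mulNr addrC. Qed.

Lemma inner_sumr (J : Type) (s : seq J) (F : J -> V) x :
  ip x (\sum_(j <- s) F j) = \sum_(j <- s) ip x (F j).
Proof. exact: (lin_sum (V := C^o) _ _ _ (inner_linr x)). Qed.

Lemma inner_span_eq0 (S : set V) x y :
  (forall z, S z -> ip x z = 0) -> lspan S y -> ip x y = 0.
Proof.
move=> xS; move: y; apply: (@lspan_ind _ _ _ (fun y => ip x y = 0)) => //.
  exact: inner0r.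
by move=> c y z xy xz; rewrite inner_linr xy xz mulr0 addr0.
Qed.

Lemma orthogonal_span_eq0 (S : set V) x :
  (forall z, S z -> ip x z = 0) -> lspan S x -> x = 0.
Proof. by move=> xS Sx; apply: inner_eq0; exact: inner_span_eq0 Sx. Qed.

Lemma inner_ge0 x : 0 <= ip x x. Proof. by case: ipI. Qed.

Lemma cauchy_schwarz x y : `|ip x y| ^+ 2 <= ip x x * ip y y.
Proof.
have [->|y0] := eqVneq y 0; first by rewrite inner0r inner0l normr0 expr0n mulr0.
have yy : 0 < ip y y.
  by rewrite lt_def inner_ge0 andbT; apply: contra_neq y0; exact: inner_eq0.
pose k := ip y x / ip y y.
pose z := (- k) *: y + x.
have yz : ip y z = 0 by rewrite inner_linr mulNr divfK ?gt_eqF // addNr.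
have := inner_ge0 z; rewrite {1}/z inner_linl yz mulr0 add0r inner_linr mulNr addrC subr_ge0.
by rewrite -(ler_pM2r yy) mulrAC divfK ?gt_eqF // normCK -innerC mulrC.
Qed.

End InnerProduct.

Section OrthogonalProjection.
Variables (R : realType) (V : vectType R[i]) (ip : V -> V -> R[i]).
Hypothesis ipI : is_inner ip.
Local Notation inner0r := (inner0r ipI).
Local Notation inner_linr := (inner_linr ipI).
Local Notation inner_linl := (inner_linl ipI).
Local Notation inner_eq0 := (inner_eq0 ipI).
Local Notation innerBr := (innerBr ipI).
Local Notation innerC := (innerC ipI).

(** Induction on the dimension: project onto the part of [W] orthogonal to one nonzero vector [e],
    then add the component of the remainder along [e]. *)
Lemma orthogonal_projection (W : {vspace V}) (x : V) :
  exists2 y, y \in W & forall z, z \in W -> ip (x - y) z = 0.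
Proof.
elim: {W}(\dim W) {-2}W (leqnn (\dim W)) => [|n IHn] W dW.
  exists 0; first exact: mem0v.
  move: dW; rewrite leqn0 dimv_eq0 => /eqP -> z.
  by rewrite memv0 => /eqP ->; rewrite inner0r.
have [W0|Wn0] := eqVneq W 0%VS.
  by apply: IHn; rewrite W0 dimv0.
pose e := vpick W; have eW : e \in W by exact: memv_pick.
have en0 : e != 0 by rewrite vpick0.
have een0 : ip e e != 0 by apply: contra_neq en0; exact: inner_eq0.
have [W' W'P] := lspan_vspace [set z : V | z \in W /\ ip e z = 0].
have mem' z : z \in W' <-> z \in W /\ ip e z = 0.
  split=> [/W'P|zW]; last by apply/W'P/lspan_in.
  move: z; apply: (@lspan_ind _ _ _ (fun z => z \in W /\ ip e z = 0)) =>
    [z //||c a b [aW ea] [bW eb]].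
    by rewrite mem0v inner0r.
  by rewrite memvD ?memvZ // inner_linr ea eb mulr0 addr0.
have dW' : (\dim W' <= n)%N.
  rewrite -ltnS; apply: leq_trans dW; rewrite ltn_neqAle dimvS ?andbT; last first.
    by apply/subvP => z /mem' [].
  apply: contra_neq een0 => dd.
  have /eqP W'W : W' == W.
    by rewrite eqEdim dd leqnn andbT; apply/subvP => z /mem' [].
  by have /mem' [] : e \in W' by rewrite W'W.
have [y yW' yP] := IHn W' dW'.
exists (y + (ip e (x - y) / ip e e) *: e).
  by rewrite memvD ?memvZ //; case/mem': yW'.
move=> z zW; set k := ip e (x - y) / ip e e.
have /mem' zW' : z - (ip e z / ip e e) *: e \in W /\ ip e (z - (ip e z / ip e e) *: e) = 0.
  split; first by rewrite memvB ?memvZ.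
  by rewrite innerBr divfK // subrr.
have /eqP := yP _ zW'; rewrite innerBr subr_eq0 => /eqP yz.
have -> : x - (y + k *: e) = (- k) *: e + (x - y) by rewrite opprD addrA addrC scaleNr.
rewrite inner_linl yz (innerC e (x - y)) /k rmorphN rmorphM /= fmorphV /=.
have -> : (ip e e)^* = ip e e by rewrite -innerC.
by rewrite mulNr mulrAC [X in _ + X]mulrAC [X in _ + X / _]mulrC addNr.
Qed.

End OrthogonalProjection.

(** * Irreducible modules *)

Section Weights.
Variables (R : realType) (q : R) (q_gt0 : 0 < q) (L : rootDatum R) (U : uqK q L).
Local Notation C := R[i].
Local Notation P := 'rV[int]_(rk L).
Local Notation I := 'I_(rk L).
Local Notation qp x := (cpow q x).
Local Notation uK w := (uk_gen U (gK w)).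
Local Notation uE r := (uk_gen U (gE r)).
Local Notation uF r := (uk_gen U (gF r)).

Lemma uk_rel : rel_g q (uk_gen U). Proof. by have [] := uk_presents U. Qed.

Lemma uK0 : uK 0 = 1. Proof. by have [[]] := uk_rel. Qed.
Lemma uKD v w : uK v * uK w = uK (v + w). Proof. by have [[]] := uk_rel. Qed.
Lemma uKE w r : uK w * uE r = qp (wip w (sroot L r)) *: (uE r * uK w).
Proof. by have [_] := uk_rel. Qed.
Lemma uKF w r : uK w * uF r = qp (- wip w (sroot L r)) *: (uF r * uK w).
Proof. by have [_ _] := uk_rel. Qed.

Lemma wipDr (u v w : P) : wip u (v + w) = wip u v + wip u w. Proof. exact: wipD. Qed.
Lemma wip0r (u : P) : wip u 0 = 0.
Proof. by apply: (addIr (wip u 0)); rewrite -wipD !add0r. Qed.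
Lemma wipNr (u v : P) : wip u (- v) = - wip u v.
Proof. by apply: (addIr (wip u v)); rewrite -wipD !addNr wip0r. Qed.
Lemma wipBr (u v w : P) : wip u (v - w) = wip u v - wip u w.
Proof. by rewrite wipD wipNr. Qed.
Lemma wipDl (u v w : P) : wip (v + w) u = wip v u + wip w u.
Proof. by rewrite ![wip _ u]wipC wipD. Qed.
Lemma wip0l (u : P) : wip 0 u = 0. Proof. by rewrite wipC wip0r. Qed.
Lemma wipNl (u v : P) : wip (- v) u = - wip v u.
Proof. by rewrite ![wip _ u]wipC wipNr. Qed.

Section Irrep.
Variables (w : P) (V : irrep U w).

Lemma act_linl (v : V) : linear (fun X => ir_act X v). Proof. by have [] := ir_rep V. Qed.
Lemma act_linr X : linear (@ir_act _ _ _ _ _ V X). Proof. by have [] := ir_rep V. Qed.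
Lemma act1 (v : V) : ir_act 1 v = v. Proof. by have [] := ir_rep V. Qed.
Lemma actM X Y (v : V) : ir_act (X * Y) v = ir_act X (ir_act Y v).
Proof. by have [] := ir_rep V. Qed.

Lemma has_wt_E r (v : V) m : has_wt v m -> has_wt (ir_act (uE r) v) (m + sroot L r).
Proof.
move=> vm w'; rewrite -actM uKE (linZ (act_linl v)) actM vm (linZ (act_linr _)) scalerA.
by rewrite -cpowD // wipDr addrC.
Qed.

Lemma has_wt_F r (v : V) m : has_wt v m -> has_wt (ir_act (uF r) v) (m - sroot L r).
Proof.
move=> vm w'; rewrite -actM uKF (linZ (act_linl v)) actM vm (linZ (act_linr _)) scalerA.
by rewrite -cpowD // wipBr addrC.
Qed.

Lemma has_wt_hw : has_wt (ir_hw V) w. Proof. exact: ir_hw_K. Qed.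

Lemma has_wtZ c (v : V) m : has_wt v m -> has_wt (c *: v) m.
Proof. by move=> vm w'; rewrite (linZ (act_linr _)) vm !scalerA mulrC. Qed.

Lemma irrep_lspan (S : set V) (v0 : V) :
  (forall g v, S v -> lspan S (ir_act (uk_gen U g) v)) -> S v0 -> v0 != 0 ->
  forall v, lspan S v.
Proof.
move=> SU Sv0 v0n0.
have act X v : lspan S v -> lspan S (ir_act X v).
  move: X v; apply: (presents_ind _ (@rel_g_transfers R q L) (uk_presents U)).
    split=> [v|c X Y QX QY v Sv|X Y QX QY v Sv]; first by rewrite act1.
      by rewrite act_linl; apply: lspan_lin; [exact: QX|exact: QY].
    by rewrite actM; exact/QX/QY.
  move=> g; apply: (@lspan_ind _ _ _ (fun v => lspan S (ir_act (uk_gen U g) v))) => //.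
  - exact: SU.
  - by rewrite (lin0 (act_linr _)); exact: lspan0.
  - by move=> c x y Sx Sy; rewrite act_linr; exact: lspan_lin.
have [W WP] := lspan_vspace S => v; apply/WP.
have [|W0|->] := @ir_irreducible _ _ _ _ _ V W; last exact: memvf.
  by move=> X u /WP Su; apply/WP; exact: act.
by move: v0n0; rewrite -memv0 -W0; have /WP -> := lspan_in Sv0.
Qed.

Lemma hw_neq0 : ir_hw V != 0.
Proof.
apply/eqP => hw0; have := ir_hw_unit V; have [ip _ _ _] := ir_inner V.
by rewrite hw0 (lin0 (V := C^o) (ip 0)) => /esym /eqP; rewrite oner_eq0.
Qed.

(** The generators send weight vectors to weight vectors, so irreducibility yields the weight
    decomposition without diagonalising any [uK]. *)
Lemma wt_spanT (v : V) : lspan [set v : V | exists m, has_wt v m] v.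
Proof.
apply: (@irrep_lspan _ (ir_hw V)) hw_neq0 v; last by exists w; exact: has_wt_hw.
move=> [w'|r|r] v [m vm]; apply: lspan_in.
+ by exists m; rewrite vm; exact: has_wtZ.
+ by exists (m + sroot L r); exact: has_wt_E.
+ by exists (m - sroot L r); exact: has_wt_F.
Qed.

End Irrep.

Variable V : forall w : domw L, irrep U (val w).
Variable A : polK V.

Lemma pk_linl X : scalar (fun x : A => pk_pair x X).
Proof. by have [[]] := pk_pairing A. Qed.
Lemma pk_linr (x : A) : scalar (pk_pair x).
Proof. by have [[]] := pk_pairing A. Qed.
Lemma pk_mul (x y : A) X :
  pk_pair (x * y) X = \sum_(p <- cop X) pk_pair x p.1 * pk_pair y p.2.
Proof. by have [_ []] := pk_pairing A. Qed.
Lemma pk_pairM (x : A) X Y :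
  pk_pair x (X * Y) = \sum_(p <- cop x) pk_pair p.1 X * pk_pair p.2 Y.
Proof. by have [_ _ []] := pk_pairing A. Qed.
Lemma pk_pair1 (x : A) : pk_pair x 1 = counit x.
Proof. by have [_ _ []] := pk_pairing A. Qed.
Lemma pk_star (x : A) X : pk_pair (star x) X = (pk_pair x (star (antipode X)))^*.
Proof. by have [] := pk_pairing A. Qed.

Lemma pk_inj (x y : A) : (forall X, pk_pair x X = pk_pair y X) -> x = y.
Proof.
move=> xy; apply/eqP; rewrite -subr_eq0; apply/eqP; apply: (pk_sep (p := A)) => X.
by rewrite (linB (V := C^o) (pk_linl X)) xy subrr.
Qed.

Lemma ip_linr w (v : V w) : scalar (ir_ip v). Proof. by have [] := ir_inner (V w). Qed.
Lemma ipC w (v u : V w) : ir_ip u v = (ir_ip v u)^*.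
Proof. by have [] := ir_inner (V w). Qed.

Lemma mcoef_linr w (v : V w) : linear (mcoef A v).
Proof.
move=> c x y; apply: pk_inj => X.
by rewrite pk_linl !mcoefE act_linr ip_linr.
Qed.

Lemma mcoef_linl w (u : V w) c (v v' : V w) :
  mcoef A (c *: v + v') u = c^* *: mcoef A v u + mcoef A v' u.
Proof.
apply: pk_inj => X; rewrite pk_linl !mcoefE ipC ip_linr rmorphD rmorphM /=.
by rewrite -!ipC.
Qed.

Lemma polK_ind (Q : A -> Prop) :
  (forall w (v u : V w) l m, has_wt v l -> has_wt u m -> Q (mcoef A v u)) ->
  Q 0 -> (forall c x y, Q x -> Q y -> Q (c *: x + y)) -> forall x, Q x.
Proof.
move=> Qm Q0 Ql x; have : [set: A] x by [].
rewrite -(pk_span A); move: x; apply: (@lspan_ind _ _ _ Q) => // x [w [v [u ->]]].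
have Qc w' (v' u' : V w') l : has_wt v' l -> Q (mcoef A v' u').
  move=> vl; move: (wt_spanT u'); move: u'.
  apply: (@lspan_ind _ _ _ (fun u => Q (mcoef A v' u))) => [u' [m um]||c a b Qa Qb].
  - exact: Qm vl um.
  - by rewrite (lin0 (mcoef_linr v')).
  - by rewrite mcoef_linr; exact: Ql.
move: (wt_spanT v); move: v.
apply: (@lspan_ind _ _ _ (fun v => Q (mcoef A v u))) => [v [m vm]||c a b Qa Qb].
- exact: Qc vm.
- have /esym := mcoef_linl u (-1) 0 0; rewrite scaler0 addr0 rmorphN1 scaleN1r addNr => <-.
  exact: Q0.
- by rewrite mcoef_linl; exact: Ql.
Qed.

Lemma polK_lin_eq (W : lmodType C) (f g : A -> W) : linear f -> linear g ->
  (forall w (v u : V w) l m, has_wt v l -> has_wt u m -> f (mcoef A v u) = g (mcoef A v u)) ->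
  f =1 g.
Proof.
move=> fl gl fg; apply: polK_ind => //; first by rewrite (lin0 fl) (lin0 gl).
by move=> c x y; rewrite fl gl => -> ->.
Qed.

Lemma bihomog_mcoef w (v u : V w) l m :
  has_wt v l -> has_wt u m -> bihomog l m (mcoef A v u).
Proof. by move=> vl um; apply: lspan_in; exists w, v, u. Qed.

Lemma lhomog_mcoef w (v u : V w) l : has_wt v l -> lhomog l (mcoef A v u).
Proof. by move=> vl; apply: lspan_in; exists w, v, u. Qed.

Lemma cop_lin (W : lmodType C) (f : A -> A -> W) :
  bilin f -> linear (fun x => \sum_(p <- cop x) f p.1 p.2).
Proof. exact/tens_lin/cop_hom. Qed.

(** The translation actions dual to multiplication in [U]. On coefficients [ract] is the action that
    enters e_r (see [ract_mcoef]), and [lact] is the one hidden in pi_rhd. *)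
Definition ract (x : A) (X : U) : A := \sum_(p <- cop x) pk_pair p.1 X *: p.2.
Definition lact (X : U) (x : A) : A := \sum_(p <- cop x) pk_pair p.2 X *: p.1.

Lemma ract_bilin X : bilin (fun x y : A => pk_pair x X *: y).
Proof. by split=> [y|x] c a b; rewrite ?pk_linl ?scalerDl -?scalerA // scalerDr !scalerA mulrC. Qed.
Lemma lact_bilin X : bilin (fun x y : A => pk_pair y X *: x).
Proof. by have [b1 b2] := ract_bilin X; split. Qed.

Lemma ract_linl X : linear (ract^~ X). Proof. exact: (cop_lin (ract_bilin X)). Qed.
Lemma lact_linr X : linear (lact X). Proof. exact: (cop_lin (lact_bilin X)). Qed.
Lemma ract_linr x : linear (ract x).
Proof.
move=> c X Y; rewrite /ract scaler_sumr -big_split; apply: eq_bigr => p _.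
by rewrite pk_linr scalerDl scalerA.
Qed.
Lemma lact_linl x : linear (lact^~ x).
Proof.
move=> c X Y; rewrite /lact scaler_sumr -big_split; apply: eq_bigr => p _.
by rewrite pk_linr scalerDl scalerA.
Qed.

Lemma lact1 x : lact 1 x = x.
Proof. by rewrite /lact -[RHS]counitr; apply: eq_bigr => p _; rewrite pk_pair1. Qed.

Lemma pk_ract x X Y : pk_pair (ract x X) Y = pk_pair x (X * Y).
Proof.
rewrite (lin_sum (V := C^o) _ _ _ (pk_linl Y)) pk_pairM; apply: eq_bigr => p _.
exact: (linZ (V := C^o) (pk_linl Y)).
Qed.

Lemma ract_mcoef w (v u : V w) X : ract (mcoef A v u) X = mcoef A (ir_act (star X) v) u.
Proof. by apply: pk_inj => Y; rewrite pk_ract !mcoefE actM ir_star starK. Qed.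

Lemma ract_mul (x y : A) X :
  ract (x * y) X = \sum_(p <- cop X) ract x p.1 * ract y p.2.
Proof.
rewrite /ract (tens_mul (@cop_hom _ A) _ _ (ract_bilin X)).
under eq_bigr do under eq_bigr do rewrite pk_mul scaler_suml.
rewrite [RHS](eq_bigr (fun p => \sum_(s <- cop x) \sum_(t <- cop y)
   (pk_pair s.1 p.1 * pk_pair t.1 p.2) *: (s.2 * t.2))); last first.
  move=> p _; rewrite mulr_suml; apply: eq_bigr => s _; rewrite mulr_sumr.
  by apply: eq_bigr => t _; rewrite -scalerAl -scalerAr scalerA.
rewrite [RHS]exchange_big /=; apply: eq_bigr => s _.
by rewrite [RHS]exchange_big.
Qed.

(** Coassociativity moves a translation from the second leg of the coproduct to the first. The
    second leg will act on the Fock space and the first will carry pi_rhd, so right translations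
    produced by commutation become the left translations of pi_rhd. *)
Lemma coassoc_act (W : lmodType C) (f : A -> A -> W) (x : A) X : bilin f ->
  \sum_(p <- cop x) f p.1 (ract p.2 X) = \sum_(p <- cop x) f (lact X p.1) p.2.
Proof.
move=> [fl fr].
transitivity (\sum_(p <- cop x) \sum_(r <- cop p.2) pk_pair r.1 X *: f p.1 r.2).
  apply: eq_bigr => p _; rewrite (lin_sum _ _ _ (fr p.1)); apply: eq_bigr => r _.
  exact: (linZ (fr p.1)).
rewrite -(coassoc x (f := fun a b c => pk_pair b X *: f a c)); first last.
- by move=> a b; apply: lin_scalef; exact: fr.
- by move=> a b; apply: lin_coef; exact: pk_linl.
- by move=> a b; apply: lin_scalef; exact: fl.
apply: eq_bigr => p _; rewrite (lin_sum _ _ _ (fl p.2)); apply: eq_bigr => r _.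
by rewrite (linZ (fl p.2)).
Qed.

End Weights.

Section IrrepTheory.
Variables (R : realType) (q : R) (q_gt0 : 0 < q) (q_lt1 : q < 1).
Variables (L : rootDatum R) (U : uqK q L).
Local Notation C := R[i].
Local Notation P := 'rV[int]_(rk L).
Local Notation I := 'I_(rk L).
Local Notation qp x := (cpow q x).
Local Notation uK w := (uk_gen U (gK w)).
Local Notation uE r := (uk_gen U (gE r)).
Local Notation uF r := (uk_gen U (gF r)).
Local Notation a_ := (sroot L).

Lemma q_neq1 : q != 1. Proof. by rewrite lt_eqF. Qed.

Lemma wip_inj (m m' : P) : (forall w, wip w m = wip w m') -> m = m'.
Proof.
move=> mm; apply/eqP; rewrite -subr_eq0; apply/negPn/negP => /wip_gt0.
by rewrite wipBr mm subrr ltxx.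
Qed.

Lemma uK_star w : star (uK w) = uK w. Proof. by have [] := uk_star U. Qed.
Lemma uE_star r : star (uE r) = uF r * uK (a_ r). Proof. by have [_] := uk_star U. Qed.
Lemma uF_star r : star (uF r) = uK (- a_ r) * uE r.
Proof.
have /(congr1 (@star _ _)) := uE_star r; rewrite starK starM uK_star => ->.
by rewrite mulrA uKD addNr uK0 mul1r.
Qed.

Lemma sroot_diag r : (a_ r) ord0 r = 2.
Proof.
have aa : wip (a_ r) (a_ r) != 0.
  (* Were the length zero, the convention for division by zero would give the r-th fundamental
     weight the r-th coordinate 0 instead of 1. *)
  apply/eqP => a0; have := wip_coroot (delta_mx ord0 r) r.
  by rewrite a0 invr0 mulr0 mxE !eqxx => /eqP; rewrite oner_eq0.
by apply: (@intr_inj R); rewrite wip_coroot mulfK.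
Qed.

Lemma sroot_gt0 r : 0 < wip (a_ r) (a_ r).
Proof.
apply: wip_gt0; apply/eqP => a0; have := sroot_diag r.
by rewrite a0 mxE.
Qed.

(** The exponent d_r with q_r = q^(d_r); it is also the factor between the r-th coordinate of a
    weight and its product with alpha_r. *)
Definition hlen r : R := wip (a_ r) (a_ r) / 2.

Lemma hlen_gt0 r : 0 < hlen r. Proof. by rewrite divr_gt0 // sroot_gt0. Qed.

Lemma wip_sroot (w : P) r : wip w (a_ r) = (w ord0 r)%:~R * hlen r.
Proof.
rewrite wip_coroot /hlen mulrA divfK ?gt_eqF ?sroot_gt0 //.
by rewrite mulrC mulKf.
Qed.

Lemma qrE r : qr L q r = q `^ hlen r. Proof. by []. Qed.

(* (q_r - q_r^-1) [x]_(q_r), for real x. *)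
Definition qsh r (x : R) : C := qp (x * hlen r) - qp (- (x * hlen r)).

Lemma qsh_eq0 r x : qsh r x = 0 -> x = 0.
Proof.
move=> /eqP; rewrite subr_eq0 => /eqP /(cpow_inj q_gt0 q_neq1) /eqP.
rewrite -subr_eq0 opprK -mulr2n mulrn_eq0 /= mulf_eq0 (gt_eqF (hlen_gt0 r)) orbF.
by move/eqP.
Qed.

Lemma qshN r x : qsh r (- x) = - qsh r x.
Proof. by rewrite /qsh mulNr opprK opprB. Qed.

(** The quantum integer identity [j+1][N-j] - [j][N-j+1] = [N-2j][1], cleared of denominators; it
    drives the induction in [sl2_raise]. *)
Lemma qsh_step r N j :
  qsh r (j + 1) * qsh r (N - j) - qsh r j * qsh r (N - j + 1) =
  qsh r (N - j - j) * qsh r 1.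
Proof.
rewrite /qsh !mulrDl !mulNr !opprD !opprK !cpowD // !mul1r.
set a := qp (N * _); set a' := qp (- (N * _)); set b := qp (j * _).
set b' := qp (- (j * _)); set c := qp (hlen r); set c' := qp (- (hlen r)).
have bb : b * b' = 1 by rewrite /b /b' -cpowD // subrr cpow0.
move: a a' b b' c c' bb => a a' b b' c c' bb.
ring: bb.
Qed.

(** * Strings for a quantum sl2 triple *)

Section Sl2.
Variables (V : lmodType C) (X Y : V -> V) (v : V) (r : I) (N : R) (k : C).
Hypotheses (Xl : linear X) (Yl : linear Y) (k0 : k != 0) (v0 : v != 0).
Hypotheses (Xv : X v = 0) (Ynil : exists j, iter j Y v = 0).
Hypothesis XY : forall j, X (Y (iter j Y v)) =
  Y (X (iter j Y v)) + (k * qsh r (N - j%:R - j%:R)) *: iter j Y v.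

(** The usual coefficient [j+1][N-j] for raising Y^(j+1) v, multiplied through by [qsh r 1] so that
    nothing is divided. *)
Lemma sl2_raise j :
  qsh r 1 *: X (iter j.+1 Y v) = (k * (qsh r (j%:R + 1) * qsh r (N - j%:R))) *: iter j Y v.
Proof.
elim: j => [|j IHj].
  rewrite iterS XY /= Xv (lin0 Yl) add0r scalerA !subr0 add0r.
  by rewrite mulrCA.
rewrite iterS XY scalerDr -(linZ Yl) IHj (linZ Yl) -iterS scalerA -scalerDl.
congr (_ *: _); have := qsh_step r N j.+1%:R.
have -> : N - j.+1%:R + 1 = N - j%:R by rewrite -natr1 opprD addrA subrK.
rewrite !natr1 => /eqP; rewrite subr_eq => /eqP ->.
by rewrite [RHS]mulrDr addrC; congr (_ + _); rewrite mulrCA [qsh r 1 * _]mulrC.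
Qed.

(** At the last nonzero Y^n v the raising formula gives [n+1][N-n] = 0, and for 0 < q < 1 a quantum
    integer vanishes only at 0. *)
Lemma sl2_string : exists n : nat,
  [/\ N = n%:R, forall j, (j <= n)%N -> iter j Y v != 0 & iter n.+1 Y v = 0].
Proof.
have ex : exists j, iter j Y v == 0 by have [j /eqP] := Ynil; exists j.
case: (ex_minnP ex) => [[|n]] /eqP Yn nmin; first by move: v0; rewrite -Yn eqxx.
have nz j : (j <= n)%N -> iter j Y v != 0.
  by move=> jn; apply: contraL (jn) => /nmin; rewrite -ltnNge.
exists n; split=> //.
have /esym/eqP := sl2_raise n; rewrite Yn (lin0 Xl) scaler0 scaler_eq0 (negPf (nz n _)) // orbF.
rewrite !mulf_eq0 (negPf k0) /= => /orP [/eqP/qsh_eq0/eqP|/eqP/qsh_eq0/eqP].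
  by rewrite natr1 pnatr_eq0.
by rewrite subr_eq0 => /eqP.
Qed.
End Sl2.

Section OneIrrep.
Variables (w : P) (V : irrep U w).
Local Notation ip := (ir_ip (i := V)).

Lemma ipI : is_inner ip. Proof. exact: ir_inner. Qed.

Lemma wt_orth (v u : V) m m' : has_wt v m -> has_wt u m' -> m != m' -> ip v u = 0.
Proof.
move=> vm um mm'; apply/eqP/negPn/negP => vu; case/eqP: mm'; apply: wip_inj => w'.
apply: (cpow_inj q_gt0 q_neq1); apply: (mulIf vu).
have := ir_star (uK w') v u; rewrite uK_star vm um.
by rewrite (innerZl ipI) (innerZr ipI) cpow_conj.
Qed.

(** Weight spaces are mutually orthogonal, so a weight missing from a finite spanning family of
    weight vectors can belong only to the zero vector. *)
Lemma wt_list : exists l : seq P, forall (v : V) m, v != 0 -> has_wt v m -> m \in l.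
Proof.
have [s [sS sP]] := lspan_seq [set v : V | exists m, has_wt v m].
pose f v := xget 0 [set m | has_wt (V := V) v m].
have fP v : v \in s -> has_wt v (f v) by move=> /sS; exact: (@xgetPex _ 0).
exists (map f s) => v m v0 vm; apply/negPn/negP => ml; move: v0.
rewrite (orthogonal_span_eq0 ipI (S := [set` s]) (x := v)) ?eqxx // => [z /= zs|].
  apply: wt_orth vm (fP z zs) _; apply: contra ml => /eqP ->; exact: map_f.
have /sP : lspan [set v : V | exists m, has_wt v m] v by exact: wt_spanT.
move=> /(@coord_span _ _ _ (in_tuple s)) ->; apply: lspan_sum => i _.
by apply/lspanZ/lspan_in; exact: mem_nth.
Qed.

(* The flag treats E and F, highest and lowest weights, at once. *)
Definition ladder (b : bool) r : U := if b then uE r else uF r.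
Definition lroot (b : bool) r : P := if b then a_ r else - a_ r.

Lemma ladder_wt b r (v : V) m : has_wt v m -> has_wt (ir_act (ladder b r) v) (m + lroot b r).
Proof. by case: b => vm; [exact: has_wt_E|exact: has_wt_F]. Qed.

Lemma ladder_wt_iter b r (v : V) m j : has_wt v m ->
  has_wt (iter j (ir_act (ladder b r)) v) (m + lroot b r *+ j).
Proof.
move=> vm; elim: j => [|j IHj]; first by rewrite mulr0n addr0.
by rewrite iterS mulrSr addrA; exact: ladder_wt.
Qed.

Lemma ladder_comm b r s (v : V) m : has_wt v m ->
  ir_act (ladder b r) (ir_act (ladder (~~ b) s) v) =
  ir_act (ladder (~~ b) s) (ir_act (ladder b r) v) +
  (if r == s then qdenom q r * qsh r (if b then (m ord0 r)%:~R else - (m ord0 r)%:~R)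
   else 0) *: v.
Proof.
move=> vm; have [_ _ _ _ EF] := uk_rel U.
have EFv r' s' : ir_act (uE r') (ir_act (uF s') v) - ir_act (uF s') (ir_act (uE r') v) =
    (if r' == s' then qdenom q r' * qsh r' (m ord0 r')%:~R else 0) *: v.
  rewrite -!actM -(linB (act_linl v)) EF; case: ifP => _; last first.
    by rewrite (lin0 (act_linl v)) scale0r.
  rewrite (linZ (act_linl v)) (linB (act_linl v)) !vm -scalerBl scalerA.
  by rewrite wipNl ![wip (a_ r') _]wipC wip_sroot.
rewrite /ladder; case: b => /=; first by rewrite -EFv addrC subrK.
have -> : ir_act (uF r) (ir_act (uE s) v) =
    ir_act (uE s) (ir_act (uF r) v) - (ir_act (uE s) (ir_act (uF r) v) -
    ir_act (uF r) (ir_act (uE s) v)) by rewrite opprB addrC subrK.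
rewrite EFv -scaleNr eq_sym qshN mulrN; congr (_ + _ *: _).
by case: eqP => [->|_]; rewrite ?oppr0.
Qed.

End OneIrrep.

End IrrepTheory.

Section IrrepStructure.
Variables (R : realType) (q : R) (q_gt0 : 0 < q) (q_lt1 : q < 1).
Variables (L : rootDatum R) (U : uqK q L).
Local Notation C := R[i].
Local Notation P := 'rV[int]_(rk L).
Local Notation I := 'I_(rk L).
Local Notation qp x := (cpow q x).
Local Notation uK w := (uk_gen U (gK w)).
Local Notation uE r := (uk_gen U (gE r)).
Local Notation uF r := (uk_gen U (gF r)).
Local Notation a_ := (sroot L).

(** The sum of the fundamental weights. It is regular dominant, and pairing with it serves as a
    height because it is positive on every simple root. *)
Definition onesw : P := const_mx 1.

Lemma wip_ones r : wip onesw (a_ r) = hlen r.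
Proof. by rewrite wip_sroot // mxE mul1r. Qed.

Lemma wip_sumr (w : P) (s : seq I) : wip w (\sum_(r <- s) a_ r) = \sum_(r <- s) wip w (a_ r).
Proof. by apply: (big_morph (wip w)) => [x y|]; rewrite ?wipDr ?wip0r. Qed.

Lemma wipMnr (w m : P) n : wip w (m *+ n) = wip w m *+ n.
Proof. by elim: n => [|n IHn]; rewrite ?mulr0n ?wip0r // !mulrS wipDr IHn. Qed.

Variables (w : P) (V : irrep U w).
Local Notation ip := (ir_ip (i := V)).
Local Notation ipV := (ipI V).
Local Notation lad := (ladder U).

Lemma wt_seq_finite (f : nat -> V) (mm : nat -> P) :
  injective mm -> (forall j, has_wt (f j) (mm j)) -> exists j, f j = 0.
Proof.
move=> mi fm; apply: contrapT => f0.
have [l lP] := wt_list q_gt0 q_lt1 V.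
have /uniq_leq_size : uniq (map mm (iota 0 (size l).+1)) by rewrite map_inj_uniq ?iota_uniq.
move=> /(_ l) H; suff : ((size l).+1 <= size l)%N by rewrite ltnn.
rewrite -[X in (X <= _)%N](size_iota 0) -(size_map mm); apply: H => _ /mapP [j _ ->].
by apply: (lP (f j)) => //; apply/eqP => fj; apply: f0; exists j.
Qed.

Lemma ladder_nil b r (v : V) m : has_wt v m -> exists j, iter j (ir_act (lad b r)) v = 0.
Proof.
move=> vm.
have := @wt_seq_finite (fun j => iter j (ir_act (lad b r)) v) (fun j => m + lroot b r *+ j).
apply => [i j /addrI|j].
  move=> /(congr1 (wip onesw)); rewrite !wipMnr.
  have nz : wip onesw (lroot b r) != 0.
    by case: b; rewrite /lroot ?wipNr ?oppr_eq0 wip_ones gt_eqF ?hlen_gt0.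
  by rewrite -[_ *+ i]mulr_natr -[_ *+ j]mulr_natr => /(mulfI nz) /eqP; rewrite eqr_nat => /eqP.
exact: ladder_wt_iter.
Qed.

Definition monom b (v0 : V) (s : seq I) : V := foldr (fun r => ir_act (lad b r)) v0 s.

Lemma monom_wt b v0 m s : has_wt v0 m ->
  has_wt (monom b v0 s) (m + \sum_(r <- s) lroot b r).
Proof.
move=> vm; elim: s => [|r s IHs] /=; first by rewrite big_nil addr0.
by rewrite big_cons [X in m + X]addrC addrA; exact: ladder_wt.
Qed.

(** Commuting an opposite ladder operator through a monomial leaves shorter monomials, and at the
    end it meets [v0], which it kills. Hence the monomials span a submodule. *)
Lemma monom_span b (v0 : V) m : v0 != 0 -> has_wt v0 m ->
  (forall r, ir_act (lad (~~ b) r) v0 = 0) ->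
  forall v, lspan (range (monom b v0)) v.
Proof.
move=> v0n0 v0m v0X; apply: (irrep_lspan (v0 := v0)) => //; last by exists [::].
have inb r v : lspan (range (monom b v0)) v -> lspan (range (monom b v0)) (ir_act (lad b r) v).
  move: v; apply: (@lspan_ind _ _ _ (fun v => lspan (range (monom b v0)) (ir_act (lad b r) v))).
  - by move=> _ [s _ <-]; apply: lspan_in; exists (r :: s).
  - by rewrite (lin0 (act_linr _)); exact: lspan0.
  - by move=> c x y Sx Sy; rewrite act_linr; exact: lspan_lin.
have innb r s : lspan (range (monom b v0)) (ir_act (lad (~~ b) r) (monom b v0 s)).
  elim: s => [|t s IHs] /=; first by rewrite v0X; exact: lspan0.
  have := ladder_comm (~~ b) r t (monom_wt b s v0m); rewrite negbK => ->.
  by apply: lspanD; [exact: inb|apply/lspanZ/lspan_in; exists s].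
move=> g _ [s _ <-]; case: g => [w'|r|r].
- by rewrite (monom_wt b s v0m); apply/lspanZ/lspan_in; exists s.
- by case: b {v0X inb} innb (inb r) => [innb inb|innb _];
    [apply: inb; apply: lspan_in; exists s|exact: innb].
- by case: b {v0X inb} innb (inb r) => [innb _|innb inb];
    [exact: innb|apply: inb; apply: lspan_in; exists s].
Qed.

Lemma hw_monom_span v : lspan (range (monom false (ir_hw V))) v.
Proof.
apply: (monom_span (m := w)) v; [exact: hw_neq0|exact: has_wt_hw|exact: ir_hw_E].
Qed.

(** A vector of any other weight would be orthogonal to all monomials in the F_r applied to the
    highest weight vector, and these span. *)
Lemma wt_below (v : V) m : v != 0 -> has_wt v m ->
  exists s : seq I, m = w - \sum_(r <- s) a_ r.
Proof.
move=> v0 vm; apply: contrapT => H; move: v0.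
rewrite (orthogonal_span_eq0 ipV (S := range (monom false (ir_hw V))) (x := v)) ?eqxx //;
  last exact: hw_monom_span.
move=> _ [s _ <-]; apply: (wt_orth q_gt0 q_lt1 vm (monom_wt false s (has_wt_hw V))).
by apply/eqP => mE; apply: H; exists s; rewrite mE /lroot sumrN.
Qed.

(** The adjoint of E_r is F_r up to an invertible K, and conversely. *)
Lemma ladder_adj b r (u v : V) : ir_act (lad (~~ b) r) u = 0 ->
  ip (ir_act (lad b r) v) u = 0.
Proof.
move=> u0; rewrite ir_star; suff -> : ir_act (star (lad b r)) u = 0 by rewrite (inner0r ipV).
case: b u0; rewrite /ladder /= => u0.
  have KF := uKF U (a_ r) r.
  rewrite uE_star; have -> : uF r * uK (a_ r) =
      (cpow q (- wip (a_ r) (a_ r)))^-1 *: (uK (a_ r) * uF r).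
    by rewrite KF scalerA mulVf ?scale1r // cpow_neq0.
  by rewrite (linZ (act_linl u)) actM u0 (lin0 (act_linr _)) scaler0.
by rewrite uF_star actM u0 (lin0 (act_linr _)).
Qed.

(** Remove from [u] its component along [v0]: the rest is orthogonal to [v0] and, by [ladder_adj],
    to every longer monomial, hence to the whole module. *)
Lemma extremal_unique b (v0 : V) m (u : V) : v0 != 0 -> has_wt v0 m ->
  (forall r, ir_act (lad (~~ b) r) v0 = 0) -> (forall r, ir_act (lad (~~ b) r) u = 0) ->
  exists c, u = c *: v0.
Proof.
move=> v0n0 v0m v0X uX; exists (ip v0 u / ip v0 v0).
have n0 : ip v0 v0 != 0 by apply: contra_neq v0n0; exact: (inner_eq0 ipV).
apply/eqP; rewrite -subr_eq0; set u' := u - _; apply/eqP.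
apply: (orthogonal_span_eq0 ipV (S := range (monom b v0))); last exact: (monom_span v0n0 v0m).
move=> _ [s _ <-]; rewrite (innerC ipV); apply/eqP; rewrite conjC_eq0; apply/eqP.
case: s => [|r s] /=; first by rewrite (innerBr ipV) divfK // subrr.
apply: ladder_adj; rewrite (linB (act_linr _)) uX (linZ (act_linr _)) v0X.
by rewrite scaler0 subrr.
Qed.

Lemma lroot_coordZ b r (m : P) j :
  (m + lroot b r *+ j) ord0 r = m ord0 r + if b then (j + j)%:Z else - (j + j)%:Z.
Proof.
have aj : (a_ r *+ j) ord0 r = (j%:Z + j%:Z)%R.
  by elim: j => [|j IHj]; rewrite ?mulr0n ?mxE // mulrS mxE IHj sroot_diag -natr1; lia.
by case: b; rewrite /lroot ?mulNrn !mxE aj PoszD.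
Qed.

Lemma lroot_coord b r (m : P) j :
  (if b then ((m + lroot (~~ b) r *+ j) ord0 r)%:~R
   else - ((m + lroot (~~ b) r *+ j) ord0 r)%:~R)
  = (if b then (m ord0 r)%:~R else - (m ord0 r)%:~R) - j%:R - j%:R :> R.
Proof. by rewrite lroot_coordZ; case: b; rewrite /= ?rmorphB ?rmorphD /=; lra. Qed.

Lemma ladder_string b r (v : V) m : v != 0 -> has_wt v m -> ir_act (lad b r) v = 0 ->
  exists n : nat,
   [/\ (m ord0 r)%:~R = (if b then n%:R else - n%:R) :> R,
       forall j, (j <= n)%N -> iter j (ir_act (lad (~~ b) r)) v != 0
     & iter n.+1 (ir_act (lad (~~ b) r)) v = 0].
Proof.
move=> v0 vm Xv.
have kn0 : qdenom q r != 0.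
  rewrite /qdenom (inj_eq (@complexI R)) /= invr_eq0; apply/eqP => e.
  suff /(qsh_eq0 q_gt0 q_lt1)/eqP : qsh q r 1 = 0 by rewrite oner_eq0.
  by rewrite /qsh mul1r /cpow -rmorphB /= powRN -qrE e.
have [|n [Nn nz n0]] := @sl2_string _ _ q_gt0 q_lt1 _ V (ir_act (lad b r)) (ir_act (lad (~~ b) r))
    v r (if b then (m ord0 r)%:~R else - (m ord0 r)%:~R) (qdenom q r)
    (act_linr _) (act_linr _) kn0 v0 Xv (ladder_nil (~~ b) r vm).
  move=> j; rewrite (ladder_comm b r r (ladder_wt_iter q_gt0 (~~ b) r j vm)) eqxx.
  by rewrite lroot_coord.
by exists n; split=> //; rewrite -Nn; case: (b); rewrite ?opprK.
Qed.

(** Walk along the r-string in the direction of the sign of m_r to its end, in k steps, then back by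
    k + |m_r| steps. Seen from that end the string has length 2k + |m_r|, so the vector reached is
    nonzero. *)
Lemma wt_refl r (v : V) m : v != 0 -> has_wt v m ->
  exists2 v' : V, v' != 0 & has_wt v' (srefl a_ r m).
Proof.
move=> v0 vm; pose b := 0 <= m ord0 r.
have ex : exists j, iter j (ir_act (lad b r)) v == 0.
  by have [j /eqP] := ladder_nil b r vm; exists j.
case: (ex_minnP ex) => [[|k]] /eqP Xk kmin; first by move: v0; rewrite -Xk eqxx.
pose v' := iter k (ir_act (lad b r)) v.
have v'0 : v' != 0 by apply/negP => /kmin; rewrite ltnn.
have v'm := ladder_wt_iter q_gt0 b r k vm.
have [n [mn nz _]] := ladder_string v'0 v'm Xk.
pose j := (k + `|m ord0 r|)%N.
exists (iter j (ir_act (lad (~~ b) r)) v').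
  apply: nz; have : (m + lroot b r *+ k) ord0 r = if b then n%:Z else - n%:Z.
    by apply: (@intr_inj R); rewrite mn; case: (b); rewrite ?rmorphN.
  by rewrite lroot_coordZ /j /b; case: ifP; lia.
have -> : srefl a_ r m = m + lroot b r *+ k + lroot (~~ b) r *+ j; last exact: ladder_wt_iter.
rewrite -addrA; congr (m + _); rewrite /j /lroot /b.
have mE : m ord0 r = if 0 <= m ord0 r then `|m ord0 r|%N%:Z else - `|m ord0 r|%N%:Z.
  by case: ifP; lia.
rewrite {1}mE; case: ifP => _ /=; rewrite ?scaleNr ?opprK -natz scaler_nat.
  by rewrite mulNrn mulrnDr opprD addNKr.
by rewrite mulNrn mulrnDr addKr.
Qed.

End IrrepStructure.

(** * The Weyl group *)

Section WeylAction.
Variables (R : realType) (L : rootDatum R).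
Local Notation P := 'rV[int]_(rk L).
Local Notation I := 'I_(rk L).
Local Notation a_ := (sroot L).
Local Notation sr := (srefl a_).
Local Notation wa := (wact a_).
Implicit Types (x y : P) (s : seq I) (r : I).

Lemma sreflD r x y : sr r (x + y) = sr r x + sr r y.
Proof. by rewrite /srefl mxE scalerDl opprD addrACA. Qed.

Lemma srefl_sroot r : sr r (a_ r) = - a_ r.
Proof. by rewrite /srefl sroot_diag scaler_nat mulr2n opprD addNKr. Qed.

Lemma sreflK r : involutive (sr r).
Proof.
move=> x; rewrite /srefl !mxE sroot_diag.
have -> : x ord0 r - x ord0 r * 2 = - x ord0 r by ring.
by rewrite scaleNr opprK subrK.
Qed.

Lemma wip_srefl r x y : wip (sr r x) y = wip x (sr r y).
Proof.
have Z (u v : P) (n : int) : wip u (n *: v) = n%:~R * wip u v.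
  case: n => n; rewrite ?NegzE ?scaleNr ?wipNr -natz scaler_nat wipMnr.
    by rewrite natz mulr_natl.
  by rewrite rmorphN /= natz mulNr mulr_natl.
rewrite /srefl wipBr wipC wipBr !Z ![wip _ (a_ r)]wip_sroot [wip y x]wipC.
by rewrite mulrCA.
Qed.

Lemma wactD s x y : wa s (x + y) = wa s x + wa s y.
Proof. by elim: s => //= r s ->; rewrite sreflD. Qed.

Lemma wactN s x : wa s (- x) = - wa s x.
Proof.
have w0 : wa s 0 = 0 by apply: (addIr (wa s 0)); rewrite -wactD !add0r.
by apply: (addIr (wa s x)); rewrite -wactD !addNr.
Qed.

Lemma wactMn s x n : wa s (x *+ n) = wa s x *+ n.
Proof.
elim: n => [|n IHn]; last by rewrite !mulrS wactD IHn.
by rewrite !mulr0n; apply: (addIr (wa s 0)); rewrite -wactD !add0r.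
Qed.

Lemma wactZ s x (n : int) : wa s (n *: x) = n *: wa s x.
Proof.
case: n => n; rewrite ?NegzE ?scaleNr ?wactN -natz !scaler_nat wactMn //.
Qed.

Lemma wact_cat s s' x : wa (s ++ s') x = wa s (wa s' x).
Proof. by rewrite /wact foldr_cat. Qed.

Lemma wact_revK s : cancel (wa s) (wa (rev s)).
Proof.
elim: s => // r s IHs x.
by rewrite rev_cons -cats1 wact_cat /= sreflK IHs.
Qed.

Lemma wact_revVK s : cancel (wa (rev s)) (wa s).
Proof. by move=> x; have := wact_revK (rev s) x; rewrite revK. Qed.

Lemma wact_rev_wip s x y : wip (wa s x) y = wip x (wa (rev s) y).
Proof.
elim: s y => // r s IHs y.
by rewrite rev_cons -cats1 wact_cat /= wip_srefl IHs.
Qed.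

Lemma wact_wip s x y : wip x (wa s y) = wip (wa (rev s) x) y.
Proof. by rewrite wact_rev_wip revK. Qed.

Lemma fundw_coord r k : (val (fundw r) : P) ord0 k = (k == r)%:R.
Proof. by rewrite mxE eqxx. Qed.

Lemma dominantP x : dominant x -> forall r, 0 <= x ord0 r.
Proof. by move/forallP. Qed.

Lemma wip_dom x r : (0 <= x ord0 r) = (0 <= wip x (a_ r)).
Proof. by rewrite wip_sroot pmulr_lge0 ?ler0z // hlen_gt0. Qed.

Lemma dominantE x : dominant x = [forall r, 0 <= wip x (a_ r)].
Proof. by apply: eq_forallb => r; rewrite wip_dom. Qed.

Lemma ones_dom : dominant (onesw L). Proof. by apply/forallP => r; rewrite mxE. Qed.

Lemma wip_fundw x y : wip x y = \sum_k (x ord0 k)%:~R * wip (val (fundw k)) y.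
Proof.
pose f z := wip z y.
have fZ n z : f (n *: z) = n%:~R * f z.
  rewrite /f; case: n => n; rewrite ?NegzE ?scaleNr ?wipNl -natz scaler_nat wipC wipMnr wipC.
    by rewrite natz mulr_natl.
  by rewrite rmorphN /= natz mulNr mulr_natl.
rewrite -/(f x) {1}[x]row_sum_delta (big_morph f (id1 := 0) (op1 := +%R)).
- by apply: eq_bigr => k _; rewrite fZ.
- by move=> u v; rewrite /f wipDl.
- by rewrite /f wip0l.
Qed.

Lemma roots_srefl r a : a \in Defs.roots L -> sr r a \in Defs.roots L.
Proof. by move/rootsP => [s [t ->]]; apply/rootsP; exists (r :: s), t. Qed.

Lemma roots_wact s a : a \in Defs.roots L -> wa s a \in Defs.roots L.
Proof. by move=> aR; elim: s => //= r s; exact: roots_srefl. Qed.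

Lemma sroot_root r : a_ r \in Defs.roots L.
Proof. by apply/rootsP; exists [::], r. Qed.

Lemma rootsN a : a \in Defs.roots L -> - a \in Defs.roots L.
Proof.
move/rootsP => [s [t ->]]; apply/rootsP; exists (rcons s t), t.
by rewrite -cats1 wact_cat /= srefl_sroot wactN.
Qed.

Lemma root_neq0 a : a \in Defs.roots L -> a != 0.
Proof.
move/rootsP => [s [t ->]]; apply/eqP => /(congr1 (wa (rev s))).
rewrite wact_revK; have -> : wa (rev s) 0 = 0.
  by apply: (addIr (wa (rev s) 0)); rewrite -wactD !add0r.
by move=> at0; have := sroot_gt0 t; rewrite at0 wip0r ltxx.
Qed.

End WeylAction.

Section WeylOrbits.
Variables (R : realType) (q : R) (q_gt0 : 0 < q) (q_lt1 : q < 1).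
Variables (L : rootDatum R) (U : uqK q L).
Variable V : forall w : domw L, irrep U (val w).
Local Notation P := 'rV[int]_(rk L).
Local Notation I := 'I_(rk L).
Local Notation a_ := (sroot L).
Local Notation sr := (srefl a_).
Local Notation wa := (wact a_).
Local Notation ones := (onesw L).
Implicit Types (x y : P) (s : seq I) (r : I).

Lemma wt_wact (w : P) (W : irrep U w) s (v : W) m : v != 0 -> has_wt v m ->
  exists2 v' : W, v' != 0 & has_wt v' (wa s m).
Proof.
move=> v0 vm; elim: s => [|r s [v' v'0 v'm]]; first by exists v.
exact: wt_refl v'0 v'm.
Qed.

Lemma orbit_below (w : domw L) s : exists t : seq I, wa s (val w) = val w - \sum_(r <- t) a_ r.
Proof.
have [v v0 vm] := wt_wact s (hw_neq0 (V w)) (has_wt_hw (V w)).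
exact: wt_below v0 vm.
Qed.

Lemma sum_sroot_eq0 (t : seq I) : wip ones (\sum_(r <- t) a_ r) <= 0 -> t = [::].
Proof.
rewrite wip_sumr; case: t => // r t; rewrite big_cons leNgt => /negP [].
rewrite ltr_wpDr ?wip_ones ?hlen_gt0 //.
by rewrite sumr_ge0 // => i _; rewrite wip_ones ltW // hlen_gt0.
Qed.

(** The transformed weight lies below w, and, being dominant, it is a highest weight itself, so that
    w lies below it as well. The two sums of simple roots cancel, and the height makes both
    empty. *)
Lemma dominant_orbit (w : domw L) s : dominant (wa s (val w)) -> wa s (val w) = val w.
Proof.
move=> d; have [t tE] := orbit_below w s.
have [t' t'E] := orbit_below (exist (fun w => dominant w) _ d) (rev s).
rewrite /= wact_revK tE in t'E.
have t0 : \sum_(i <- t ++ t') a_ i = 0.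
  rewrite big_cat; apply: oppr_inj; apply: (addrI (val w)).
  by rewrite oppr0 addr0 opprD addrA; exact: esym t'E.
have /(f_equal size) : t ++ t' = [::] by apply: sum_sroot_eq0; rewrite t0 wip0r.
by rewrite tE size_cat => /eqP; rewrite addn_eq0 => /andP [/nilP -> _]; rewrite big_nil subr0.
Qed.

(* If a root a takes both signs on dominant weights, it vanishes at a regular
   dominant l; then the reflection in a maps the dominant weight N l + fundw r,
   N large, to a different dominant weight. *)
Lemma root_sign a : a \in Defs.roots L ->
  (forall x, dominant x -> 0 <= wip x a) \/ (forall x, dominant x -> wip x a <= 0).
Proof.
move=> aR; have /rootsP [s [t aE]] := aR.
(* [c] is the pairing with the coroot of [a], computed by carrying [a] back to the simple root [t];
   accordingly the word [s ++ t :: rev s] acts as the reflection in [a]. *)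
pose c x : int := (wa (rev s) x) ord0 t.
have cE x : wip x a = (c x)%:~R * hlen t by rewrite aE wact_wip wip_sroot.
have cD x y : c (x + y) = c x + c y by rewrite /c wactD mxE.
have cMn x n : c (x *+ n) = c x *+ n by rewrite /c wactMn mulmxnE.
have refl x : wa (s ++ t :: rev s) x = x - c x *: a.
  by rewrite wact_cat /= /srefl wactD wactN wactZ wact_revVK -/(c x) aE.
apply: contrapT => /not_orP [neg pos].
have [r cr] : exists r, 0 < c (val (fundw r)).
  apply: contrapT => H; apply: pos => x /dominantP xd; rewrite wip_fundw sumr_le0 // => k _.
  apply: mulr_ge0_le0; first by rewrite ler0z.
  rewrite cE; apply: mulr_le0_ge0; last exact/ltW/hlen_gt0.
  rewrite lerz0 leNgt.
  by apply/negP => ck; apply: H; exists k.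
have [r' cr'] : exists r, c (val (fundw r)) < 0.
  apply: contrapT => H; apply: neg => x /dominantP xd; rewrite wip_fundw sumr_ge0 // => k _.
  apply: mulr_ge0; first by rewrite ler0z.
  rewrite cE; apply: mulr_ge0; last exact/ltW/hlen_gt0.
  rewrite ler0z leNgt.
  by apply/negP => ck; apply: H; exists k.
(* [c] takes both signs on fundamental weights: combine [ones] with the one on which [c] has the
   sign opposite to [c ones], with weights that make the two contributions cancel. *)
have [l [l1 l0]] : exists l : P, (forall k, 1 <= l ord0 k) /\ c l = 0.
  have [S0|S0] := leP 0 (c ones).
    exists (ones *+ `|c (val (fundw r'))|%N + val (fundw r') *+ `|c ones|%N); split=> [k|].
      by rewrite mxE !mulmxnE fundw_coord mxE; case: (k == r'); lia.
    by rewrite cD !cMn; nia.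
  exists (ones *+ `|c (val (fundw r))|%N + val (fundw r) *+ `|c ones|%N); split=> [k|].
    by rewrite mxE !mulmxnE fundw_coord mxE; case: (k == r); lia.
  by rewrite cD !cMn; nia.
(* [N] bounds every coordinate of the multiple of [a] that the reflection subtracts, so the
   reflected weight is still dominant. *)
pose N := (\sum_k absz (c (val (fundw r)) * a ord0 k)%R)%N.
pose m := l *+ N + val (fundw r).
have lN k : N%:Z <= l ord0 k *+ N by rewrite -mulr_natr natz; have := l1 k; nia.
have md : dominant m.
  apply/forallP => k; rewrite mxE mulmxnE fundw_coord; have := lN k; case: (k == r); rewrite /=; lia.
have cm : c m = c (val (fundw r)) by rewrite cD cMn l0 mul0rn add0r.
have : wa (s ++ t :: rev s) m = m.
  have := @dominant_orbit (exist (fun w => dominant w) m md) (s ++ t :: rev s); apply.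
  rewrite [val _]/=.
  apply/forallP => k; rewrite refl cm !mxE mulmxnE.
  have : (absz (c (val (fundw r)) * a ord0 k)%R <= N)%N by rewrite /N (bigD1 k) //= leq_addr.
  have := lN k; rewrite eqxx /=; case: (k == r) => /=; lia.
rewrite refl cm => mE.
have /eqP : c (val (fundw r)) *: a = 0.
  by apply: oppr_inj; apply: (addrI m); rewrite mE oppr0 addr0.
move/eqP => /rowP ca0; case/eqP: (root_neq0 aR); apply/rowP => k.
have /eqP := ca0 k; rewrite mxE [in X in _ == X]mxE mulf_eq0 gt_eqF //= => /eqP ->.
by rewrite mxE.
Qed.

(** Positivity is tested against dominant weights, unlike in [pos_root], where it is a condition on
    the coefficients on simple roots. *)
Definition posroot a := forall x, dominant x -> 0 <= wip x a.

Lemma root_posneg a : a \in Defs.roots L -> posroot a \/ posroot (- a).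
Proof.
move/root_sign => [?|H]; [by left|right] => x /H; by rewrite wipNr oppr_ge0.
Qed.

(** A root with one sign on all fundamental weights and zero on their sum would vanish on each of
    them. *)
Lemma root_ones a : a \in Defs.roots L -> wip ones a != 0.
Proof.
move=> aR.
have key b : b \in Defs.roots L -> posroot b -> wip ones b != 0.
  move=> bR bp; apply: contra_neq (root_neq0 bR) => b0.
  apply: wip_inj => x; rewrite wip0r wip_fundw big1 // => k _.
  move: b0; rewrite wip_fundw (eq_bigr (fun k => wip (val (fundw k)) b)); last first.
    by move=> i _; rewrite mxE mul1r.
  move/eqP; rewrite psumr_eq0; last by move=> i _; apply: bp; exact: fundw_dominant.
  by move=> /allP /(_ k); rewrite mem_index_enum => /(_ isT) /eqP ->; rewrite mulr0.
have [/(key a aR)//|] := root_posneg aR.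
by move/(key _ (rootsN aR)); rewrite wipNr oppr_eq0.
Qed.

Lemma posrootP a : a \in Defs.roots L -> 0 < wip ones a -> posroot a.
Proof.
move=> aR a0; have [//|/(_ _ (ones_dom L))] := root_posneg aR.
by rewrite wipNr oppr_ge0 leNgt a0.
Qed.

(** s_r fixes the fundamental weights other than the r-th. If it made [a] negative, [a] would vanish
    on all of those and be proportional to alpha_r; integrality then forces equality. *)
Lemma srefl_posroot r a : a \in Defs.roots L -> 0 < wip ones a -> a != a_ r ->
  0 < wip ones (sr r a).
Proof.
move=> aR a0 ar; have ap := posrootP aR a0.
have raR := roots_srefl r aR.
rewrite lt_def root_ones //= leNgt; apply/negP => ra0; case/eqP: ar.
have nra : posroot (- sr r a) by apply: posrootP (rootsN raR) _; rewrite wipNr oppr_gt0.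
have k0 k : k != r -> wip (val (fundw k)) a = 0.
  move=> kr; apply/eqP; rewrite eq_le ap ?fundw_dominant // andbT.
  have /nra := fundw_dominant k; rewrite wipNr oppr_ge0 -wip_srefl /srefl fundw_coord.
  by rewrite eq_sym (negPf kr) scale0r subr0.
have wipa x : wip x a = (x ord0 r)%:~R * wip (val (fundw r)) a.
  by rewrite wip_fundw (bigD1 r) //= big1 ?addr0 // => k /k0 ->; rewrite mulr0.
have /rootsP [s [t aE]] := aR.
have cE x : wip x a = ((wa (rev s) x) ord0 t)%:~R * hlen t.
  by rewrite aE wact_wip wip_sroot.
set y := (wa (rev s) (val (fundw r))) ord0 t.
(* Evaluating [a] on the weight that [wa (rev s)] carries to the t-th fundamental weight exhibits an
   integer inverse of [y]; as [y] is nonnegative, it is 1. *)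
have y1 : (wa s (val (fundw t))) ord0 r * y = 1.
  have := wipa (wa s (val (fundw t))); rewrite !cE wact_revK fundw_coord eqxx mul1r -/y.
  rewrite mulrA => /eqP; rewrite -subr_eq0 -{1}[hlen t]mul1r -mulrBl mulf_eq0.
  rewrite (gt_eqF (hlen_gt0 t)) orbF -rmorphM -(rmorph1 (@intmul R 1)) -rmorphB intr_eq0.
  by rewrite subr_eq0 => /eqP.
have y0 : 0 <= y.
  by have := ap _ (fundw_dominant r); rewrite cE pmulr_lge0 ?hlen_gt0 // ler0z.
have yE : y = 1.
  move: y1 y0; move: (_ ord0 r) (y) => c d; case: d => // -[|[|d]] cd _ //; first by lia.
  by case: c cd => [[|c]|c]; rewrite ?NegzE; nia.
have wipa' x : wip x a = (x ord0 r)%:~R * hlen t by rewrite wipa cE -/y yE mul1r.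
have aa : wip a a = 2 * hlen t.
  by rewrite {2}aE wact_wip aE wact_revK wip_sroot sroot_diag.
have ar2 : a ord0 r = 2.
  apply: (@intr_inj R); have := wipa' a; rewrite aa => /(mulIf _) <- //.
  by rewrite gt_eqF // hlen_gt0.
have lens : hlen r = hlen t.
  have := wipa' (a_ r); rewrite wipC wip_sroot ar2 sroot_diag => /(mulfI _) -> //.
by apply: wip_inj => x; rewrite wipa' wip_sroot lens.
Qed.

End WeylOrbits.

(** * The length function and the longest element *)

Section Length.
Variables (R : realType) (q : R) (q_gt0 : 0 < q) (q_lt1 : q < 1).
Variables (L : rootDatum R) (U : uqK q L).
Variable V : forall w : domw L, irrep U (val w).
Local Notation P := 'rV[int]_(rk L).
Local Notation I := 'I_(rk L).
Local Notation a_ := (sroot L).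
Local Notation sr := (srefl a_).
Local Notation wa := (wact a_).
Local Notation ones := (onesw L).
Implicit Types (x y : P) (s : seq I) (r : I).

(** Since (s rho, a) = (rho, s^-1 a), with [ones] for rho, this counts the positive roots made
    negative by s^-1: the length of the Weyl group element, computed from any word. *)
Definition inversions s : nat :=
  count (fun a => (0 < wip ones a) && (wip (wa s ones) a < 0)) (Defs.roots L).

Lemma root_ones_wact s a : a \in Defs.roots L -> wip (wa s ones) a != 0.
Proof. by move=> aR; rewrite wact_rev_wip (root_ones q_gt0 q_lt1 V) // roots_wact. Qed.

Lemma count_roots_srefl r p :
  count (fun a => p (sr r a)) (Defs.roots L) = count p (Defs.roots L).
Proof.
rewrite -(count_map (sr r) p); apply/permP: p; apply: uniq_perm.
- by rewrite map_inj_uniq ?roots_uniq //; exact: can_inj (sreflK r).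
- exact: roots_uniq.
move=> a; apply/mapP/idP => [[b bR ->]|aR]; first exact: roots_srefl.
by exists (sr r a); rewrite ?sreflK // roots_srefl.
Qed.

(** Reindexing the roots by s_r turns the count for [r :: s] into that for [s], except at -alpha_r,
    which is now counted: s_r preserves the signs of all other roots than alpha_r and -alpha_r, and
    alpha_r is counted on neither side. *)
Lemma inversions_up r s : 0 < wip (wa s ones) (a_ r) -> inversions (r :: s) = (inversions s).+1.
Proof.
move=> s0; rewrite /inversions -(count_roots_srefl r) /=.
have aR := sroot_root r; have naR := rootsN aR.
have h0 := hlen_gt0 r.
pose p a := (0 < wip ones a) && (wip (wa s ones) a < 0).
rewrite (eq_in_count (a2 := predU (pred1 (- a_ r)) p)) => [|a aR']; last first.
  rewrite /= wip_srefl sreflK /p.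
  have [->|anr] := eqVneq a (- a_ r).
    by rewrite -srefl_sroot sreflK srefl_sroot wip_ones h0 wipNr oppr_lt0 s0.
  rewrite /=; have [->|ar] := eqVneq a (a_ r).
    by rewrite srefl_sroot wipNr wip_ones oppr_gt0 [in LHS]ltNge (ltW h0) /=
      [X in _ = _ && X]ltNge (ltW s0) andbF.
  congr (_ && _); apply/idP/idP => [ra|a0]; last first.
    exact: (srefl_posroot q_gt0 q_lt1 V).
  rewrite -[a](sreflK r); apply: (srefl_posroot q_gt0 q_lt1 V) => //; first exact: roots_srefl.
  by apply: contra anr => /eqP ra'; rewrite -[a](sreflK r) ra' srefl_sroot.
have := count_predUI (pred1 (- a_ r)) p (Defs.roots L).
rewrite (eq_count (a2 := pred0) (a1 := predI _ _)) => [|a]; last first.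
  rewrite /= /p; case: eqP => // ->; by rewrite wipNr wip_ones oppr_gt0 ltNge (ltW h0).
by rewrite count_pred0 addn0 => ->; rewrite (count_uniq_mem _ (roots_uniq L)) naR.
Qed.

Lemma inversions_down r s : wip (wa s ones) (a_ r) < 0 -> inversions s = (inversions (r :: s)).+1.
Proof.
move=> s0; rewrite -(@inversions_up r); first by rewrite /inversions /= sreflK.
by rewrite /= wip_srefl srefl_sroot wipNr oppr_gt0.
Qed.

Lemma inversions_cons r s : (inversions (r :: s) <= (inversions s).+1)%N.
Proof.
have := root_ones_wact s (sroot_root r); rewrite neq_lt => /orP [/inversions_down ->|].
  by rewrite leqW.
by move/inversions_up => ->.
Qed.

Lemma inversions_nil : inversions [::] = 0%N.
Proof.
apply/eqP; rewrite eqn0Ngt -has_count; apply/hasPn => a _ /=.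
by apply/negP => /andP [a0 /(lt_trans a0)]; rewrite ltxx.
Qed.

Lemma inversions_cat s s' : (inversions (s ++ s') <= size s + inversions s')%N.
Proof.
elim: s => //= r s IHs; apply: leq_trans (inversions_cons _ _) _; by rewrite addSn ltnS.
Qed.

Lemma inversions_size s : (inversions s <= size s)%N.
Proof. by have := inversions_cat s [::]; rewrite cats0 inversions_nil addn0. Qed.

(** Under the hypothesis every root s^-1 alpha_r is positive, so s maps dominant weights to dominant
    ones and fixes them by [dominant_orbit]. Every weight becomes dominant after adding a multiple
    of [ones]. *)
Lemma wact_dominant_id s : (forall r, 0 < wip (wa s ones) (a_ r)) -> wa s =1 id.
Proof.
move=> s0.
have dom x : dominant x -> wa s x = x.
  move=> xd; apply: (dominant_orbit q_gt0 q_lt1 V (w := exist (fun w => dominant w) x xd)).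
  rewrite [val _]/= dominantE; apply/forallP => r; rewrite wact_rev_wip.
  apply: (posrootP q_gt0 q_lt1 V) xd; first by rewrite roots_wact // sroot_root.
  by rewrite -wact_rev_wip.
move=> x; pose N := (\sum_k absz (x ord0 k))%N.
have : wa s (x + ones *+ N) = x + ones *+ N.
  apply: dom; apply/forallP => k; rewrite mxE mulmxnE mxE natz.
  have : (absz (x ord0 k) <= N)%N by rewrite /N (bigD1 k) //= leq_addr.
  by move: (x ord0 k) => c; lia.
by rewrite wactD wactMn (dom _ (ones_dom L)) => /addIr.
Qed.

(** While some simple root pairs negatively with the image of [ones], prepending its reflection
    removes one inversion; when none is left the element acts as the identity. *)
Lemma inversions_word s : exists2 u, size u = inversions s & wa s =1 wa u.
Proof.
move En : (inversions s) => n; elim: n s En => [|n IHn] s En.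
  exists [::] => //; apply: wact_dominant_id => r.
  have := root_ones_wact s (sroot_root r); rewrite neq_lt => /orP [/inversions_down|//].
  by rewrite En.
have [r r0] : exists r, wip (wa s ones) (a_ r) < 0.
  apply: contrapT => H; have sid : wa s =1 id.
    apply: wact_dominant_id => r; have := root_ones_wact s (sroot_root r).
    by rewrite neq_lt => /orP [r0|//]; case: H; exists r.
  by move: En; rewrite /inversions sid -[RHS]/(n.+1) -/(inversions [::]) inversions_nil.
have [|u su uE] := IHn (r :: s); first by apply/succn_inj; rewrite -inversions_down.
by exists (r :: u); rewrite /= ?su // => x; rewrite /= -uE /= sreflK.
Qed.

Variable w0 : longestWord L.

Lemma inversions_lw : inversions w0 = size w0.
Proof.
apply/eqP; rewrite eqn_leq inversions_size /=; have [u <- uE] := inversions_word w0.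
by apply: lw_reduced => x; rewrite uE.
Qed.

(** Otherwise prepending [r] to [s'] would lose an inversion, and the remaining letters could not
    bring the count up to the size of [w0]. *)
Lemma lw_suffix s r s' : w0 = s ++ r :: s' :> seq I -> 0 < wip (wa s' ones) (a_ r).
Proof.
move=> w0E; have := root_ones_wact s' (sroot_root r).
rewrite neq_lt => /orP [/inversions_down|//] e.
have := inversions_lw; rewrite w0E size_cat /=.
have := inversions_cat s (r :: s'); have := inversions_size s'; lia.
Qed.

(** Otherwise [r :: w0] would have more inversions than [w0] has letters, and no word of size at
    most that of [w0] could act in the same way. *)
Lemma lw_antidominant r : wip (wa w0 ones) (a_ r) < 0.
Proof.
have := root_ones_wact w0 (sroot_root r); rewrite neq_lt => /orP [//|/inversions_up].
rewrite inversions_lw => e.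
have [s' s'E] := lw_longest w0 (r :: w0); rewrite leqNgt => /negP [].
have := inversions_size s'; rewrite (_ : inversions s' = inversions (r :: w0)) ?e //.
by rewrite /inversions s'E.
Qed.

End Length.

(** * Lowest weight vectors from the Lusztig operators *)

Section LowestWeight.
Variables (R : realType) (q : R) (q_gt0 : 0 < q) (q_lt1 : q < 1).
Variables (L : rootDatum R) (U : uqK q L).
Variable V : forall w : domw L, irrep U (val w).
Variables (T : lusztigT V) (w0 : longestWord L).
Local Notation P := 'rV[int]_(rk L).
Local Notation I := 'I_(rk L).
Local Notation a_ := (sroot L).
Local Notation wa := (wact a_).
Local Notation ones := (onesw L).
Local Notation uE r := (uk_gen U (gE r)).
Local Notation uF r := (uk_gen U (gF r)).

Lemma act_exp (w : P) (W : irrep U w) X n (v : W) :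
  ir_act (X ^+ n) v = iter n (ir_act X) v.
Proof. by elim: n v => [|n IHn] v; rewrite ?expr0 ?act1 // exprS actM IHn. Qed.

Lemma qr_gt0 r : 0 < qr L q r. Proof. exact: powR_gt0. Qed.

Lemma qr_neq1 r : qr L q r != 1.
Proof.
apply/eqP => qr1; have := hlen_gt0 r; suff -> : hlen r = 0 by rewrite ltxx.
by apply: (cpow_inj q_gt0 (q_neq1 q_lt1)); rewrite cpow0 /cpow -qrE qr1.
Qed.

Lemma qfact_neq0 r n : qfact (qr L q r) n != 0.
Proof.
have p0 := qr_gt0 r; have p1 := qr_neq1 r.
have key k : (0 < k)%N -> qr L q r ^- k - qr L q r ^+ k != 0.
  move=> k0; rewrite subr_eq0; apply: contra_neq p1 => pk.
  have k2 : (0 < k + k)%N by rewrite addn_gt0 k0.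
  by apply/eqP; rewrite -(pexpr_eq1 k2) ?ltW // exprD -{1}pk mulVf // expf_neq0 // gt_eqF.
apply/prodf_neq0 => i _; rewrite mulf_neq0 ?key // invr_eq0.
by have := key 1%N isT; rewrite expr1.
Qed.

(** Only the term a = 0, b = n, c = 0 survives, where n is the length of the string: c > 0 applies
    E_r to [v], and a > 0 with c = 0 forces b > n, beyond the string. So T_r v is a nonzero multiple
    of F_r^n v. *)
Lemma lT_singular r (w : domw L) (v : V w) m : v != 0 -> has_wt v m ->
  ir_act (uE r) v = 0 -> lT T r v != 0 /\ has_wt (lT T r v) (srefl a_ r m).
Proof.
move=> v0 vm Ev.
have [n [mn nz n0]] := @ladder_string _ _ q_gt0 q_lt1 _ _ _ (V w) true r v m v0 vm Ev.
have {}mn : m ord0 r = n by apply: (@intr_inj R).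
have [N0 NE] := lT_spec T r vm.
have big_n k : (n < k)%N -> iter k (ir_act (uF r)) v = 0.
  elim: k => // k IHk; rewrite ltnS leq_eqVlt => /predU1P [<-//|/IHk]; rewrite iterS => ->.
  exact: (lin0 (act_linr _)).
have En c : (0 < c)%N -> ir_act (uE r ^+ c) v = 0.
  case: c => // c _; rewrite exprSr actM Ev; exact: (lin0 (act_linr _)).
pose N := maxn N0 n.+1.
have nN : (n < N)%N by rewrite leq_max leqnn orbT.
have z0 : (0 < N)%N by rewrite (leq_trans _ nN).
rewrite (NE N (leq_maxl _ _)).
rewrite (bigD1 (Ordinal z0)) //= [X in _ + X]big1 ?addr0; last first.
  move=> a a0; apply: big1 => b _; apply: big1 => c /eqP e.
  rewrite !actM; case: (posnP c) => [c0|/En ->]; last first.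
    by rewrite !(lin0 (act_linr _)) scaler0.
  rewrite c0 expr0 act1 (_ : ir_act (uF r ^+ b) v = 0) ?(lin0 (act_linr _)) ?scaler0 //.
  rewrite act_exp big_n //.
  have : (0 < a)%N by rewrite lt0n; apply: contra a0 => /eqP a0; apply/eqP/val_inj.
  move: e; rewrite mn c0; lia.
rewrite (bigD1 (Ordinal nN)) //= [X in _ + X]big1 ?addr0; last first.
  move=> b bn; apply: big1 => c /eqP e.
  rewrite !actM; case: (posnP c) => [c0|/En ->]; last first.
    by rewrite !(lin0 (act_linr _)) scaler0.
  case/eqP: bn; apply: val_inj => /=; move: e; rewrite mn c0; lia.
rewrite (bigD1 (Ordinal z0)) ?mn ?subr0 //= [X in _ + X]big1 ?addr0; last first.
  move=> c /andP [_ c0]; rewrite !actM En ?(lin0 (act_linr _)) ?scaler0 //.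
  by rewrite lt0n; apply: contra c0 => /eqP c0; apply/eqP/val_inj.
rewrite expr0 mul1r mulr1 act_exp; set k := (X in X *: _).
have k0 : k != 0.
  rewrite /k (inj_eq (@complexI R)) /= mulf_neq0 // ?invr_eq0 ?mulf_neq0 ?qfact_neq0 //.
    by rewrite signr_eq0.
  by rewrite expfz_neq0 // gt_eqF // qr_gt0.
split; first by rewrite scaler_eq0 negb_or k0 nz.
apply: has_wtZ; have := ladder_wt_iter q_gt0 false r n vm; rewrite /lroot /ladder.
by rewrite /srefl mn -natz scaler_nat mulNrn.
Qed.

(** To apply [lT_singular] at each letter, E_r must kill the vector built so far. If not,
    transporting the new weight back by the suffix s' gives the weight w + s'^-1 alpha_r, which is
    not below w because s'^-1 alpha_r is positive by [lw_suffix]. *)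
Lemma lT_word (w : domw L) s s' : w0 = s' ++ s :> seq I ->
  let v := foldr (fun r v => lT T r v) (ir_hw (V w)) s in
  v != 0 /\ has_wt v (wa s (val w)).
Proof.
elim: s s' => [|r s IHs] s' w0E /=; first by split; [exact: hw_neq0|exact: has_wt_hw].
have [|v0 vm] := IHs (rcons s' r); first by rewrite cat_rcons.
set v := foldr _ _ _ in v0 vm *; apply: lT_singular => //.
apply: contrapT => /eqP Ev0.
have [v' v'0 v'm] := wt_wact q_gt0 q_lt1 (rev s) Ev0 (has_wt_E q_gt0 r vm).
have [t /(congr1 (wip ones))] := wt_below q_gt0 q_lt1 v'0 v'm.
rewrite wactD wact_revK wipDr wipBr => /addrI e.
have := lw_suffix q_gt0 q_lt1 V w0E; rewrite wact_rev_wip e oppr_gt0 ltNge.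
by rewrite wip_sumr sumr_ge0 // => i _; rewrite wip_ones ltW // hlen_gt0.
Qed.

Lemma eta_wt w : Defs.eta T w0 w != 0 /\ has_wt (Defs.eta T w0 w) (wa w0 (val w)).
Proof.
have [v0 vm] := @lT_word w w0 [::] erefl.
by split; [rewrite scaler_eq0 negb_or v0 cpow_neq0|exact: has_wtZ].
Qed.

(** A nonzero image, transported back by w0, would have the weight w - w0^-1 alpha_r, which is not
    below w since w0^-1 alpha_r is negative. *)
Lemma eta_F r w : ir_act (uF r) (Defs.eta T w0 w) = 0.
Proof.
have [e0 em] := eta_wt w.
apply: contrapT => /eqP Fv0.
have [v' v'0 v'm] := wt_wact q_gt0 q_lt1 (rev w0) Fv0 (has_wt_F q_gt0 r em).
have [t /(congr1 (wip ones))] := wt_below q_gt0 q_lt1 v'0 v'm.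
rewrite wactD wactN wact_revK !wipBr => /addrI /oppr_inj e.
have := lw_antidominant q_gt0 q_lt1 V w0 r; rewrite wact_rev_wip e ltNge.
by rewrite wip_sumr sumr_ge0 // => i _; rewrite wip_ones ltW // hlen_gt0.
Qed.

End LowestWeight.

(** * Actions on Pol_q(K) and q-commutation *)

Section HopfStar.
Variables (R : realType).
Local Notation C := R[i].

Lemma star_lin0 (B : starAlg R) : star (0 : B) = 0.
Proof. by have := starL (-1) (0 : B) 0; rewrite scaler0 addr0 rmorphN1 scaleN1r addNr. Qed.

Lemma starZ (B : starAlg R) c (x : B) : star (c *: x) = c^* *: star x.
Proof. by have := starL c x 0; rewrite !addr0 star_lin0 addr0. Qed.

Lemma starD (B : starAlg R) (x y : B) : star (x + y) = star x + star y.
Proof. by have := starL 1 x y; rewrite !scale1r rmorph1 scale1r. Qed.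

Lemma starN (B : starAlg R) (x : B) : star (- x) = - star x.
Proof. by rewrite -scaleN1r starZ rmorphN1 scaleN1r. Qed.

Lemma star_sum (B : starAlg R) (J : Type) (s : seq J) (F : J -> B) :
  star (\sum_(j <- s) F j) = \sum_(j <- s) star (F j).
Proof. by apply: (big_morph _ (@starD B) (star_lin0 B)). Qed.

Lemma counit_lin (H : hopfStar R) : scalar (@counit R H).
Proof. by have [] := counit_hom H. Qed.

Lemma counit1 (H : hopfStar R) : counit (1 : H) = 1.
Proof. by have [] := counit_hom H. Qed.

Lemma antipode1 (H : hopfStar R) : antipode (1 : H) = 1.
Proof.
have b : bilin (fun x y : H => antipode x * y).
  split=> [y|x] c u v; last by rewrite mulrDr -scalerAr.
  by rewrite antipode_lin mulrDl -scalerAl.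
by have := antipodel (1 : H); rewrite (tens_one (@cop_hom _ H) b) mulr1 counit1 scale1r.
Qed.
End HopfStar.

Section Actions.
Variables (R : realType) (q : R) (q_gt0 : 0 < q) (L : rootDatum R) (U : uqK q L).
Variable V : forall w : domw L, irrep U (val w).
Variable A : polK V.
Local Notation C := R[i].
Local Notation P := 'rV[int]_(rk L).
Local Notation I := 'I_(rk L).
Local Notation qp x := (cpow q x).
Local Notation uK w := (uk_gen U (gK w)).
Local Notation uE r := (uk_gen U (gE r)).
Local Notation uF r := (uk_gen U (gF r)).
Local Notation a_ := (sroot L).

Lemma copK w : tens_eq (cop (uK w)) [:: (uK w, uK w)].
Proof. by have [] := uk_cop U. Qed.
Lemma copE r : tens_eq (cop (uE r)) [:: (uE r, uK (a_ r)); (1, uE r)].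
Proof. by have [_ /(_ r) []] := uk_cop U. Qed.
Lemma copF r : tens_eq (cop (uF r)) [:: (uF r, 1); (uK (- a_ r), uF r)].
Proof. by have [_ /(_ r) []] := uk_cop U. Qed.

Lemma uKV w : uK w * uK (- w) = 1. Proof. by rewrite uKD subrr uK0. Qed.
Lemma uVK w : uK (- w) * uK w = 1. Proof. by rewrite uKD addNr uK0. Qed.

Lemma antipode_bilin : bilin (fun x y : U => antipode x * y).
Proof.
split=> [y|x] c u v; last by rewrite mulrDr -scalerAr.
by rewrite antipode_lin mulrDl -scalerAl.
Qed.

Lemma counit_bilin : bilin (fun x y : U => counit x *: y).
Proof.
split=> [y|x] c u v; last by rewrite scalerDr !scalerA mulrC.
by rewrite counit_lin scalerDl scalerA.
Qed.

Lemma antipodeK w : antipode (uK w) = uK (- w).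
Proof.
have := counitl (uK w); rewrite (tens_eq_bilin counit_bilin (copK w)) big_seq1 /=.
move=> /(congr1 (fun x => x * uK (- w))); rewrite -scalerAl uKV => e.
have := antipodel (uK w); rewrite (tens_eq_bilin antipode_bilin (copK w)) big_seq1 /= e.
by move=> /(congr1 (fun x => x * uK (- w))); rewrite -mulrA uKV mulr1 mul1r.
Qed.

Lemma antipodeE r : antipode (uE r) = - (uE r * uK (- a_ r)).
Proof.
have := counitl (uE r); rewrite (tens_eq_bilin counit_bilin (copE r)) big_cons big_seq1 /=.
rewrite counit1 scale1r => /(canRL (addrK _)); rewrite subrr.
move=> /(congr1 (fun x => x * uK (- a_ r))); rewrite -scalerAl uKV mul0r => e.
have := antipodel (uE r); rewrite (tens_eq_bilin antipode_bilin (copE r)) big_cons big_seq1 /= e.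
rewrite antipode1 mul1r => /eqP; rewrite addr_eq0 => /eqP.
by move=> /(congr1 (fun x => x * uK (- a_ r))); rewrite -mulrA uKV mulr1 mulNr.
Qed.

Lemma star_antipodeK w : star (antipode (uK w)) = uK (- w).
Proof. by rewrite antipodeK uK_star. Qed.

Lemma star_antipodeE r : star (antipode (uE r)) = - (qp (wip (a_ r) (a_ r)) *: uF r).
Proof.
rewrite antipodeE starN starM uK_star uE_star mulrA uKF wipNl opprK -scalerAl.
by rewrite -mulrA uVK mulr1.
Qed.

Lemma ract1 (x : A) : ract x 1 = x.
Proof. by rewrite /ract -[RHS]counitl; apply: eq_bigr => p _; rewrite pk_pair1. Qed.

Lemma pk_lact X (x : A) Y : pk_pair (lact X x) Y = pk_pair x (Y * X).
Proof.
rewrite (lin_sum (V := C^o) _ _ _ (pk_linl Y)) pk_pairM; apply: eq_bigr => p _.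
by rewrite (linZ (V := C^o) (pk_linl Y)) mulrC.
Qed.

Lemma lact_mcoef w (v u : V w) X : lact X (mcoef A v u) = mcoef A v (ir_act X u).
Proof. by apply: pk_inj => Y; rewrite pk_lact !mcoefE actM. Qed.

Lemma lact_mul (x y : A) X :
  lact X (x * y) = \sum_(p <- cop X) lact p.1 x * lact p.2 y.
Proof.
rewrite /lact (tens_mul (@cop_hom _ A) _ _ (lact_bilin A X)).
under eq_bigr do under eq_bigr do rewrite pk_mul scaler_suml.
rewrite [RHS](eq_bigr (fun p => \sum_(s <- cop x) \sum_(t <- cop y)
   (pk_pair s.2 p.1 * pk_pair t.2 p.2) *: (s.1 * t.1))); last first.
  move=> p _; rewrite mulr_suml; apply: eq_bigr => s _; rewrite mulr_sumr.
  by apply: eq_bigr => t _; rewrite -scalerAl -scalerAr scalerA.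
rewrite [RHS]exchange_big /=; apply: eq_bigr => s _.
by rewrite [RHS]exchange_big.
Qed.

Lemma ract_mul_bilin (x y : A) : bilin (fun X Y => ract x X * ract y Y).
Proof.
split=> [Y|X] c u v; first by rewrite ract_linr mulrDl -scalerAl.
by rewrite ract_linr mulrDr -scalerAr.
Qed.

Lemma lact_mul_bilin (x y : A) : bilin (fun X Y => lact X x * lact Y y).
Proof.
split=> [Y|X] c u v; first by rewrite lact_linl mulrDl -scalerAl.
by rewrite lact_linl mulrDr -scalerAr.
Qed.

Lemma ract_mulE (x y : A) r :
  ract (x * y) (uE r) = ract x (uE r) * ract y (uK (a_ r)) + x * ract y (uE r).
Proof.
rewrite ract_mul (tens_eq_bilin (ract_mul_bilin x y) (copE r)) big_cons big_seq1 /=.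
by rewrite ract1.
Qed.

Lemma ract_mulF (x y : A) r :
  ract (x * y) (uF r) = ract x (uF r) * y + ract x (uK (- a_ r)) * ract y (uF r).
Proof.
rewrite ract_mul (tens_eq_bilin (ract_mul_bilin x y) (copF r)) big_cons big_seq1 /=.
by rewrite ract1.
Qed.

Lemma lact_mulF (x y : A) r :
  lact (uF r) (x * y) = lact (uF r) x * y + lact (uK (- a_ r)) x * lact (uF r) y.
Proof.
rewrite lact_mul (tens_eq_bilin (lact_mul_bilin x y) (copF r)) big_cons big_seq1 /=.
by rewrite lact1.
Qed.

(** Combined with [star_antipodeE], this turns a starred relation for E_r into one for F_r. *)
Lemma ract_star (x : A) X : star (ract (star x) X) = ract x (star (antipode X)).
Proof.
rewrite /ract (tens_eq_bilin (ract_bilin A X) (cop_star x)) big_map star_sum.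
by apply: eq_bigr => p _; rewrite /= starZ starK pk_star conjCK.
Qed.

Lemma mcoefZl w c (v u : V w) : mcoef A (c *: v) u = c^* *: mcoef A v u.
Proof.
apply: pk_inj => X.
by rewrite (linZ (V := C^o) (pk_linl X)) !mcoefE (innerZl (ipI (V w))).
Qed.

Lemma mcoefZr w c (v u : V w) : mcoef A v (c *: u) = c *: mcoef A v u.
Proof. exact: (linZ (mcoef_linr A v)). Qed.

Lemma ractK_mcoef w (v u : V w) l w' : has_wt v l ->
  ract (mcoef A v u) (uK w') = qp (wip w' l) *: mcoef A v u.
Proof. by move=> vl; rewrite ract_mcoef uK_star vl mcoefZl cpow_conj. Qed.

Lemma lactK_mcoef w (v u : V w) m w' : has_wt u m ->
  lact (uK w') (mcoef A v u) = qp (wip w' m) *: mcoef A v u.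
Proof. by move=> um; rewrite lact_mcoef um mcoefZr. Qed.

Lemma ractF_mcoef w (v u : V w) l r : has_wt v l ->
  ract (mcoef A v u) (uF r) = qp (- wip (a_ r) (l + a_ r)) *: mcoef A (ir_act (uE r) v) u.
Proof.
move=> vl; rewrite ract_mcoef uF_star actM (has_wt_E q_gt0 r vl) mcoefZl cpow_conj.
by rewrite wipNl.
Qed.

End Actions.

(** * Elements of Pol_q(K) killed by all F_r on both sides *)

Section PeterWeyl.
Variables (R : realType) (q : R) (q_gt0 : 0 < q) (q_lt1 : q < 1).
Variables (L : rootDatum R) (U : uqK q L).
Variable V : forall w : domw L, irrep U (val w).
Variables (A : polK V) (T : lusztigT V) (w0 : longestWord L).
Local Notation C := R[i].
Local Notation P := 'rV[int]_(rk L).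
Local Notation I := 'I_(rk L).
Local Notation uK w := (uk_gen U (gK w)).
Local Notation uE r := (uk_gen U (gE r)).
Local Notation uF r := (uk_gen U (gF r)).
Local Notation a_ := (sroot L).

(** An arbitrary element of [A] is a sum of coefficients of various irreducible modules. In a class
    of modules closed under direct sums it becomes a single coefficient. *)
Record umod := Umod {
  um :> vectType C;
  um_ip : um -> um -> C;
  um_act : U -> um -> um;
  um_inner : is_inner um_ip;
  um_rep : is_rep um_act;
  um_star : forall X v u, um_ip (um_act X v) u = um_ip v (um_act (star X) u) }.

Definition irrep_umod w (W : irrep U w) : umod :=
  Umod (ir_inner W) (ir_rep W) (@ir_star _ _ _ _ _ W).

Section Sum.
Variables M N : umod.

Definition sum_ip (x y : (M * N)%type) : C := um_ip x.1 y.1 + um_ip x.2 y.2.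
Definition sum_act (X : U) (x : (M * N)%type) : (M * N)%type := (um_act X x.1, um_act X x.2).

Lemma sum_inner : is_inner sum_ip.
Proof.
have [Ml MC Mp M0] := um_inner M; have [Nl NC Np N0] := um_inner N.
split=> [x c y z|x y|x|[x1 x2]]; rewrite /sum_ip /=.
- by rewrite Ml Nl mulrDr addrACA.
- by rewrite MC NC rmorphD.
- by rewrite addr_ge0.
move=> /eqP; rewrite paddr_eq0 // => /andP [/eqP/M0 -> /eqP/N0 ->] //.
Qed.

Lemma sum_rep : is_rep sum_act.
Proof.
have [Ml Mr M1 MM] := um_rep M; have [Nl Nr N1 NM] := um_rep N.
split=> [x c X Y|X c x y|[x y]|X Y [x y]]; rewrite /sum_act /=.
- by rewrite Ml Nl.
- by rewrite Mr Nr.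
- by rewrite M1 N1.
- by rewrite MM NM.
Qed.

Definition sum_umod : umod.
Proof.
apply: (Umod sum_inner sum_rep) => X v u; rewrite /sum_ip /=.
by rewrite !um_star.
Defined.

End Sum.

Definition bspan : {malg C[domw L]} -> A := mext (bpol A T w0).

Lemma bspan_lin : linear bspan. Proof. exact: mext_lin. Qed.

(** Stated as a property of the module so that it passes to direct sums; no decomposition into
    irreducible submodules has to be recovered afterwards. *)
Definition extremal_coef (M : umod) := forall v u : M,
  (forall r, um_act (uE r) v = 0) -> (forall r, um_act (uF r) u = 0) ->
  exists h, forall X, um_ip v (um_act X u) = pk_pair (bspan h) X.

Lemma extremal_coef_irrep w : extremal_coef (irrep_umod (V w)).
Proof.
move=> v u /= Ev Fu; have [e0 em] := eta_wt q_gt0 q_lt1 T w0 w.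
have [c ->] := extremal_unique q_gt0 (b := false) (hw_neq0 (V w)) (has_wt_hw (V w))
  (@ir_hw_E _ _ _ _ _ (V w)) Ev.
have [d ->] := extremal_unique q_gt0 (b := true) e0 em
  (fun r => eta_F q_gt0 q_lt1 T w0 r w) Fu.
exists ((c^* * d) *: << w >>) => X; rewrite (linZ bspan_lin) /bspan mextU.
rewrite (linZ (act_linr X)) (innerZl (ipI (V w))) (innerZr (ipI (V w))).
by rewrite (linZ (V := C^o) (pk_linl X)) mcoefE mulrA.
Qed.

Lemma extremal_coef_sum M N : extremal_coef M -> extremal_coef N ->
  extremal_coef (sum_umod M N).
Proof.
move=> Mc Nc [v v'] [u u'] /= Ev Fu.
have [|r|h hE] := Mc v u; first by move=> r; have [] := Ev r.
  by have [] := Fu r.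
have [|r|h' h'E] := Nc v' u'; first by move=> r; have [] := Ev r.
  by have [] := Fu r.
exists (h + h') => X; rewrite (linD bspan_lin) (linD (V := C^o) (pk_linl X)).
by rewrite -hE -h'E.
Qed.

Lemma polK_coef (z : A) : exists M : umod, extremal_coef M /\
  exists v u : M, forall X, pk_pair z X = um_ip v (um_act X u).
Proof.
move: z; apply: (polK_ind q_gt0) => [w v u l m vl um||c x y].
- exists (irrep_umod (V w)); split; first exact: extremal_coef_irrep.
  by exists v, u => X; rewrite mcoefE.
- have d0 : dominant (0 : P) by apply/forallP => r; rewrite mxE.
  pose w : domw L := exist (fun w => dominant w) 0 d0.
  exists (irrep_umod (V w)); split; first exact: extremal_coef_irrep.
  exists 0, 0 => X; rewrite (lin0 (V := C^o) (pk_linl X)) /=.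
  by rewrite (inner0l (ipI (V w))).
move=> [M [Mc [v [u vu]]]] [N [Nc [v' [u' v'u']]]].
exists (sum_umod M N); split; first exact: extremal_coef_sum.
exists (c^* *: v, v'), (u, u') => X; rewrite /= /sum_ip /= (innerZl (um_inner M)) conjCK.
by rewrite pk_linl vu v'u'.
Qed.

Section Cyclic.
Variable M : umod.

Lemma um_linl (v : M) : linear (fun X => um_act X v). Proof. by have [] := um_rep M. Qed.
Lemma um_linr X : linear (@um_act M X). Proof. by have [] := um_rep M. Qed.
Lemma um_act1 (v : M) : um_act 1 v = v. Proof. by have [] := um_rep M. Qed.
Lemma um_actM X Y (v : M) : um_act (X * Y) v = um_act X (um_act Y v).
Proof. by have [] := um_rep M. Qed.

Lemma cyclic_vspace (u : M) : exists W : {vspace M}, forall v,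
  (v \in W) <-> exists X, v = um_act X u.
Proof.
have [W WP] := lspan_vspace (range (fun X => um_act X u)).
exists W => v; split=> [/WP|[X ->]]; last by apply/WP/lspan_in; exists X.
move: v; apply: (@lspan_ind _ _ _ (fun v => exists X, v = um_act X u)) => [_ [X _ <-]||].
- by exists X.
- by exists 0; rewrite (lin0 (um_linl u)).
- by move=> c _ _ [X ->] [Y ->]; exists (c *: X + Y); rewrite um_linl.
Qed.

End Cyclic.

(* Write z(X) = <v, X u> in a finite unitary module.  Projecting v onto U u and
   then u onto U v turns the vanishing of z on F_r U and U F_r into E_r v = 0 and
   F_r u = 0, so that each component of v, u is extremal. *)
Lemma polK_extremal (z : A) : (forall r, ract z (uF r) = 0) ->
  (forall r, lact (uF r) z = 0) -> exists h, z = bspan h.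
Proof.
have [M [Mc [v [u vu]]]] := polK_coef z => zF Fz; have ipM := um_inner M.
have zFX r X : pk_pair z (uF r * X) = 0.
  by rewrite -pk_ract zF (lin0 (V := C^o) (pk_linl X)).
have zXF r X : pk_pair z (X * uF r) = 0.
  by rewrite -pk_lact Fz (lin0 (V := C^o) (pk_linl X)).
have adj X (x y : M) : um_ip x (um_act X y) = um_ip (um_act (star X) x) y.
  by rewrite um_star starK.
have [W WP] := cyclic_vspace u.
have [v1 v1W v1P] := orthogonal_projection ipM W v.
have [X1 v1E] : exists X, v1 = um_act X u by apply/WP.
have z1 X : pk_pair z X = um_ip v1 (um_act X u).
  rewrite vu -[v](subrK v1) -[v - v1]scale1r (inner_linl ipM) v1P ?mulr0 ?add0r //.
  by apply/WP; exists X.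
(* As v1 = X1 u, the squared norm of F_r-star v1 is the value of [z] at a product beginning with
   F_r, which vanishes. This is the reason for projecting v onto the cyclic module of u. *)
have Fv1 r : um_act (star (uF r)) v1 = 0.
  apply: (inner_eq0 ipM); rewrite {2}v1E -um_actM -adj -um_actM -z1; exact: zFX.
have Ev1 r : um_act (uE r) v1 = 0.
  have := Fv1 r; rewrite uF_star um_actM => /(congr1 (um_act (uK (a_ r)))).
  by rewrite -um_actM uKV um_act1 (lin0 (um_linr _)).
have [W' W'P] := cyclic_vspace v1.
have [u1 u1W u1P] := orthogonal_projection ipM W' u.
have [X2 u1E] : exists X, u1 = um_act X v1 by apply/W'P.
have z2 X : pk_pair z X = um_ip v1 (um_act X u1).
  rewrite z1 !adj -[u](subrK u1) -[u - u1]scale1r (inner_linr ipM) (innerC ipM).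
  by rewrite u1P ?conjC0 ?mulr0 ?add0r //; apply/W'P; exists (star X).
(* Likewise u1 = X2 v1 makes the squared norm of F_r u1 a value of [z] at a product ending with
   F_r. *)
have Fu1 r : um_act (uF r) u1 = 0.
  apply: (inner_eq0 ipM); rewrite {1}u1E -um_actM um_star -um_actM -z2; exact: zXF.
have [h hE] := Mc v1 u1 Ev1 Fu1.
by exists h; apply: pk_inj => X; rewrite z2 hE.
Qed.

End PeterWeyl.

Lemma count_ltn (E : eqType) (p' p : pred E) (s : seq E) x :
  x \in s -> p x -> ~~ p' x -> subpred p' p -> (count p' s < count p s)%N.
Proof.
move=> xs px p'x sub; elim: s xs => //= y s IHs; rewrite inE => /predU1P [<-|/IHs lt].
  by rewrite px (negPf p'x) add0n add1n ltnS sub_count.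
by rewrite -addnS leq_add //; case: (p' y) (sub y) => // ->.
Qed.

(** * The q-commutation of b_w with coefficients *)

Section QCommutation.
Variables (R : realType) (q : R) (q_gt0 : 0 < q) (q_lt1 : q < 1).
Variables (L : rootDatum R) (U : uqK q L).
Variable V : forall w : domw L, irrep U (val w).
Variables (A : polK V) (T : lusztigT V) (w0 : longestWord L).
Variable S : forall r, su2Restriction A r.
Variables (Pe : polExt A T w0) (Fe : funExt Pe) (rho : extRep S Fe).
Local Notation C := R[i].
Local Notation P := 'rV[int]_(rk L).
Local Notation I := 'I_(rk L).
Local Notation qp x := (cpow q x).
Local Notation uK w := (uk_gen U (gK w)).
Local Notation uE r := (uk_gen U (gE r)).
Local Notation uF r := (uk_gen U (gF r)).
Local Notation a_ := (sroot L).
Local Notation wa := (wact a_).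
Local Notation pX x := (pe_gen Pe (xPol x)).
Local Notation pU w := (pe_gen Pe (xU _ w)).
Local Notation pB w := (pe_gen Pe (xB _ w)).
Local Notation fX y := (am_gen Fe (aX _ y)).
Local Notation bp := (bpol A T w0).

Lemma pe_rel : rel_ext T w0 (pe_gen Pe). Proof. by have [] := pe_presents Pe. Qed.

Lemma pX_hom : star_hom (fun x => pX x). Proof. by have [] := pe_rel. Qed.
Lemma pX_lin : linear (fun x => pX x). Proof. by have [/alg_hom_lin] := pX_hom. Qed.
Lemma pXM x y : pX (x * y) = pX x * pX y. Proof. by have [/alg_homM ->] := pX_hom. Qed.
Lemma pU0 : pU 0 = 1. Proof. by have [_ []] := pe_rel. Qed.
Lemma pUD v w : pU v * pU w = pU (v + w). Proof. by have [_ []] := pe_rel. Qed.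
Lemma pU_pX w x : pU w * pX x = pX x * pU w. Proof. by have [_ []] := pe_rel. Qed.
Lemma pU_pB v w : pU v * pB w = pB w * pU v. Proof. by have [_ []] := pe_rel. Qed.
Lemma pB0 : pB 0 = 1. Proof. by have [_ _ []] := pe_rel. Qed.
Lemma pBD v w : pB v * pB w = pB (v + w). Proof. by have [_ _ []] := pe_rel. Qed.
Lemma pB_pX w l m x : bihomog l m x ->
  pB w * pX x = qp (wip w (l - wa w0 m)) *: (pX x * pB w).
Proof. by have [_ _ _ H _] := pe_rel; exact: H. Qed.
Lemma pX_bp (w : domw L) : pX (bp w) = pU (val w) * pB (val w).
Proof. by have [] := pe_rel. Qed.

Lemma pX_bp_comm (w : domw L) l m x : bihomog l m x ->
  pX (bp w * x) = qp (wip (val w) (l - wa w0 m)) *: pX (x * bp w).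
Proof.
move=> xlm; rewrite !pXM pX_bp -mulrA (pB_pX _ xlm) -scalerAr.
by congr (_ *: _); rewrite !mulrA pU_pX.
Qed.

Lemma bp_bihomog (w : domw L) : bihomog (val w) (wa w0 (val w)) (bp w).
Proof.
have [_ em] := eta_wt q_gt0 q_lt1 T w0 w.
by apply: bihomog_mcoef em; exact: has_wt_hw.
Qed.

(* b_w = u_w |b|_w is invertible and commutes with every |b|_x. *)
Lemma w0_involutive (w : domw L) : wa w0 (wa w0 (val w)) = val w.
Proof.
apply: wip_inj => x; apply/eqP; rewrite -subr_eq0 -oppr_eq0 opprB -wipBr; apply/eqP.
apply: (cpow_inj q_gt0 (q_neq1 q_lt1)); rewrite cpow0.
(* The grading relation between |b|_x and b_w carries the scalar q^(x, w - w0 w0 w). The two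
   elements also commute and their product is invertible, so this scalar is 1. *)
have := pB_pX x (bp_bihomog w); rewrite pX_bp.
set c := qp _ => e; have {}e : pU (val w) * (pB (val w) * pB x) =
    c *: (pU (val w) * (pB (val w) * pB x)).
  by rewrite [in RHS]mulrA -e [RHS]mulrA -pU_pB -!mulrA !pBD addrC.
have {}e : c *: 1 = (1 : Pe).
  have k : (pU (- val w) * (pU (val w) * (pB (val w) * pB x))) * pB (- (val w + x)) = 1.
    by rewrite [X in X * _]mulrA pUD addNr pU0 mul1r !pBD subrr pB0.
  by rewrite -[in RHS]k e -scalerAr -scalerAl k.
apply/eqP; rewrite -subr_eq0; apply/negPn/negP => c1.
have : (c - 1) *: (1 : Pe) = 0 by rewrite scalerBl e scale1r subrr.
by move/eqP; rewrite scaler_eq0 (negPf c1) oner_eq0.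
Qed.

Lemma w0_rev (w : domw L) : wa (rev w0) (val w) = wa w0 (val w).
Proof. by rewrite -{1}w0_involutive wact_revK. Qed.

Lemma fe_rel : rel_amp (@ext_lhomog _ _ _ _ _ _ _ _ Pe) (am_gen Fe).
Proof. by have [] := am_presents Fe. Qed.

Lemma fX_hom : star_hom (fun y => fX y). Proof. by have [] := fe_rel. Qed.
Lemma fX_lin : linear (fun y => fX y). Proof. by have [/alg_hom_lin] := fX_hom. Qed.
Lemma fXM x y : fX (x * y) = fX x * fX y. Proof. by have [/alg_homM ->] := fX_hom. Qed.
Lemma fX1 : fX 1 = 1. Proof. by have [/alg_hom1] := fX_hom. Qed.
Lemma fX_star y : fX (star y) = star (fX y). Proof. by have [_] := fX_hom. Qed.

Lemma ext_x_lin : linear (ext_x Fe).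
Proof. by move=> c x y; rewrite /ext_x pX_lin fX_lin. Qed.

Lemma er_linl v : linear (fun y => rho y v). Proof. by have [] := er_rep rho. Qed.
Lemma er_linr y : linear (rho y). Proof. by have [] := er_rep rho. Qed.
Lemma er1 v : rho 1 v = v. Proof. by have [] := er_rep rho. Qed.
Lemma erM x y v : rho (x * y) v = rho x (rho y v). Proof. by have [] := er_rep rho. Qed.

Lemma vatU (chi : P) (t : (size w0).-tuple nat) : vat chi << t >> = << (chi, t) >> :> Lh0 w0.
Proof. exact: mextU. Qed.

Lemma er_bp (w : domw L) chi (t : (size w0).-tuple nat) :
  exists2 c, c != 0 & rho (ext_x Fe (bp w)) << (chi, t) >> = c *: << (chi + val w, t) >>.
Proof.
rewrite /ext_x pX_bp fXM erM (er_b rho) (linZ (er_linr _)) -vatU (er_u rho) vatU scalerA.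
eexists; last by [].
by rewrite mulf_neq0 ?signr_eq0 // cpow_neq0.
Qed.

(** On a basis vector of degree 0, b_w acts as a nonzero scalar followed by a shift of the degree to
    w, so distinct w land on distinct basis vectors. *)
Lemma bspan_inj h : (forall v, rho (ext_x Fe (bspan A T w0 h)) v = 0) -> h = 0.
Proof.
move=> hv; apply/malgP => w; rewrite mcoeff0.
pose t : (size w0).-tuple nat := nseq_tuple (size w0) 0%N.
have := congr1 (mcoeff (val w, t)) (hv << (0, t) >>); rewrite mcoeff0.
rewrite /bspan /mext (lin_sum _ _ _ ext_x_lin) (lin_sum _ _ _ (er_linl _)) raddf_sum /=.
have coef w' : (rho (ext_x Fe (h@_w' *: bp w')) << (0, t) >>)@_(val w, t) != 0 -> w' = w.
  rewrite (linZ ext_x_lin) (linZ (er_linl _)); have [c _ ->] := er_bp w' 0 t.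
  rewrite !mcoeffZ mcoeffU; have [[]|_] := (0 + val w', t) =P (val w, t); last first.
    by rewrite !mulr0 eqxx.
  by rewrite add0r => /val_inj.
have [wh|/mcoeff_outdom //] := boolP (w \in msupp h).
rewrite (big_fsetD1 w wh) /= big1_fset => [|w']; last first.
  rewrite !inE => /andP [w'w _] _; apply/eqP; apply: contraNT w'w => /coef ->.
  exact: eqxx.
rewrite addr0 (linZ ext_x_lin) (linZ (er_linl _)); have [c c0 ->] := er_bp w 0 t.
rewrite !mcoeffZ mcoeffU add0r eqxx mulr1 => /eqP.
by rewrite mulf_eq0 (negPf c0) orbF => /eqP.
Qed.

Lemma pol_ext_zero (z : A) : pX z = 0 -> (forall r, ract z (uF r) = 0) ->
  (forall r, lact (uF r) z = 0) -> z = 0.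
Proof.
move=> z0 zF Fz; have [h zE] := polK_extremal q_gt0 q_lt1 T w0 zF Fz.
rewrite zE (@bspan_inj h) ?(lin0 (bspan_lin A T w0)) // => v.
by rewrite -zE /ext_x z0 (lin0 fX_lin) (lin0 (er_linl _)).
Qed.

Definition qcomm (w w' : domw L) (v u : V w') l m : A :=
  bp w * mcoef A v u - qp (wip (val w) (l - wa w0 m)) *: (mcoef A v u * bp w).

Lemma qcomm_pX w w' (v u : V w') l m : has_wt v l -> has_wt u m -> pX (qcomm w v u l m) = 0.
Proof.
move=> vl um; rewrite /qcomm (linB pX_lin) (linZ pX_lin).
by rewrite (pX_bp_comm w (bihomog_mcoef A vl um)) subrr.
Qed.

(** F_r kills b_w from the right because its left vector is of highest weight. The twisted Leibniz
    rule then keeps only the terms where F_r meets the coefficient, and the K-factor on b_w accounts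
    for the change from l to l + alpha_r. *)
Lemma ract_qcomm w w' (v u : V w') l m r : has_wt v l ->
  exists c, ract (qcomm w v u l m) (uF r) = c *: qcomm w (ir_act (uE r) v) u (l + a_ r) m.
Proof.
move=> vl; have yF : ract (bp w) (uF r) = 0.
  rewrite (ractF_mcoef q_gt0 A _ r (has_wt_hw (V w))) ir_hw_E.
  by rewrite -(scale0r 0) mcoefZl rmorph0 !scale0r scaler0.
exists (qp (- wip (a_ r) (l + a_ r)) * qp (- wip (a_ r) (val w))).
rewrite /qcomm (linB (ract_linl _)) (linZ (ract_linl _)) !ract_mulF yF mul0r mulr0 add0r addr0.
rewrite (ractF_mcoef q_gt0 A _ r vl) (ractK_mcoef A _ _ (has_wt_hw (V w))).
rewrite -scalerAl -!scalerAr -scalerAl !scalerA scalerBr !scalerA wipNl.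
congr (_ *: _ - _ *: _); first by rewrite mulrC.
rewrite mulrC -mulrA; congr (_ * _); rewrite -cpowD //; congr (qp _).
by rewrite !wipBr wipDr [wip (a_ r) _]wipC; ring.
Qed.

(** From the left F_r kills b_w by [eta_F]. The exponents match after exchanging (w, w0 alpha_r)
    with (w0 w, alpha_r), which rests on w0 being an involution. *)
Lemma lact_qcomm w w' (v u : V w') l m r : has_wt u m ->
  exists c, lact (uF r) (qcomm w v u l m) = c *: qcomm w v (ir_act (uF r) u) l (m - a_ r).
Proof.
move=> um; have [_ em] := eta_wt q_gt0 q_lt1 T w0 w.
have Fy : lact (uF r) (bp w) = 0.
  by rewrite lact_mcoef (eta_F q_gt0 q_lt1) -(scale0r 0) mcoefZr scale0r.
exists (qp (- wip (a_ r) (wa w0 (val w)))).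
rewrite /qcomm (linB (lact_linr _)) (linZ (lact_linr _)) !lact_mulF Fy mul0r mulr0 add0r addr0.
rewrite (lactK_mcoef A _ _ em) !lact_mcoef -!scalerAl scalerBr !scalerA wipNl.
congr (_ *: _ - _ *: _); rewrite -cpowD //; congr (qp _).
rewrite wactD wactN !wipBr [wip _ (wa w0 (a_ r))]wact_wip w0_rev [wip (a_ r) _]wipC.
by ring.
Qed.

(* Induction on the number of weights above that of v, then below that of u. *)
Lemma bp_qcomm (w w' : domw L) (v u : V w') l m : has_wt v l -> has_wt u m ->
  bp w * mcoef A v u = qp (wip (val w) (l - wa w0 m)) *: (mcoef A v u * bp w).
Proof.
move=> vl um; apply/eqP; rewrite -subr_eq0 -/(qcomm w v u l m); apply/eqP.
have [wl wlP] := wt_list q_gt0 q_lt1 (V w').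
pose ht := wip (onesw L).
have htD m' r : ht m' < ht (m' + a_ r) by rewrite /ht wipDr wip_ones ltrDl hlen_gt0.
have htB m' r : ht (m' - a_ r) < ht m' by rewrite /ht wipBr wip_ones ltrBlDr ltrDl hlen_gt0.
pose up m' := count (fun k => ht m' < ht k) wl.
pose down m' := count (fun k => ht k < ht m') wl.
have [n] := ubnP (up l); elim: n v l vl u m um => // n IHn v l vl u m um; rewrite ltnS => un.
have [k] := ubnP (down m); elim: k u m um => // k IHk u m um; rewrite ltnS => dk.
apply: pol_ext_zero => [|r|r]; first exact: qcomm_pX.
- have [c ->] := ract_qcomm w u m r vl.
  have [Ev|Ev] := eqVneq (ir_act (uE r) v) 0.
    by rewrite Ev /qcomm -(scale0r 0) mcoefZl rmorph0 !scale0r mulr0 mul0r scaler0 subrr scaler0.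
  have vm := has_wt_E q_gt0 r vl; rewrite IHn ?scaler0 //.
  apply: leq_trans un; apply: (count_ltn (x := l + a_ r)); rewrite ?htD ?ltxx //.
    exact: wlP Ev vm.
  by move=> k'; apply: lt_trans.
- have [c ->] := lact_qcomm w v l r um.
  have [Fu|Fu] := eqVneq (ir_act (uF r) u) 0.
    by rewrite Fu /qcomm -(scale0r 0) mcoefZr !scale0r mulr0 mul0r scaler0 subrr scaler0.
  have um' := has_wt_F q_gt0 r um; rewrite IHk ?scaler0 //.
  apply: leq_trans dk; apply: (count_ltn (x := m - a_ r)); rewrite ?htB ?ltxx //.
    exact: wlP Fu um'.
  by move=> k' /lt_trans; apply.
Qed.

End QCommutation.

(** * Relations in the amplifications *)

Section ExtRelations.
Variables (R : realType) (q : R) (q_gt0 : 0 < q) (q_lt1 : q < 1).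
Variables (L : rootDatum R) (U : uqK q L).
Variable V : forall w : domw L, irrep U (val w).
Variables (A : polK V) (T : lusztigT V) (w0 : longestWord L).
Variable S : forall r, su2Restriction A r.
Variables (Pe : polExt A T w0) (Fe : funExt Pe) (rho : extRep S Fe).
Local Notation C := R[i].
Local Notation P := 'rV[int]_(rk L).
Local Notation I := 'I_(rk L).
Local Notation qp x := (cpow q x).
Local Notation uK w := (uk_gen U (gK w)).
Local Notation uE r := (uk_gen U (gE r)).
Local Notation uF r := (uk_gen U (gF r)).
Local Notation a_ := (sroot L).
Local Notation wa := (wact a_).
Local Notation pX x := (pe_gen Pe (xPol x)).
Local Notation pU w := (pe_gen Pe (xU _ w)).
Local Notation pB w := (pe_gen Pe (xB _ w)).
Local Notation fX y := (am_gen Fe (aX _ y)).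
Local Notation fF f := (am_gen Fe (aF _ f)).
Local Notation gl := (ext_x Fe).
Local Notation bp := (bpol A T w0).

Lemma fFZ c f : fF (fun x => c * f x) = c *: fF f.
Proof.
have [_ [FL _ _ _] _] := fe_rel Fe.
have F0 : fF (fun=> 0) = 0.
  have := FL (-1) (fun=> 0) (fun=> 0); rewrite scaleN1r addNr => <-.
  by congr (am_gen _ (aF _ _)); apply/funext => x; rewrite mulr0 addr0.
have := FL c f (fun=> 0); rewrite F0 addr0 => <-.
by congr (am_gen _ (aF _ _)); apply/funext => x; rewrite addr0.
Qed.

Lemma fF_fX m y f : ext_lhomog m y -> fF f * fX y = fX y * fF (wshift m f).
Proof. by have [_ _] := fe_rel Fe; apply. Qed.

Lemma zfun_gl w l x : lhomog l x ->
  ext_f Fe (zfun q w) * gl x = qp (- wip w l) *: (gl x * ext_f Fe (zfun q w)).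
Proof.
move=> xl; rewrite /ext_f (fF_fX _ (elh_pol Pe xl)) scalerAr -fFZ; congr (_ * am_gen _ (aF _ _)).
by apply/funext => m; rewrite /wshift /zfun -cpowD // wipBr addrC.
Qed.

Lemma ext_u_gl w x : ext_u Fe w * gl x = gl x * ext_u Fe w.
Proof. by rewrite /ext_u /ext_x -!fXM pU_pX. Qed.

Lemma k_ext_gl w l x : lhomog l x ->
  k_ext Fe w * gl x = qp (- wip w l) *: (gl x * k_ext Fe w).
Proof.
move=> xl; rewrite /k_ext -scalerAl -scalerAr -mulrA ext_u_gl mulrA (zfun_gl _ xl).
by rewrite -scalerAl !scalerA mulrC -mulrA.
Qed.

Lemma l_ext_gl w l x : lhomog l x ->
  l_ext Fe w * gl x = qp (- wip w l) *: (gl x * l_ext Fe w).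
Proof.
move=> xl; rewrite /l_ext -scalerAl -scalerAr -mulrA (zfun_gl _ xl) -scalerAr mulrA ext_u_gl.
by rewrite !scalerA mulrC -mulrA.
Qed.

Lemma glM x y : gl (x * y) = gl x * gl y.
Proof. by rewrite /ext_x pXM fXM. Qed.

Lemma gl_star x : gl (star x) = star (gl x).
Proof. by rewrite /ext_x -fX_star; have [_ ->] := pX_hom Pe. Qed.

Lemma mul_linl (B : algType C) (y : B) (f : A -> B) : linear f -> linear (fun x => y * f x).
Proof. by move=> fl c a b; rewrite fl mulrDr -scalerAr. Qed.

Lemma mul_linr (B : algType C) (y : B) (f : A -> B) : linear f -> linear (fun x => f x * y).
Proof. by move=> fl c a b; rewrite fl mulrDl -scalerAl. Qed.

Lemma gl_k w x : gl x * k_ext Fe w = k_ext Fe w * gl (ract x (uK w)).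
Proof.
move: x; apply: (polK_lin_eq q_gt0) => [||w' v u l m vl um].
- exact/mul_linr/ext_x_lin.
- by apply: mul_linl; apply: lin_comp; [exact: ext_x_lin|exact: ract_linl].
rewrite /= (ractK_mcoef A _ _ vl) (linZ (@ext_x_lin _ _ _ _ _ _ _ _ _ Fe)) -[RHS]scalerAr.
by rewrite (k_ext_gl _ (lhomog_mcoef A u vl)) scalerA -cpowD // subrr cpow0 scale1r.
Qed.

Lemma gl_l w x : gl x * l_ext Fe w = l_ext Fe w * gl (ract x (uK w)).
Proof.
move: x; apply: (polK_lin_eq q_gt0) => [||w' v u l m vl um].
- exact/mul_linr/ext_x_lin.
- by apply: mul_linl; apply: lin_comp; [exact: ext_x_lin|exact: ract_linl].
rewrite /= (ractK_mcoef A _ _ vl) (linZ (@ext_x_lin _ _ _ _ _ _ _ _ _ Fe)) -[RHS]scalerAr.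
by rewrite (l_ext_gl _ (lhomog_mcoef A u vl)) scalerA -cpowD // subrr cpow0 scale1r.
Qed.

Lemma gl_bp (w : domw L) : gl (bp w) = ext_u Fe (val w) * ext_b Fe (val w).
Proof. by rewrite /ext_x pX_bp fXM. Qed.

Lemma binv_bp (w : domw L) : binv Fe (val w) * gl (bp w) = 1.
Proof.
rewrite gl_bp /binv /ext_b /ext_u -!fXM mulrA -[X in X * _]mulrA pUD addNr pU0 mulr1 pBD.
by rewrite addNr pB0 fX1.
Qed.

Lemma bp_binv (w : domw L) : gl (bp w) * binv Fe (val w) = 1.
Proof.
rewrite gl_bp /binv /ext_b /ext_u -!fXM mulrA -[X in X * _]mulrA pBD subrr pB0 mulr1 pUD.
by rewrite subrr pU0 fX1.
Qed.

Lemma wt_star_E w (W : irrep U w) r (v : W) l : has_wt v l ->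
  has_wt (ir_act (star (uE r)) v) (l - a_ r).
Proof.
by move=> vl; rewrite uE_star actM vl (linZ (act_linr _)); exact/has_wtZ/has_wt_F.
Qed.

(** Only the b at the r-th fundamental weight occurs in e_r, so its q-commutation with x and with x
    <| E_r is all that enters. *)
Lemma gl_e r x : gl x * e_ext Fe r =
  e_ext Fe r * gl (ract x (uK (a_ r))) + gl (ract x (uE r)).
Proof.
have lin := @ext_x_lin _ _ _ _ _ _ _ _ _ Fe.
move: x; apply: (polK_lin_eq q_gt0) => [||w' v u l m vl um].
- exact: mul_linr.
- by apply: lin_addf; [apply: mul_linl|]; apply: lin_comp => //; exact: ract_linl.
set w := fundw r; set x := mcoef A v u; set y := bp w.
have yE : mcoef A (ir_act (star (uE r)) (ir_hw (V w))) (Defs.eta T w0 w) = ract y (uE r).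
  by rewrite ract_mcoef.
have wa_r : wip (val w) (a_ r) = hlen r by rewrite wip_sroot fundw_coord eqxx mul1r.
(* [c] is the scalar in b x = c x b, and [p2] is q_r^2. *)
pose c := qp (wip (val w) (l - wa w0 m)).
pose p2 := qp (wip (val w) (a_ r) + wip (val w) (a_ r)).
have p2E : p2 * qp (- wip (val w) (a_ r)) = qp (wip (val w) (a_ r)).
  by rewrite /p2 -cpowD // addrK.
have yx : y * x = c *: (x * y) by exact: (bp_qcomm q_gt0 q_lt1 rho w vl um).
(* x <| E_r has left weight l - alpha_r, whence the extra factor. *)
have yxE : y * ract x (uE r) = (c * qp (- wip (val w) (a_ r))) *: (ract x (uE r) * y).
  rewrite /x ract_mcoef (bp_qcomm q_gt0 q_lt1 rho w (wt_star_E r vl) um); congr (_ *: _).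
  by rewrite -cpowD //; congr (qp _); rewrite !wipBr; ring.
(* E_r acts on b x = c x b by the twisted Leibniz rule; by [yxE] both terms containing x <| E_r are
   multiples of b (x <| E_r), with total coefficient 1 - q_r^2. *)
have e1 : qp (wip (a_ r) l) *: (ract y (uE r) * x) + (1 - p2) *: (y * ract x (uE r)) =
    c *: (x * ract y (uE r)).
  have := congr1 (fun z => ract z (uE r)) yx.
  rewrite /= (linZ (ract_linl _)) !ract_mulE (ractK_mcoef A _ _ vl).
  rewrite (ractK_mcoef A _ _ (has_wt_hw (V w))) -!scalerAr -/x -/y => e2.
  rewrite scalerBl scale1r addrA e2 scalerDr addrAC scalerA yxE scalerA.
  rewrite [wip (a_ r) (val w)]wipC -scalerBl -[RHS]add0r; congr (_ + _).
  rewrite -[RHS](scale0r (ract x (uE r) * y)); congr (_ *: _); apply/eqP; rewrite subr_eq0.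
  by rewrite [X in _ == X]mulrCA p2E.
have cb : gl x * binv Fe (val w) = c *: (binv Fe (val w) * gl x).
  rewrite -[LHS]mul1r -(binv_bp w) -mulrA [gl (bp w) * _]mulrA -glM yx (linZ lin) glM.
  by rewrite -scalerAl -[gl x * _ * _]mulrA bp_binv mulr1 -scalerAr.
(* The normalisation in [e_ext] cancels exactly that coefficient. *)
have c0 : ((1 - qr L q r ^+ 2)^-1)%:C%C * (1 - p2) = 1.
  rewrite /p2 wa_r; have -> : 1 - qp (hlen r + hlen r) = (1 - qr L q r ^+ 2)%:C%C :> C.
    by rewrite cpowD // rmorphB rmorphXn expr2.
  rewrite -rmorphM mulVf // subr_eq0 eq_sym pexpr_eq1 //; first exact: qr_neq1.
  by rewrite ltW // qr_gt0.
rewrite /e_ext -/w yE -scalerAr mulrA cb -scalerAl -mulrA -glM scalerAr.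
rewrite -(linZ lin) -e1 (linD lin) (linZ lin) [gl (_ *: (y * _))](linZ lin) !glM.
rewrite mulrDr scalerDr -[in X in _ + X]scalerAr scalerA c0 scale1r mulrA binv_bp mul1r.
congr (_ + _); rewrite (ractK_mcoef A _ _ vl) (linZ lin).
by rewrite -!scalerAr -scalerAl mulrA scalerA mulrC -scalerA.
Qed.

Lemma star_e_gl r x : star (e_ext Fe r) * gl x =
  gl (ract x (uK (- a_ r))) * star (e_ext Fe r) -
  qp (wip (a_ r) (a_ r)) *: gl (ract x (uF r)).
Proof.
have lin := @ext_x_lin _ _ _ _ _ _ _ _ _ Fe.
have := congr1 (@star _ _) (gl_e r (star x)).
rewrite starM -gl_star starK starD starM -!gl_star !ract_star star_antipodeK star_antipodeE //.
by rewrite (linN (ract_linr _)) (linZ (ract_linr _)) (linN lin) (linZ lin).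
Qed.

(** [star_e_gl] with l_(-alpha_r) inserted: the scalars from moving it past x and past x <| F_r
    cancel those of [star_e_gl], because x <| F_r has left weight l + alpha_r. *)
Lemma gl_f r x : gl x * f_ext Fe r =
  f_ext Fe r * gl x + l_ext Fe (- a_ r) * gl (ract x (uF r)).
Proof.
have lin := @ext_x_lin _ _ _ _ _ _ _ _ _ Fe.
move: x; apply: (polK_lin_eq q_gt0) => [||w' v u l m vl um].
- exact: mul_linr.
- apply: lin_addf; first exact: mul_linl.
  by apply: mul_linl; apply: lin_comp => //; exact: ract_linl.
have xl := lhomog_mcoef A u vl; set x := mcoef A v u in xl *.
have xFl : lhomog (l + a_ r) (ract x (uF r)).
  by rewrite (ractF_mcoef q_gt0 A u r vl); apply/lspanZ/lhomog_mcoef/has_wt_E.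
have lx := l_ext_gl (- a_ r) xl; have lxF := l_ext_gl (- a_ r) xFl.
have := star_e_gl r x; rewrite (ractK_mcoef A _ _ vl) (linZ lin) /= -/x /f_ext.
move: (l_ext Fe (- a_ r)) (star (e_ext Fe r)) lx lxF => lam es lx lxF ex.
rewrite -[_ * _ * gl x]mulrA lx lxF -scalerAr [es * (gl x * _)]mulrA ex mulrBl scalerBr.
rewrite -!scalerAl !scalerA -!cpowD // !wipNl !opprK wipDr subrr cpow0 scale1r subrK.
by rewrite mulrA.
Qed.

(** The degree in P of an operator on the Fock space, read off its matrix entries so that products
    and adjoints are immediate. *)
Definition shifts (m : P) (y : Fe) := forall a b,
  (rho y << a >>)@_b != 0 -> b.1 = a.1 + m.

Lemma shiftsZ m c y : shifts m y -> shifts m (c *: y).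
Proof.
move=> ym a b; rewrite (linZ (er_linl rho _)) mcoeffZ mulf_eq0 negb_or => /andP [_].
exact: ym.
Qed.

Lemma shiftsM m n y z : shifts m y -> shifts n z -> shifts (m + n) (y * z).
Proof.
move=> ym zn a b; rewrite erM [rho z _]malg_basis (lin_sum _ _ _ (er_linr rho y)) raddf_sum /=.
move=> H; have [c zc yc] : exists2 c, (rho z << a >>)@_c != 0 & (rho y << c >>)@_b != 0.
  apply: contrapT => N; case/eqP: H; apply: big1 => c _.
  rewrite (linZ (er_linr rho y)) mcoeffZ.
  have [->|zc] := eqVneq ((rho z << a >>)@_c) 0; first by rewrite mul0r.
  have [->|yc] := eqVneq ((rho y << c >>)@_b) 0; first by rewrite mulr0.
  by case: N; exists c; [exact: zc|exact: yc].
by rewrite (ym _ _ yc) (zn _ _ zc) -addrA [n + m]addrC.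
Qed.

Lemma fip_basisl (K : choiceType) (k : K) (v : {malg C[K]}) : fip << k >> v = v@_k.
Proof. by rewrite /fip msuppU oner_eq0 big_seq_fset1 mcoeffUU conjC1 mul1r. Qed.

Lemma fip_basisr (K : choiceType) (k : K) (v : {malg C[K]}) : fip v << k >> = (v@_k)^*.
Proof.
rewrite /fip; have [kv|kv] := boolP (k \in msupp v).
  rewrite (big_fsetD1 k kv) /= big1_fset ?addr0 ?mcoeffUU ?mulr1 // => k'.
  by rewrite !inE => /andP [k'k _] _; rewrite mcoeffU eq_sym (negPf k'k) mulr0.
rewrite (mcoeff_outdom kv) conjC0 big1_fset // => k' k'v _.
by rewrite mcoeffU; case: eqP kv => [->|]; rewrite ?k'v // mulr0.
Qed.

Lemma shifts_star m y : shifts m y -> shifts (- m) (star y).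
Proof.
move=> ym a b; rewrite -fip_basisl -(er_star rho) fip_basisr conjC_eq0.
by move/ym => ->; rewrite addrK.
Qed.

Lemma shifts_u w : shifts w (ext_u Fe w).
Proof.
move=> [chi t] b; rewrite -vatU (er_u rho) vatU mcoeffZ mcoeffU.
by case: (_ =P b) => [<- //|_]; rewrite mulr0 eqxx.
Qed.

Lemma shifts_b w : shifts 0 (ext_b Fe w).
Proof.
move=> [chi t] b; rewrite (er_b rho) mcoeffZ mcoeffU.
by case: (_ =P b) => [<- /=|_]; rewrite ?addr0 // mulr0 eqxx.
Qed.

Lemma shifts_f f : shifts 0 (ext_f Fe f).
Proof.
move=> [chi t] b; rewrite -vatU (er_f rho) vatU mcoeffZ mcoeffU.
by case: (_ =P b) => [<- /=|_]; rewrite ?addr0 // mulr0 eqxx.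
Qed.

Lemma shifts_x l x : lhomog l x -> shifts l (gl x).
Proof.
move=> xl [chi t] b; rewrite -vatU (er_x rho _ _ xl) /vat raddf_sum /= => H.
have [t' ] : exists t', (<< (chi + l, t') >> : Lh0 w0)@_b != 0.
  apply: contrapT => N; case/eqP: H; apply: big1 => t' _; rewrite mcoeffZ.
  have [->|tb] := eqVneq ((<< (chi + l, t') >> : Lh0 w0)@_b) 0; first by rewrite mulr0.
  by case: N; exists t'; exact: tb.
by rewrite mcoeffU; case: (_ =P b) => [<-|]; rewrite ?eqxx.
Qed.

Lemma shifts_k w : shifts (- w) (k_ext Fe w).
Proof.
apply: shiftsZ; rewrite -[X in shifts X _]add0r.
by apply: shiftsM; [exact: shifts_f|exact: shifts_u].
Qed.

Lemma shifts_l w : shifts w (l_ext Fe w).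
Proof.
apply: shiftsZ; rewrite -[X in shifts X _]addr0.
by apply: shiftsM; [exact: shifts_u|exact: shifts_f].
Qed.

Lemma shifts_e r : shifts (- a_ r) (e_ext Fe r).
Proof.
apply: shiftsZ; have -> : - a_ r = (0 + - val (fundw r)) + (val (fundw r) - a_ r).
  by rewrite add0r addKr.
apply: shiftsM; first by apply: shiftsM; [exact: shifts_b|exact: shifts_u].
by apply: shifts_x; apply: lhomog_mcoef; apply: wt_star_E; exact: has_wt_hw.
Qed.

Lemma shifts_fe r : shifts 0 (f_ext Fe r).
Proof.
rewrite -[X in shifts X _](subrr (a_ r)); apply: shiftsM; last exact: shifts_l.
by rewrite -[X in shifts X _]opprK; apply: shifts_star; exact: shifts_e.
Qed.

End ExtRelations.

(** * The algebras F_q(AK) and the action pi_rhd *)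

Section Amplification.
Variables (R : realType) (q : R) (L : rootDatum R).
Local Notation C := R[i].
Local Notation P := 'rV[int]_(rk L).

Lemma finsupp_wshift (m : P) (f : P -> C) : finsupp_fun f -> finsupp_fun (wshift m f).
Proof.
move=> ff; rewrite /finsupp_fun; have -> : [set x | wshift m f x != 0] = +%R m @` [set x | f x != 0].
  apply/seteqP; split=> x /=; rewrite /wshift.
    by move=> fx; exists (x - m) => //; rewrite addrC subrK.
  by move=> [y fy <-]; rewrite [m + y]addrC addrK.
exact: finite_image.
Qed.

Lemma wshift0 (f : P -> C) : wshift 0 f = f.
Proof. by apply/funext => x; rewrite /wshift subr0. Qed.

Lemma wshift_add (m n : P) (f : P -> C) : wshift m (wshift n f) = wshift (m + n) f.
Proof. by apply/funext => x; rewrite /wshift -addrA -opprD. Qed.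

Variables (U : uqK q L) (V : forall w : domw L, irrep U (val w)) (A : polK V).

Section Generic.
Variables (homog : P -> A -> Prop) (F : amplif homog).

Lemma amp_rel : rel_amp homog (am_gen F). Proof. by have [] := am_presents F. Qed.

Lemma aX_hom : star_hom (fun x => am_gen F (aX _ x)). Proof. by have [] := amp_rel. Qed.

Lemma aX_lin : linear (fun x => am_gen F (aX _ x)).
Proof. by have [/alg_hom_lin] := aX_hom. Qed.

Lemma aXM x y : am_gen F (aX _ (x * y)) = am_gen F (aX _ x) * am_gen F (aX _ y).
Proof. by have [/alg_homM ->] := aX_hom. Qed.

Lemma aX_star x : am_gen F (aX _ (star x)) = star (am_gen F (aX _ x)).
Proof. by have [_] := aX_hom. Qed.

Lemma aF_aX m x f : homog m x ->
  am_gen F (aF _ f) * am_gen F (aX _ x) = am_gen F (aX _ x) * am_gen F (aF _ (wshift m f)).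
Proof. by have [_ _] := amp_rel; apply. Qed.

Lemma aFM f h : am_gen F (aF _ (fun x => f x * h x)) = am_gen F (aF _ f) * am_gen F (aF _ h).
Proof. by have [_ []] := amp_rel. Qed.

Lemma aF_star f : am_gen F (aF _ (fun x => (f x)^*)) = star (am_gen F (aF _ f)).
Proof. by have [_ []] := amp_rel. Qed.

Lemma aF_lin c f h :
  am_gen F (aF _ (fun x => c * f x + h x)) = c *: am_gen F (aF _ f) + am_gen F (aF _ h).
Proof. by have [_ []] := amp_rel. Qed.

Lemma aF0 : am_gen F (aF _ (fun=> 0)) = 0.
Proof.
have := aF_lin (-1) (fun=> 0) (fun=> 0); rewrite scaleN1r addNr => <-.
by congr (am_gen _ (aF _ _)); apply/funext => x; rewrite mulr0 addr0.
Qed.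

Lemma xf_linl f : linear (fun x => xf F x f).
Proof. by move=> c x y; rewrite /xf aX_lin mulrDl -scalerAl. Qed.

Lemma xf_linr x c f h : xf F x (fun m => c * f m + h m) = c *: xf F x f + xf F x h.
Proof. by rewrite /xf aF_lin mulrDr -scalerAr. Qed.

Lemma xf0 x : xf F x (fun=> 0) = 0. Proof. by rewrite /xf aF0 mulr0. Qed.

Lemma ampc_xf x f : finsupp_fun f -> ampc (xf F x f).
Proof. by move=> ff; apply: lspan_in; exists x, f. Qed.

Lemma finsupp_delta (chi : P) : finsupp_fun (delta_fun chi : P -> C).
Proof.
apply: (@sub_finite_set _ _ [set chi]) => // x /=.
by rewrite /delta_fun; case: (x =P chi) => //= _; rewrite eqxx.
Qed.

Lemma xf_delta x f : finsupp_fun f ->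
  exists s : seq P, xf F x f = \sum_(chi <- s) f chi *: xf F x (delta_fun chi).
Proof.
move=> /finite_seqP [s sE]; exists (undup s).
have fs m : f m != 0 -> m \in undup s.
  by move=> fm; rewrite mem_undup; have : [set x | f x != 0] m by []; rewrite sE.
elim: (undup s) f (undup_uniq s) fs {sE} => [|chi t IHt] g /= tu gt.
  rewrite big_nil (_ : g = fun=> 0) ?xf0 //; apply/funext => m.
  by apply/eqP/negPn/negP => /gt.
case/andP: tu => chit tu.
pose h m := if m == chi then 0 else g m.
have gE : g = fun m => g chi * delta_fun chi m + h m.
  apply/funext => m; rewrite /delta_fun /h; case: (m =P chi) => [->|_].
    by rewrite mulr1 addr0.
  by rewrite mulr0 add0r.
rewrite [in LHS]gE xf_linr big_cons (IHt h tu) => [|m]; last first.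
  by rewrite /h; case: (m =P chi) => [_|/eqP mc]; rewrite ?eqxx // => /gt; rewrite inE (negPf mc).
congr (_ + _); apply: eq_big_seq => m mt; rewrite /h.
by case: (m =P chi) chit => [<-|//]; rewrite mt.
Qed.

Lemma ampc_ind (Q : F -> Prop) : (forall x f, finsupp_fun f -> Q (xf F x f)) -> Q 0 ->
  (forall c x y, ampc x -> ampc y -> Q x -> Q y -> Q (c *: x + y)) -> forall y, ampc y -> Q y.
Proof.
move=> Qx Q0 Ql y [n [c [u [Su ->]]]]; elim: n c u Su => [|n IHn] c u Su.
  by rewrite big_ord0.
rewrite big_ord_recl; apply: Ql.
- exact/lspan_in/Su.
- by apply: lspan_sum => i _; exact/lspanZ/lspan_in/Su.
- by have [x [f [ff ->]]] := Su ord0; exact: Qx.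
- exact: IHn.
Qed.

End Generic.

Variables (Fp : funPlus A) (Up : uqPlus q L) (prhd : pirhd Fp Up).
Local Notation uK w := (uk_gen U (gK w)).
Local Notation uE r := (uk_gen U (gE r)).
Local Notation uF r := (uk_gen U (gF r)).
Local Notation a_ := (sroot L).
Local Notation pik := (pr_pik prhd).
Local Notation pia := (pr_pia prhd).

Lemma lactM X Y (x : A) : lact (X * Y) x = lact X (lact Y x).
Proof. by apply: pk_inj => Z; rewrite !pk_lact mulrA. Qed.

(** The contribution of one elementary tensor of the coproduct. Bilinearity in X and Y makes the sum
    independent of the family chosen to represent the coproduct. *)
Definition prterm x f X Y : Fp := mext (fun m => xf Fp (lact (pik X) x) (wshift (- m) f)) (pia Y).

Lemma pik_lin : linear pik. Proof. by have [/alg_hom_lin] := pr_pikP prhd. Qed.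
Lemma pia_lin : linear pia. Proof. by have [] := pr_piaP prhd. Qed.

Lemma prterm_bilin x f : bilin (prterm x f).
Proof.
split=> [Y|X] c a b; rewrite /prterm; last by rewrite pia_lin mext_lin.
move: c a b; change (linear (fun X => mext
  (fun m => xf Fp (lact (pik X) x) (wshift (- m) f)) (pia Y))).
rewrite /mext; apply: lin_sumf => m; apply: lin_scalef.
by move=> c a b; rewrite pik_lin lact_linl xf_linl.
Qed.

Lemma prhd_xf X x f : finsupp_fun f ->
  prhd X (xf Fp x f) = \sum_(p <- cop X) prterm x f p.1 p.2.
Proof.
move=> ff; rewrite (pr_xf prhd X x ff); apply: eq_bigr => p _; apply: eq_bigr => m _.
congr (_ *: _); rewrite /lact (lin_sum _ _ _ (xf_linl Fp _)); apply: eq_bigr => s _.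
by rewrite (linZ (xf_linl Fp _)).
Qed.

Lemma ampc_prterm X Y x f : finsupp_fun f -> ampc (prterm x f X Y).
Proof.
move=> ff; apply: lspan_sum => m _; apply: lspanZ; apply: ampc_xf; exact: finsupp_wshift.
Qed.

Lemma prhd_lin X : linear_on (@ampc _ _ _ _ _ _ _ Fp) (prhd X). Proof. exact: pr_lin. Qed.

Lemma ampc_prhd X y : ampc y -> ampc (prhd X y).
Proof.
have [p0 pZ _] := linear_on_lspan (prhd_lin X).
move=> [n [c [u [Su ->]]]]; elim: n c u Su => [|n IHn] c u Su.
  by rewrite big_ord0 p0; exact: lspan0.
rewrite big_ord_recl prhd_lin; last 2 first.
- exact/lspan_in/Su.
- by apply: lspan_sum => i _; exact/lspanZ/lspan_in/Su.
apply: lspan_lin; last exact: IHn.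
have [x [f [ff ->]]] := Su ord0.
by rewrite prhd_xf //; apply: lspan_sum => p _; exact: ampc_prterm.
Qed.

Lemma prhd0 X : prhd X 0 = 0. Proof. by have [] := linear_on_lspan (prhd_lin X). Qed.

Lemma prhd_linX y c X Y : ampc y -> prhd (c *: X + Y) y = c *: prhd X y + prhd Y y.
Proof.
move: y; apply: ampc_ind => [x f ff||a x y xa ya Hx Hy].
- rewrite !prhd_xf //.
  exact: (tens_lin (@cop_hom _ Up) (prterm_bilin x f)).
- by rewrite !prhd0 scaler0 addr0.
- rewrite !prhd_lin // Hx Hy !scalerDr !scalerA addrACA; congr (_ + _ + _).
  by rewrite mulrC.
Qed.

Lemma prhd1 y : ampc y -> prhd 1 y = y.
Proof.
move: y; apply: ampc_ind => [x f ff||a x y xa ya Hx Hy].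
- rewrite prhd_xf // (tens_one (@cop_hom _ Up) (prterm_bilin x f)) /prterm.
  have [/alg_hom1 -> _ _] := pr_pikP prhd; have [_ [-> _] _ _] := pr_piaP prhd.
  by rewrite mextU oppr0 wshift0 lact1.
- exact: prhd0.
- by rewrite prhd_lin // Hx Hy.
Qed.

Lemma mext_conv (W : lmodType C) (H : P -> W) g h :
  mext H (Defs.conv g h) = mext (fun v => mext (fun w => H (v + w)) h) g.
Proof.
rewrite /Defs.conv (lin_sum _ _ _ (mext_lin H)); apply: eq_bigr => v _.
rewrite (lin_sum _ _ _ (mext_lin H)) [in RHS]/mext scaler_sumr; apply: eq_bigr => w _.
by rewrite (linZ (mext_lin H)) mextU scalerA.
Qed.

(** Left translations compose, and translations of f add up as in the convolution of the group
    algebra, so each leg of the coproduct acts multiplicatively. *)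
Lemma prhdM X Y y : ampc y -> prhd (X * Y) y = prhd X (prhd Y y).
Proof.
move: y; apply: ampc_ind => [x f ff||a x y xa ya Hx Hy].
- rewrite !prhd_xf // (tens_mul (@cop_hom _ Up) _ _ (prterm_bilin x f)).
  have [_ pZ pS] := linear_on_lspan (prhd_lin X).
  rewrite pS; last by move=> p _; exact: ampc_prterm.
  rewrite exchange_big /=; apply: eq_bigr => r _.
  rewrite [in RHS]/prterm /mext pS; last first.
    by move=> m _; apply: lspanZ; apply: ampc_xf; exact: finsupp_wshift.
  rewrite [RHS](eq_bigr (fun m => \sum_(p <- cop X) (pia r.2)@_m *:
    prterm (lact (pik r.1) x) (wshift (- m) f) p.1 p.2)); last first.
    move=> m _; have mf := finsupp_wshift (- m) ff.
    by rewrite pZ; [rewrite prhd_xf // scaler_sumr|exact: ampc_xf].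
  rewrite [RHS]exchange_big /=; apply: eq_bigr => p _.
  have [/alg_homM piM _ _] := pr_pikP prhd; have [_ [_ pcM] _ _] := pr_piaP prhd.
  rewrite /prterm piM pcM mext_conv /mext.
  transitivity (\sum_(m <- msupp (pia p.2)) \sum_(n <- msupp (pia r.2)) (pia p.2)@_m *:
      ((pia r.2)@_n *: xf Fp (lact (pik p.1 * pik r.1) x) (wshift (- (m + n)) f))).
    by apply: eq_bigr => m _; rewrite scaler_sumr.
  rewrite exchange_big /=; apply: eq_bigr => n _; rewrite scaler_sumr.
  apply: eq_bigr => m _.
  by rewrite !scalerA lactM wshift_add opprD [_@_m * _]mulrC.
- by rewrite !prhd0.
- by rewrite !prhd_lin ?Hx ?Hy //; exact: ampc_prhd.
Qed.

Lemma prhd_K w x f : finsupp_fun f ->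
  prhd (up_gen Up (bK w)) (xf Fp x f) = xf Fp (lact (uK w) x) (wshift (- w) f).
Proof.
move=> ff; have [cK _ _ _] := up_cop Up; rewrite prhd_xf //.
rewrite (tens_eq_bilin (prterm_bilin x f) (cK w)) big_seq1 /prterm /=.
have [_ _ /(_ w) [-> _]] := pr_pikP prhd; have [_ _ _ /(_ w) [-> _]] := pr_piaP prhd.
by rewrite mextU.
Qed.

Lemma prhd_L w x f : finsupp_fun f ->
  prhd (up_gen Up (bL w)) (xf Fp x f) = xf Fp (lact (uK w) x) (wshift w f).
Proof.
move=> ff; have [_ cL _ _] := up_cop Up; rewrite prhd_xf //.
rewrite (tens_eq_bilin (prterm_bilin x f) (cL w)) big_seq1 /prterm /=.
have [_ _ /(_ w) [_ ->]] := pr_pikP prhd; have [_ _ _ /(_ w) [_ ->]] := pr_piaP prhd.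
by rewrite mextU opprK.
Qed.

Lemma prhd_E r x f : finsupp_fun f ->
  prhd (up_gen Up (bE r)) (xf Fp x f) = xf Fp (lact (uE r) x) (wshift (- a_ r) f).
Proof.
move=> ff; have [_ _ cE _] := up_cop Up; rewrite prhd_xf //.
rewrite (tens_eq_bilin (prterm_bilin x f) (cE r)) big_cons big_seq1 /prterm /=.
have [_ /(_ r) [-> _] _] := pr_pikP prhd.
have [_ _ /(_ r) [-> _] /(_ (a_ r)) [-> _]] := pr_piaP prhd.
by rewrite mextU (lin0 (mext_lin _)) addr0.
Qed.

Lemma prhd_F r x f : finsupp_fun f ->
  prhd (up_gen Up (bF r)) (xf Fp x f) = xf Fp (lact (uF r) x) f.
Proof.
move=> ff; have [_ _ _ cF] := up_cop Up; rewrite prhd_xf //.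
rewrite (tens_eq_bilin (prterm_bilin x f) (cF r)) big_cons big_seq1 /prterm /=.
have [_ /(_ r) [_ ->] _] := pr_pikP prhd.
have [_ [-> _] /(_ r) [_ ->] _] := pr_piaP prhd.
by rewrite mextU (lin0 (mext_lin _)) addr0 oppr0 wshift0.
Qed.

End Amplification.

(** * Hilbert spaces *)

Section HilbertBasics.
Variable R : realType.
Local Notation C := R[i].
Implicit Types H K : hilbert R.

Lemma lip_continuous (V W : normedModType C) (f : V -> W) (M : C) :
  (forall x y, `|f x - f y| <= M * `|x - y|) -> continuous f.
Proof.
move=> fM x; have M0 : 0 <= `|M| + 1 by rewrite addr_ge0.
have fM' z y : `|f z - f y| <= (`|M| + 1) * `|z - y|.
  apply: le_trans (fM z y) _.
  have [->|zy] := eqVneq z y; first by rewrite subrr normr0 !mulr0.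
  have MR : M \is Num.real.
    have := le_trans (normr_ge0 _) (fM z y); rewrite pmulr_lge0 ?normr_gt0 ?subr_eq0 //.
    exact: ger0_real.
  by rewrite ler_wpM2r // (le_trans (real_ler_norm MR)) // lerDl.
apply/cvgrPdist_lt => e e0.
have M1 : 0 < `|M| + 1 by rewrite ltr_wpDl.
near=> y; apply: le_lt_trans (fM' _ _) _; rewrite -ltr_pdivlMl //.
near: y; apply: (@cvgr_dist_lt _ _ _ (nbhs x) _ id x); first exact: cvg_id.
by rewrite mulr_gt0 // invr_gt0.
Unshelve. all: by end_near.
Qed.

Lemma closure_map (V W : topologicalType) (f : V -> W) (S : set V) (S' : set W) x :
  continuous f -> closure S x -> (forall a, S a -> closure S' (f a)) -> closure S' (f x).
Proof.
move=> fc Sx SS'; have : closed (f @^-1` closure S').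
  by apply: preimage_closed => [? _|]; [exact: fc|exact: closed_closure].
move/closure_id => fE; have : closure (f @^-1` closure S') x by apply: closureS Sx.
by rewrite -fE.
Qed.

Lemma closure_idem (V : topologicalType) (S : set V) : closure (closure S) = closure S.
Proof. by have /closure_id <- := @closed_closure V S. Qed.

Lemma closure_lin (V : normedModType C) (S : set V) :
  (forall c x y, S x -> S y -> S (c *: x + y)) ->
  forall c x y, closure S x -> closure S y -> closure S (c *: x + y).
Proof.
move=> SL c x y Sx Sy.
have cA z : continuous (fun y : V => c *: z + y).
  apply: (@lip_continuous _ _ _ 1) => u v; rewrite mul1r.
  by rewrite opprD addrACA subrr add0r.
have cB z : continuous (fun x : V => c *: x + z).
  apply: (@lip_continuous _ _ _ `|c|) => u v.
  by rewrite opprD addrACA subrr addr0 -scalerBr normrZ.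
apply: (closure_map (cB y) Sx) => a Sa.
apply: (closure_map (cA a) Sy) => b Sb; apply: subset_closure; exact: SL.
Qed.

Lemma hipI H : is_inner (@hip R H). Proof. exact: hip_inner. Qed.

Lemma hip_cs H (x y : H) : `|hip x y| <= `|x| * `|y|.
Proof.
rewrite -(@ler_pXn2r _ 2) ?nnegrE ?mulr_ge0 //.
by rewrite exprMn -!hip_norm; exact: cauchy_schwarz (hipI H) _ _.
Qed.

Lemma hip_continuous H (x : H) : continuous (hip x : H -> C^o).
Proof.
apply: (@lip_continuous _ C^o _ `|x|) => y z.
rewrite -[X in `|X|](linB (V := C^o) (inner_linr (hipI H) x)).
exact: hip_cs.
Qed.

Definition total H (S : set H) := forall x, (forall y, S y -> hip y x = 0) -> x = 0.

Lemma dense_total H (S : set H) : closure S = setT -> total S.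
Proof.
move=> Sd x Sx; apply: (inner_eq0 (hipI H)).
have Sx' y : S y -> hip x y = 0.
  by move=> /Sx yx; rewrite (innerC (hipI H)) yx conjC0.
have : closure [set (0 : C^o)] (hip x x).
  apply: (closure_map (S := S) (@hip_continuous _ x)); first by rewrite Sd.
  by move=> y Sy; rewrite Sx' //; exact: subset_closure.
have /closure_id <- // : closed [set (0 : C^o)].
apply: accessible_closed_set1; apply: hausdorff_accessible; exact: norm_hausdorff.
Qed.

Lemma total_eq H (S : set H) x y : total S -> (forall z, S z -> hip z x = hip z y) -> x = y.
Proof.
move=> St xy; apply/eqP; rewrite -subr_eq0; apply/eqP; apply: St => z /xy e.
by rewrite (linB (V := C^o) (inner_linr (hipI H) z)) e subrr.
Qed.

Lemma tn_norm H K (T : htensor H K) x y : `|tn T x y| = `|x| * `|y|.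
Proof.
apply/eqP; rewrite -(@eqrXn2 _ 2) ?mulr_ge0 //.
by rewrite exprMn -!hip_norm tn_ip.
Qed.

Lemma tn_continuousr H K (T : htensor H K) x : continuous (tn T x).
Proof.
apply: (@lip_continuous _ _ _ `|x|) => y z.
by rewrite -(linB (tn_linr T x)) tn_norm.
Qed.

Lemma tn_continuousl H K (T : htensor H K) y : continuous (tn T ^~ y).
Proof.
apply: (@lip_continuous _ _ _ `|y|) => x z.
by rewrite -(linB (tn_linl T y)) tn_norm mulrC.
Qed.

Lemma tensor_total H K (T : htensor H K) (S : set H) (S' : set K) :
  closure S = setT -> closure S' = setT ->
  total [set z : T | exists x y, [/\ S x, S' y & z = tn T x y]].
Proof.
move=> Sd S'd z zS; apply: (dense_total (tn_dense T)) => _ [n [c [u [Su ->]]]].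
have zero x y : hip z (tn T x y) = 0.
  have : closure [set (0 : C^o)] (hip z (tn T x y)).
    have cx y' : continuous (fun x => hip z (tn T x y') : C^o).
      move=> x'; apply: (@continuous_comp _ _ _ (fun x => tn T x y') (hip z : T -> C^o)).
        exact: tn_continuousl.
      exact: hip_continuous.
    have cy x' : continuous (fun y => hip z (tn T x' y) : C^o).
      move=> y'; apply: (@continuous_comp _ _ _ (tn T x') (hip z : T -> C^o)).
        exact: tn_continuousr.
      exact: hip_continuous.
    apply: (closure_map (S := S) (cx y)); first by rewrite Sd.
    move=> a Sa; apply: (closure_map (S := S') (cy a)); first by rewrite S'd.
    move=> b Sb; apply: subset_closure => /=.
    by rewrite (innerC (hipI T)) zS ?conjC0 //; exists a, b.
  have /closure_id <- // : closed [set (0 : C^o)].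
  apply: accessible_closed_set1; apply: hausdorff_accessible; exact: norm_hausdorff.
rewrite (innerC (hipI T)) (inner_sumr (hipI T)) big1 ?conjC0 // => i _.
by have [x [y ->]] := Su i; rewrite (innerZr (hipI T)) zero mulr0.
Qed.

Lemma isometry_continuous H K (f : H -> K) :
  linear f -> (forall x y, hip (f x) (f y) = hip x y) -> continuous f.
Proof.
move=> fl fi; apply: (@lip_continuous _ _ _ 1) => x y.
rewrite mul1r -(linB fl) -(@ler_pXn2r _ 2) ?nnegrE //.
by rewrite -!hip_norm fi.
Qed.

(** The equation <d', x> = <d, y> is a closed condition on (x, y). It therefore persists on the
    closure, where it determines y because [D] is total. *)
Lemma closable_adjoint H (D : set H) (G2 : set (H * H)%type) : total D ->
  (forall d, D d -> exists d', forall z, G2 z -> hip d' z.1 = hip d z.2) ->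
  is_operator (closure G2).
Proof.
move=> Dt Dadj x y y' Gy Gy'; apply: (total_eq Dt) => d /Dadj [d' dd'].
suff key z : closure G2 z -> hip d' z.1 = hip d z.2.
  by rewrite -(key _ Gy) -(key _ Gy').
move=> Gz; pose g (z : H * H) : C^o := hip d' z.1 - hip d z.2.
have gc : continuous g.
  move=> u; apply: (@continuousB _ C^o (H * H)%type (fun z => hip d' z.1) (fun z => hip d z.2)).
    apply: (@continuous_comp _ _ _ fst (hip d' : H -> C^o)); first exact: cvg_fst.
    exact: hip_continuous.
  apply: (@continuous_comp _ _ _ snd (hip d : H -> C^o)); first exact: cvg_snd.
  exact: hip_continuous.
have : closure [set (0 : C^o)] (g z).
  apply: (closure_map gc Gz) => a Ga; apply: subset_closure.
  by rewrite /g dd' // subrr.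
have /closure_id <- : closed [set (0 : C^o)].
  by apply: accessible_closed_set1; apply: hausdorff_accessible; exact: norm_hausdorff.
by move/eqP; rewrite subr_eq0 => /eqP.
Qed.

End HilbertBasics.

(** * The coaction unitary *)

Section Core.
Variables (R : realType) (q : R) (q_gt0 : 0 < q) (q_lt1 : q < 1).
Variables (L : rootDatum R) (w0 : longestWord L) (U : uqK q L).
Variables (V : forall w : domw L, irrep U (val w)) (A : polK V) (psi : haar A).
Variables (T : lusztigT V) (S : forall r, su2Restriction A r).
Variables (Pe : polExt A T w0) (Fe : funExt Pe) (rho : extRep S Fe).
Variables (Fp : funPlus A) (psip : ampState psi Fp) (Hp : L2plus psip).
Variables (F0 : funZero A) (psi0 : ampState psi F0) (H0 : L2zero psi0).
Variables (Hh : L2h w0) (rho0 : zeroRep w0 S F0).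
Variables (T00 : htensor H0 H0) (Tp0 : htensor Hp H0).
Variables (T0h : htensor H0 Hh) (Tph : htensor Hp Hh).
Variables (W : gammaUnitary T00 Tp0) (Phi : identLinf H0 Hh rho0).
Variable (Vh : coactUnitary T0h Tph W Phi).
Local Notation C := R[i].
Local Notation P := 'rV[int]_(rk L).
Local Notation I := 'I_(rk L).
Local Notation a_ := (sroot L).
Local Notation uK w := (uk_gen U (gK w)).
Local Notation gl := (ext_x Fe).
Local Notation xp x f := (xf Fp x f).
Local Notation x0 x f := (xf F0 x f).

Lemma embp_lin c (x y : Fp) : ampc x -> ampc y ->
  emb Hp (c *: x + y) = c *: emb Hp x + emb Hp y.
Proof. exact: emb_lin. Qed.

Lemma emb0_lin c (x y : F0) : ampc x -> ampc y ->
  emb H0 (c *: x + y) = c *: emb H0 x + emb H0 y.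
Proof. exact: emb_lin. Qed.

Lemma embh_lin : linear (emb Hh).
Proof. by move=> c x y; rewrite emb_lin. Qed.

Lemma embp_xf_lin f : finsupp_fun f -> linear (fun x => emb Hp (xp x f)).
Proof. by move=> ff c x y; rewrite xf_linl embp_lin //; exact: ampc_xf. Qed.

Definition rx (x : A) (v : Lh0 w0) : Lh0 w0 := rho (gl x) v.

Lemma rx_linl v : linear (fun x => rx x v).
Proof. by move=> c x y; rewrite /rx ext_x_lin er_linl. Qed.

Lemma rx_linr x : linear (rx x). Proof. exact: er_linr. Qed.

Lemma rxM x y v : rx (x * y) v = rx x (rx y v). Proof. by rewrite /rx glM erM. Qed.

Lemma rx1 v : rx 1 v = v.
Proof.
rewrite /rx /ext_x; have [/alg_hom1 -> _] := pX_hom Pe.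
by rewrite fX1 er1.
Qed.

Lemma zr_linl v : linear (fun y => rho0 y v). Proof. by have [] := zr_rep rho0. Qed.
Lemma zr_linr y : linear (rho0 y). Proof. by have [] := zr_rep rho0. Qed.
Lemma zrM x y v : rho0 (x * y) v = rho0 x (rho0 y v). Proof. by have [] := zr_rep rho0. Qed.

(** Pol_q(K) acts on the Fock space both through F_q^0(AK) and through the extended algebra. Since
    the two actions agree, slices of the unitary can be computed in the first and commutation
    relations in the second. *)
Lemma zr_aX x v : rho0 (am_gen F0 (aX _ x)) v = rx x v.
Proof.
move: v; apply: malg_lin_eq => [||[chi t]]; [exact: zr_linr|exact: rx_linr|].
move: x; apply: (polK_lin_eq q_gt0) => [||w v u l m vl um].
- by move=> c x y; rewrite aX_lin zr_linl.
- exact: rx_linl.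
have xl := lhomog_mcoef A u vl.
by rewrite -vatU (zr_x rho0 _ _ xl) /rx (er_x rho _ _ xl).
Qed.

Lemma zr_xf x f chi t :
  rho0 (x0 x f) << (chi, t) >> = f (- chi) *: rx x << (chi, t) >>.
Proof. by rewrite /xf zrM -vatU (zr_f rho0) (linZ (zr_linr _)) zr_aX. Qed.

Lemma ampc_homog_ind (homog : P -> A -> Prop) (F : amplif homog) (Q : F -> Prop) :
  (forall w (v u : V w) l m chi, has_wt v l -> has_wt u m ->
     Q (xf F (mcoef A v u) (delta_fun chi))) -> Q 0 ->
  (forall c x y, ampc x -> ampc y -> Q x -> Q y -> Q (c *: x + y)) -> forall y, ampc y -> Q y.
Proof.
move=> Qm Q0 Ql; apply: ampc_ind => // x f ff.
have Qd chi : Q (xf F x (delta_fun chi)).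
  move: x; apply: (polK_ind q_gt0) => [w v u l m vl um||c x y Qx Qy].
  - exact: Qm vl um.
  - by rewrite (lin0 (xf_linl F _)).
  - by rewrite xf_linl; apply: Ql => //; apply: ampc_xf; exact: finsupp_delta.
have [s ->] := xf_delta F x ff.
suff [] : Q (\sum_(chi <- s) f chi *: xf F x (delta_fun chi)) /\
  ampc (\sum_(chi <- s) f chi *: xf F x (delta_fun chi)) by [].
elim: s => [|chi s [IHs aS]]; first by rewrite big_nil; split=> //; exact: lspan0.
have ax : ampc (xf F x (delta_fun chi)) by apply: ampc_xf; exact: finsupp_delta.
by rewrite big_cons; split; [exact: Ql|exact: lspan_lin].
Qed.

Lemma x0_mul x g y f l : lhomog l y ->
  x0 x g * x0 y f = x0 (x * y) (fun m => wshift l g m * f m).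
Proof.
move=> yl; rewrite /xf aXM aFM -!mulrA; congr (_ * _).
by rewrite !mulrA (aF_aX F0 g yl).
Qed.

Lemma finsupp_mul (f g : P -> C) : finsupp_fun f -> finsupp_fun (fun m => f m * g m).
Proof.
by apply: sub_finite_set => m /=; apply: contra_neq => ->; rewrite mul0r.
Qed.

Lemma ampc0_mul y z : ampc y -> ampc z -> ampc (y * z : F0).
Proof.
move=> ay; move: z; apply: ampc_homog_ind => [w v u l m chi vl um||c a b aa ab Ha Hb].
- move: y ay; apply: ampc_homog_ind => [w' v' u' l' m' chi' vl' um'||c a b aa ab Ha Hb].
  + rewrite (x0_mul _ _ _ (lhomog_mcoef A u vl)); apply: ampc_xf; apply: finsupp_mul.
    by apply: finsupp_wshift; exact: finsupp_delta.
  + by rewrite mul0r; exact: lspan0.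
  + by rewrite mulrDl -scalerAl; exact: lspan_lin.
- by rewrite mulr0; exact: lspan0.
- by rewrite mulrDr -scalerAr; exact: lspan_lin.
Qed.

Lemma finite_union_lin (M : lmodType C) c (F G : P -> M) :
  finite_set [set m | F m != 0] -> finite_set [set m | G m != 0] ->
  finite_set [set m | c *: F m + G m != 0].
Proof.
move=> fF fG; apply: (@sub_finite_set _ _ ([set m | F m != 0] `|` [set m | G m != 0])).
  move=> m /=; have [->|] := eqVneq (F m) 0; last by left.
  by rewrite scaler0 add0r; right.
by rewrite finite_setU.
Qed.

(** Moving the function of [z] past a homogeneous coefficient leaves the product of two finitely
    supported functions, one of them translated by m; their supports meet for finitely many m only.
    This makes the functions in the slices finitely supported. *)
Lemma finite_star_xf z (x : A) f : ampc z -> finsupp_fun f ->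
  finite_set [set m | star z * xp x (wshift (- m) f) != 0].
Proof.
move=> + ff; move: z; apply: ampc_ind => [y h hf||c a b _ _ Ha Hb].
- suff : finite_set [set m | am_gen Fp (aF _ (fun k => (h k)^*)) *
      (am_gen Fp (aX _ (star y * x)) * am_gen Fp (aF _ (wshift (- m) f))) != 0].
    apply: sub_finite_set => m /=.
    by rewrite /xf starM -aF_star -aX_star aXM -!mulrA.
  move: (star y * x) => {y x}; apply: (polK_ind q_gt0) => [w v u l m vl um||c a b Ha Hb].
  + have hom : homog_plus (l - m) (mcoef A v u).
      by exists l, m; split=> //; exact: bihomog_mcoef.
    apply: (@sub_finite_set _ _ ((fun p => p.2 - p.1 - (l - m)) @`
       ([set k | h k != 0] `*` [set k | f k != 0]))); last first.
      by apply: finite_image; apply: finite_setX.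
    move=> k /=; rewrite mulrA (aF_aX _ _ hom) -mulrA -aFM => H.
    have [j jH] : exists j, wshift (l - m) (fun k => (h k)^*) j * wshift (- k) f j != 0.
      apply: contrapT => N; case/eqP: H.
      rewrite (_ : (fun _ => _) = (fun=> 0)) ?aF0 ?mulr0 //; apply/funext => j.
      by apply/eqP/negPn/negP => jH; apply: N; exists j.
    move: jH; rewrite mulf_eq0 negb_or /wshift conjC_eq0 opprK => /andP [hj fj].
    exists (j - (l - m), j + k) => //=.
    by apply/eqP; rewrite !subr_eq -addrA [X in k + X]addrC subrK addrC.
  + rewrite (_ : [set m | _] = set0) //; apply/seteqP; split=> m //=.
    by rewrite (lin0 (aX_lin Fp)) mul0r mulr0 eqxx.
  + have := finite_union_lin c Ha Hb; apply: sub_finite_set => m /=.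
    by rewrite aX_lin mulrDl mulrDr -scalerAl -scalerAr.
- rewrite (_ : [set m | _] = set0) //; apply/seteqP; split=> m //=.
  by rewrite star_lin0 mul0r eqxx.
- have := finite_union_lin c^* Ha Hb; apply: sub_finite_set => m /=.
  by rewrite starL mulrDl -scalerAl.
Qed.

Local Notation slice z x f := (fun m : P => hip z (emb Hp (xp x (wshift (- m) f)))).

Lemma finsupp_slice (z : Fp) x f : ampc z -> finsupp_fun f ->
  finsupp_fun (slice (emb Hp z) x f).
Proof.
move=> az ff; apply: sub_finite_set (finite_star_xf x az ff) => m /=.
apply: contra_neq => e0; rewrite emb_ip //; last by apply: ampc_xf; exact: finsupp_wshift.
by rewrite e0; have [] := linear_on_lspan (V := Fp) (W := C^o) (as_lin psip).
Qed.

(* The slice of W at z and x f is left multiplication by sum x_(2) g, with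
   g(m) = <z, x_(1) f(. + m)>. *)
Lemma slice_lmul (z : Fp) x f (Y : H0 -> H0) : ampc z -> finsupp_fun f -> Linf0 (H0 := H0) Y ->
  (forall y y', hip y (Y y') = hip (tn Tp0 (emb Hp z) y) (W (tn T00 (emb H0 (x0 x f)) y'))) ->
  is_lmul (\sum_(p <- cop x) x0 p.2 (slice (emb Hp z) p.1 f)) Y.
Proof.
move=> az ff [Yb _] Yf; split=> //; have [Yl _] := Yb; set y := \sum_(_ <- _) _.
have ay : ampc y by apply: lspan_sum => p _; apply: ampc_xf; exact: finsupp_slice.
have embl := linear_on_lspan (V := F0) (W := H0) emb0_lin.
apply: (@ampc_homog_ind _ _ (fun b => Y (emb H0 b) = emb H0 (y * b))) =>
  [w v u l m chi vl um||c a a' aa aa' Ha Ha'].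
- have yl := lhomog_mcoef A u vl; set y' := mcoef A v u in yl *.
  apply: (@total_eq _ _ setT) => [t tS|t _].
    by apply: (inner_eq0 (hipI H0)); exact: tS.
  rewrite Yf (gvE W x chi ff yl) (inner_sumr (hipI Tp0)) /gamma1 big_map.
  rewrite mulr_suml; have [_ eZ ->] := embl; last first.
    move=> p _; apply: ampc0_mul; apply: ampc_xf; last exact: finsupp_delta.
    exact: finsupp_slice.
  rewrite (inner_sumr (hipI H0)); apply: eq_bigr => p _ /=; rewrite tn_ip.
  rewrite (x0_mul _ _ _ yl); set g := slice _ _ _.
  have -> : (fun m => wshift l g m * delta_fun chi m) =
      (fun m => g (chi - l) * delta_fun chi m + 0).
    apply/funext => k; rewrite /wshift /delta_fun addr0.
    by case: (k =P chi) => [->//|_]; rewrite !mulr0.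
  rewrite xf_linr xf0 addr0 eZ ?(innerZr (hipI H0)); last by apply: ampc_xf; exact: finsupp_delta.
  congr (hip _ (emb Hp (xp _ _)) * _); apply/funext => k.
  by rewrite /wshift opprK.
- by rewrite mulr0; have [-> _ _] := embl; exact: lin0.
- rewrite mulrDr -scalerAr !emb0_lin //; last 2 first.
  + exact: ampc0_mul.
  + exact: ampc0_mul.
  by rewrite Yl Ha Ha'.
Qed.

Lemma tensor_core_total : total [set z : Tph | exists x y,
  [/\ (emb Hp @` @ampc _ _ _ _ _ _ _ Fp) x, (emb Hh @` setT) y & z = tn Tph x y]].
Proof. by apply: tensor_total; exact: emb_dense. Qed.

Lemma cu_lin : linear Vh. Proof. by have [] := cu_unitary Vh. Qed.

(** Tested against z (x) v: [cu_slice] gives the slice, [slice_lmul] shows that it is a left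
    multiplication, and [il_ext] evaluates it on the Fock space. The shift by chi arises because
    functions act at degree chi through their value at -chi. *)
Lemma cu_core x f chi t : finsupp_fun f ->
  Vh (tn T0h (emb H0 (x0 x f)) (emb Hh << (chi, t) >>)) =
  \sum_(p <- cop x) tn Tph (emb Hp (xp p.1 (wshift chi f))) (emb Hh (rx p.2 << (chi, t) >>)).
Proof.
move=> ff; apply: (total_eq tensor_core_total) => _ [_ [_ [[z az <-] [v _ <-] ->]]].
have [Y [YL Y1 Y2]] := cu_slice Vh (emb H0 (x0 x f)) (emb Hp z).
rewrite -Y2 (il_ext Phi _ (slice_lmul az ff YL Y1)); last first.
  by apply: lspan_sum => p _; apply: ampc_xf; exact: finsupp_slice.
rewrite (lin_sum _ _ _ (zr_linl _)) (lin_sum _ _ _ embh_lin).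
rewrite (inner_sumr (hipI Hh)) (inner_sumr (hipI Tph)); apply: eq_bigr => p _.
rewrite zr_xf (linZ embh_lin) (innerZr (hipI Hh)) tn_ip; congr (hip _ (emb Hp (xp _ _)) * _).
by rewrite opprK.
Qed.

(* The shift of f by the degree makes [Vh] send Jx id f x v to
   sum x_(1) f (x) x_(2) v for v of any degree. *)
Definition Jx (F : Lh0 w0 -> Lh0 w0) f x : Lh0 w0 -> T0h :=
  mext (fun a => tn T0h (emb H0 (x0 x (wshift (- a.1) f))) (emb Hh (F << a >>))).

Lemma Jx_linr F f x : linear (Jx F f x). Proof. exact: mext_lin. Qed.

Definition embt f (x : A) (v : Lh0 w0) : Tph := tn Tph (emb Hp (xp x f)) (emb Hh v).

Lemma embt_linr f x : linear (embt f x).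
Proof. by move=> c v v'; rewrite /embt embh_lin tn_linr. Qed.

Lemma embt_linl f v : finsupp_fun f -> linear (fun x => embt f x v).
Proof. by move=> ff c x y; rewrite /embt embp_xf_lin // tn_linl. Qed.

Lemma cu_J f x v : finsupp_fun f ->
  Vh (Jx id f x v) = \sum_(p <- cop x) embt f p.1 (rx p.2 v).
Proof.
move=> ff; move: v; apply: malg_lin_eq => [||[chi t]].
- by move=> c v v'; rewrite Jx_linr cu_lin.
- apply: lin_sumf => p c v v'; by rewrite rx_linr embt_linr.
rewrite /Jx mextU cu_core; last exact: finsupp_wshift.
by apply: eq_bigr => p _; rewrite /embt wshift_add subrr wshift0.
Qed.

(** x_(2) S(x_(3)) collapses to a counit, so every algebraic vector on the right is reached from the
    algebraic core and not merely from the Hilbert space. *)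
Lemma cu_J_inv f x v : finsupp_fun f ->
  Vh (\sum_(p <- cop x) Jx id f p.1 (rx (antipode p.2) v)) = embt f x v.
Proof.
move=> ff; rewrite (lin_sum _ _ _ cu_lin).
under eq_bigr do rewrite cu_J //.
rewrite (coassoc x (f := fun a b c => embt f a (rx b (rx (antipode c) v)))).
- transitivity (\sum_(p <- cop x) embt f p.1 (counit p.2 *: v)).
    apply: eq_bigr => p _; rewrite -(lin_sum _ _ _ (embt_linr f p.1)); congr (embt f _ _).
    under eq_bigr do rewrite -rxM.
    rewrite -(lin_sum _ _ _ (rx_linl v)) antipoder.
    by rewrite (linZ (rx_linl v)) rx1.
  transitivity (\sum_(p <- cop x) embt f (counit p.2 *: p.1) v).
    apply: eq_bigr => p _; rewrite (linZ (embt_linr f _)).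
    by rewrite (linZ (embt_linl v ff)).
  by rewrite -(lin_sum _ _ _ (embt_linl v ff)) counitr.
- by move=> b c; exact: embt_linl.
- by move=> a c k b b'; rewrite rx_linl embt_linr.
- by move=> a b k c c'; rewrite antipode_lin rx_linl rx_linr embt_linr.
Qed.

(** * The intertwining relation and its multiplicativity *)

Variables (U0 : uqZero q L) (Up : uqPlus q L) (pi : piMap Fe U0).
Variables (alpha : rightCoaction U0 Up) (prhd : pirhd Fp Up).
Local Notation zg g := (uz_gen U0 g).
Local Notation pg g := (up_gen Up g).

Lemma pi_hom : alg_hom pi. Proof. by have [] := pm_hom pi. Qed.
Lemma pi_star X : pi (star X) = star (pi X). Proof. by have [_] := pm_hom pi. Qed.

Definition act0 (X : U0) (v : Lh0 w0) : Lh0 w0 := rho (pi X) v.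

Lemma act0_linl v : linear (fun X => act0 X v).
Proof. by move=> c X Y; rewrite /act0 (alg_hom_lin pi_hom) er_linl. Qed.

Lemma act0_linr X : linear (act0 X). Proof. exact: er_linr. Qed.

Lemma act0M X Y v : act0 (X * Y) v = act0 X (act0 Y v).
Proof. by rewrite /act0 (alg_homM pi_hom) erM. Qed.

Lemma act01 v : act0 1 v = v. Proof. by rewrite /act0 (alg_hom1 pi_hom) er1. Qed.

(** The legs are in the order of [Tph], before the flip that occurs in [graph_alpha]. *)
Definition bterm (y : Fp) (v : Lh0 w0) (X : U0) (Z : Up) : Tph :=
  tn Tph (emb Hp (prhd Z y)) (emb Hh (act0 X v)).

Definition bact X y v : Tph := \sum_(s <- alpha X) bterm y v s.1 s.2.

Lemma bterm_bilin y v : ampc y -> bilin (bterm y v).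
Proof.
move=> ay; split=> [Z|X] c a b; rewrite /bterm.
  by rewrite act0_linl embh_lin tn_linr.
by rewrite prhd_linX // embp_lin ?tn_linl //; exact: ampc_prhd.
Qed.

Lemma bact_linX y v : ampc y -> linear (fun X => bact X y v).
Proof. by move=> ay; exact: (tens_lin (rca_hom alpha) (bterm_bilin v ay)). Qed.

Lemma bact_liny X v c y y' : ampc y -> ampc y' ->
  bact X (c *: y + y') v = c *: bact X y v + bact X y' v.
Proof.
move=> ay ay'; rewrite /bact scaler_sumr -big_split; apply: eq_bigr => s _.
by rewrite /bterm prhd_lin // embp_lin ?tn_linl //; exact: ampc_prhd.
Qed.

Lemma bact_linv X y : linear (bact X y).
Proof.
by apply: lin_sumf => s c v v'; rewrite /bterm act0_linr embh_lin tn_linr.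
Qed.

Lemma bactM X Y y v : ampc y ->
  bact (X * Y) y v = \sum_(t <- alpha Y) bact X (prhd t.2 y) (act0 t.1 v).
Proof.
move=> ay; rewrite /bact (tens_mul (rca_hom alpha) _ _ (bterm_bilin v ay)) exchange_big /=.
apply: eq_bigr => t _; apply: eq_bigr => s _.
by rewrite /bterm prhdM // act0M.
Qed.

Lemma bact1 y v : ampc y -> bact 1 y v = tn Tph (emb Hp y) (emb Hh v).
Proof.
move=> ay; rewrite /bact (tens_one (rca_hom alpha) (bterm_bilin v ay)) /bterm.
by rewrite prhd1 // act01.
Qed.

(** In [Jx (act0 X) f x v] the function is still translated by the degrees in v, not by those in
    pi(X) v. It is thus 1 (x) pi(X) applied to [Jx id f x v]. *)
Definition intertwines X := forall x f v, finsupp_fun f ->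
  Vh (Jx (act0 X) f x v) = \sum_(p <- cop x) bact X (xp p.1 f) (rx p.2 v).

(** The discrepancy between the degrees of v and of pi(X) v is absorbed into f; the resulting
    translation is the one that pi_a contributes to pi_rhd. *)
Lemma Jx_shift d X f x v : finsupp_fun f -> shifts rho d (pi X) ->
  Jx (act0 X) f x v = Jx id (wshift d f) x (act0 X v).
Proof.
move=> ff dX; move: v; apply: malg_lin_eq => [||a].
- exact: Jx_linr.
- by move=> c v v'; rewrite act0_linr Jx_linr.
rewrite {1}/Jx mextU {1}[act0 X << a >>]malg_basis (lin_sum _ _ _ embh_lin).
rewrite (lin_sum _ _ _ (tn_linr T0h _)) /Jx /mext.
apply: eq_big_seq => b; rewrite -mcoeff_neq0 => /dX bE.
by rewrite (linZ embh_lin) (linZ (tn_linr T0h _)) wshift_add bE opprD subrK.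
Qed.

Lemma intertwines_shift d X x f v : finsupp_fun f -> shifts rho d (pi X) ->
  Vh (Jx (act0 X) f x v) =
  \sum_(p <- cop x) embt (wshift d f) p.1 (rho (gl p.2 * pi X) v).
Proof.
move=> ff dX; rewrite (Jx_shift _ _ ff dX) cu_J; last exact: finsupp_wshift.
by apply: eq_bigr => p _; rewrite /rx erM.
Qed.

Lemma embt_ract (x : A) Z f (F : Lh0 w0 -> Lh0 w0) v : finsupp_fun f -> linear F ->
  \sum_(p <- cop x) embt f p.1 (F (rx (ract p.2 Z) v)) =
  \sum_(p <- cop x) embt f (lact Z p.1) (F (rx p.2 v)).
Proof.
move=> ff Fl; apply: (coassoc_act (f := fun a b => embt f a (F (rx b v)))).
split=> [b|a]; first exact: embt_linl.
by move=> c b b'; rewrite rx_linl Fl embt_linr.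
Qed.

Lemma intertwines_K w : intertwines (zg (bK w)).
Proof.
move=> x f v ff; rewrite (intertwines_shift (d := - w)) ?pm_K //; last exact: shifts_k.
have [aK _ _ _] := rca_gen alpha.
under eq_bigr do rewrite gl_k // erM.
rewrite (embt_ract x (uK w) v (finsupp_wshift _ ff) (er_linr rho _)).
apply: eq_bigr => p _; rewrite /bact.
rewrite (tens_eq_bilin (bterm_bilin _ (ampc_xf Fp _ ff)) (aK w)) big_seq1 /bterm /=.
by rewrite prhd_K // /act0 pm_K.
Qed.

Lemma intertwines_L w : intertwines (zg (bL w)).
Proof.
move=> x f v ff; rewrite (intertwines_shift (d := w)) ?pm_L //; last exact: shifts_l.
have [_ aL _ _] := rca_gen alpha.
under eq_bigr do rewrite gl_l // erM.
rewrite (embt_ract x (uK w) v (finsupp_wshift _ ff) (er_linr rho _)).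
apply: eq_bigr => p _; rewrite /bact.
rewrite (tens_eq_bilin (bterm_bilin _ (ampc_xf Fp _ ff)) (aL w)) big_seq1 /bterm /=.
by rewrite prhd_L // /act0 pm_L.
Qed.

(** The two terms of [gl_e] match E_r (x) K + 1 (x) E_r. In both of them pi_rhd translates f by
    -alpha_r, the degree of e_r. *)
Lemma intertwines_E r : intertwines (zg (bE r)).
Proof.
move=> x f v ff; rewrite (intertwines_shift (d := - a_ r)) ?pm_E //; last exact: shifts_e.
have [_ _ aE _] := rca_gen alpha.
under eq_bigr do rewrite (gl_e q_gt0 q_lt1 rho) (linD (er_linl rho _)) erM (linD (embt_linr _ _)).
rewrite big_split /= (embt_ract x _ v (finsupp_wshift _ ff) (er_linr rho _)).
rewrite [X in _ + X](embt_ract x _ v (finsupp_wshift _ ff) (@lin_id _ _)) -big_split.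
apply: eq_bigr => p _; rewrite /bact.
rewrite (tens_eq_bilin (bterm_bilin _ (ampc_xf Fp _ ff)) (aE r)) big_cons big_seq1 /bterm /=.
by rewrite prhd_K // prhd_E // act01 /act0 pm_E.
Qed.

(** The two terms of [gl_f] match F_r (x) 1 and L_(-alpha_r) (x) F_r; f_r has degree 0, in agreement
    with the absence of a translation in [prhd_F]. *)
Lemma intertwines_F r : intertwines (zg (bF r)).
Proof.
move=> x f v ff; rewrite (intertwines_shift (d := 0)) ?pm_F //; last exact: shifts_fe.
have [_ _ _ aF] := rca_gen alpha; rewrite wshift0.
under eq_bigr do rewrite (gl_f q_gt0 q_lt1 rho) (linD (er_linl rho _)) !erM (linD (embt_linr _ _)).
rewrite big_split /= [X in _ + X](embt_ract x _ v ff (er_linr rho _)) -big_split.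
apply: eq_bigr => p _; rewrite /bact.
rewrite (tens_eq_bilin (bterm_bilin _ (ampc_xf Fp _ ff)) (aF r)) big_cons big_seq1 /bterm /=.
rewrite prhd1; last exact: ampc_xf.
by rewrite prhd_F // /act0 pm_F pm_L /f_ext erM.
Qed.

(** A set of pairs, as [bact_graph] below: the image of a vector is given through a chosen
    expression as a sum of tensors, and independence of that choice is a separate statement. *)
Definition core_graph X : set (T0h * T0h)%type :=
  lspan [set z : (T0h * T0h)%type | exists a v, ampc a /\
    z = (tn T0h (emb H0 a) (emb Hh v), tn T0h (emb H0 a) (emb Hh (act0 X v)))].

Definition bact_graph X : set (Tph * Tph)%type :=
  lspan [set z : (Tph * Tph)%type | exists v y, ampc y /\
    z = (tn Tph (emb Hp y) (emb Hh v), bact X y v)].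

Lemma core_graph_Jx X (F : U0) f x v : finsupp_fun f ->
  core_graph X (Jx (act0 F) f x v, Jx (act0 (X * F)) f x v).
Proof.
move=> ff; move: v; apply: malg_ind => [a||c v v' Hv Hv'].
- rewrite /Jx !mextU; apply: lspan_in; exists (x0 x (wshift (- a.1) f)), (act0 F << a >>).
  by split; [apply: ampc_xf; exact: finsupp_wshift|rewrite act0M].
- by rewrite !(lin0 (Jx_linr _ _ _)); exact: lspan0.
- by rewrite !Jx_linr; exact: (lspan_lin c Hv Hv').
Qed.

Lemma core_graph_Jx1 X f x v : finsupp_fun f ->
  core_graph X (Jx id f x v, Jx (act0 X) f x v).
Proof.
move=> ff; have := core_graph_Jx X 1 x v ff; rewrite mulr1.
by have -> : act0 1 = id by apply/funext => u; rewrite act01.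
Qed.

Lemma act0_adj X u v : hip (emb Hh (act0 (star X) u)) (emb Hh v) =
  hip (emb Hh u) (emb Hh (act0 X v)).
Proof. by rewrite !emb_ip // /act0 pi_star (er_star rho) starK. Qed.

(** 1 (x) [act0 (star X)] is a formal adjoint on a total set. *)
Lemma closure_core_graph_fun X : is_operator (closure (core_graph X)).
Proof.
have tot := tensor_total (T := T0h) (emb_dense H0) (emb_dense Hh).
have := @closable_adjoint _ T0h _ (core_graph X) tot; apply.
move=> _ [_ [_ [[a aa <-] [u _ <-] ->]]].
exists (tn T0h (emb H0 a) (emb Hh (act0 (star X) u))).
apply: lspan_ind => [_ [b [v [_ ->]]]||c z z' Hz Hz'] /=.
- by rewrite !tn_ip act0_adj.
- by rewrite !(inner0r (hipI T0h)).
- by rewrite !(inner_linr (hipI T0h)) Hz Hz'.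
Qed.

Lemma core_graph_fun X : is_operator (core_graph X).
Proof.
move=> x y y' xy xy'.
by apply: (@closure_core_graph_fun X x); exact: subset_closure.
Qed.

(** The antipode preimage of [cu_J_inv] is used for both components at once: applying 1 (x) pi(X) to
    it and then [HX] collapses to [bact X] by the same cancellation. *)
Lemma bact_graph_core X : intertwines X -> forall t, bact_graph X t ->
  exists2 d, core_graph X d & t = (Vh d.1, Vh d.2).
Proof.
move=> HX; apply: lspan_ind => [_ [v [y [ay ->]]]||c t t' [d Hd ->] [d' Hd' ->]].
- move: y ay; apply: ampc_ind => [x f ff||c y y' ay ay' [d Hd [e1 e2]] [d' Hd' [e1' e2']]].
  + exists (\sum_(p <- cop x) Jx id f p.1 (rx (antipode p.2) v),
            \sum_(p <- cop x) Jx (act0 X) f p.1 (rx (antipode p.2) v)).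
      elim: (cop x) => [|p s IHs]; first by rewrite !big_nil; exact: lspan0.
      by rewrite !big_cons; exact: (lspanD (core_graph_Jx1 X _ _ ff) IHs).
    rewrite /= cu_J_inv //; congr pair; rewrite (lin_sum _ _ _ cu_lin).
    under [RHS]eq_bigr do rewrite HX //.
    rewrite (coassoc x (f := fun a b c => bact X (xp a f) (rx b (rx (antipode c) v)))).
    * transitivity (\sum_(p <- cop x) bact X (xp p.1 f) (counit p.2 *: v)).
        transitivity (\sum_(p <- cop x) bact X (xp (counit p.2 *: p.1) f) v).
          have ll : linear (fun a => bact X (xp a f) v).
            by move=> c a b; rewrite xf_linl bact_liny //; exact: ampc_xf.
          by rewrite -(lin_sum _ _ _ ll) counitr.
        apply: eq_bigr => p _; rewrite (linZ (bact_linv _ _)) (linZ (xf_linl Fp _)).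
        have := @bact_liny X v (counit p.2) (xp p.1 f) 0 (ampc_xf Fp _ ff) (lspan0 _).
        rewrite addr0 => ->; rewrite [bact X 0 v](_ : _ = 0) ?addr0 //.
        have := @bact_liny X v (-1) 0 0 (lspan0 _) (lspan0 _).
        by rewrite scaler0 addr0 scaleN1r addNr.
      apply: eq_bigr => p _; rewrite -(lin_sum _ _ _ (bact_linv X _)); congr (bact _ _ _).
      under eq_bigr do rewrite -rxM.
      rewrite -(lin_sum _ _ _ (rx_linl v)) antipoder.
      by rewrite (linZ (rx_linl v)) rx1.
    * move=> b c k a a'; rewrite xf_linl bact_liny //; exact: ampc_xf.
    * by move=> a c k b b'; rewrite rx_linl bact_linv.
    * by move=> a b k c c'; rewrite antipode_lin rx_linl rx_linr bact_linv.
  + exists 0; first exact: lspan0.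
    have [-> _ _] := linear_on_lspan (V := Fp) (W := Hp) embp_lin.
    rewrite (lin0 cu_lin) (lin0 (tn_linl Tph _)); congr pair.
    have := @bact_liny X v (-1) 0 0 (lspan0 _) (lspan0 _).
    by rewrite scaler0 addr0 scaleN1r addNr.
  + exists (c *: d + d'); first exact: lspan_lin.
    by rewrite /= !cu_lin embp_lin // tn_linl bact_liny // e1 e2 e1' e2'.
- by exists 0; [exact: lspan0|rewrite /= (lin0 cu_lin)].
- by exists (c *: d + d'); [exact: lspan_lin|rewrite /= !cu_lin].
Qed.

(** [Vh] is injective, so single-valuedness carries over from [core_graph_fun]. *)
Lemma bact_graph_fun X : intertwines X ->
  forall x y y', bact_graph X (x, y) -> bact_graph X (x, y') -> y = y'.
Proof.
move=> HX x y y' /(bact_graph_core HX) [[d1 d2] Hd [e1 ->]].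
move=> /(bact_graph_core HX) [[d1' d2'] Hd' [e1' ->]].
have dd : d1 = d1'.
  have [_ iso _] := cu_unitary Vh; apply/eqP; rewrite -subr_eq0; apply/eqP.
  apply: (inner_eq0 (hipI T0h)); rewrite -iso (linB cu_lin) -e1 -e1' subrr.
  exact: (inner0r (hipI Tph)).
by rewrite -dd in Hd'; rewrite (core_graph_fun Hd Hd').
Qed.

Lemma bact_graph_sum X (J : Type) (s : seq J) (y : J -> Fp) (v : J -> Lh0 w0) :
  (forall j, ampc (y j)) ->
  bact_graph X (\sum_(j <- s) tn Tph (emb Hp (y j)) (emb Hh (v j)),
                \sum_(j <- s) bact X (y j) (v j)).
Proof.
move=> ay; elim: s => [|j s IHs]; first by rewrite !big_nil; exact: lspan0.
have h : bact_graph X (tn Tph (emb Hp (y j)) (emb Hh (v j)), bact X (y j) (v j)).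
  by apply: lspan_in; exists (v j), (y j).
by rewrite !big_cons; exact: (lspanD h IHs).
Qed.

Lemma core_graph_bact X : intertwines X -> forall d, core_graph X d ->
  bact_graph X (Vh d.1, Vh d.2).
Proof.
move=> HX; apply: lspan_ind => [_ [a [v [aa ->]]]||c d d' Hd Hd'].
- move: v; apply: malg_ind => [[chi t]||c v v' Hv Hv'].
  + move: a aa; apply: ampc_ind => [x f ff||c a a' aa aa' Ha Ha'].
    * have ff' := finsupp_wshift chi ff.
      have := @core_graph_Jx1 X (wshift chi f) x << (chi, t) >> ff'.
      have -> : Jx id (wshift chi f) x << (chi, t) >> =
          tn T0h (emb H0 (x0 x f)) (emb Hh << (chi, t) >>).
        by rewrite /Jx mextU wshift_add addNr wshift0.
      have e : Jx (act0 X) (wshift chi f) x << (chi, t) >> =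
          tn T0h (emb H0 (x0 x f)) (emb Hh (act0 X << (chi, t) >>)).
        by rewrite /Jx mextU wshift_add addNr wshift0.
      rewrite -e => _; rewrite HX // cu_core //.
      by apply: bact_graph_sum => p; exact: ampc_xf.
    * have [-> _ _] := linear_on_lspan (V := F0) (W := H0) emb0_lin.
      by rewrite /= !(lin0 (tn_linl T0h _)) (lin0 cu_lin); exact: lspan0.
    * rewrite emb0_lin //= !tn_linl !cu_lin; exact: (lspan_lin c Ha Ha').
  + rewrite /= (lin0 (act0_linr X)) (lin0 embh_lin) (lin0 (tn_linr T0h _)) (lin0 cu_lin).
    exact: lspan0.
  + rewrite /= act0_linr !embh_lin !tn_linr !cu_lin; exact: (lspan_lin c Hv Hv').
- by rewrite /= (lin0 cu_lin); exact: lspan0.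
- by rewrite /= !cu_lin; exact: (lspan_lin c Hd Hd').
Qed.

(** [HX] applied to the core pair starting at [Jx (act0 Y) f x v], and [bact X] applied to the sum
    of the [bact Y], give two pairs of [bact_graph X] with the same first component by [HY];
    single-valuedness identifies the second components. *)
Lemma intertwinesM X Y : intertwines X -> intertwines Y -> intertwines (X * Y).
Proof.
move=> HX HY x f v ff.
have := core_graph_bact HX (core_graph_Jx X Y x v ff); rewrite /= HY // => g1.
suff g2 : bact_graph X (\sum_(p <- cop x) bact Y (xp p.1 f) (rx p.2 v),
    \sum_(p <- cop x) bact (X * Y) (xp p.1 f) (rx p.2 v)) by have := bact_graph_fun HX g1 g2.
elim: (cop x) => [|p s IHs]; first by rewrite !big_nil; exact: lspan0.
have h : bact_graph X (bact Y (xp p.1 f) (rx p.2 v), bact (X * Y) (xp p.1 f) (rx p.2 v)).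
  rewrite bactM; last exact: ampc_xf.
  by apply: bact_graph_sum => t; apply: ampc_prhd; exact: ampc_xf.
by rewrite !big_cons; exact: (lspanD h IHs).
Qed.

Lemma intertwinesT X : intertwines X.
Proof.
move: X; apply: (presents_ind _ (@rel_zero_transfers R q L) (uz_presents U0)) => [|g].
  split=> [x f v ff|c X Y HX HY x f v ff|X Y]; last exact: intertwinesM.
    have -> : act0 1 = id by apply/funext => u; rewrite act01.
    rewrite cu_J //; apply: eq_bigr => p _; rewrite bact1 //; exact: ampc_xf.
  have -> : Jx (act0 (c *: X + Y)) f x v = c *: Jx (act0 X) f x v + Jx (act0 Y) f x v.
    rewrite /Jx /mext scaler_sumr -big_split; apply: eq_bigr => a _ /=.
    by rewrite act0_linl embh_lin tn_linr scalerDr !scalerA mulrC.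
  rewrite cu_lin HX // HY // scaler_sumr -big_split; apply: eq_bigr => p _ /=.
  by rewrite (bact_linX _ (ampc_xf Fp _ ff)).
by case: g => [w|w|r|r]; [exact: intertwines_K|exact: intertwines_L
  |exact: intertwines_E|exact: intertwines_F].
Qed.

(** * Flips, closures and the conclusion *)

Variables (Thp : htensor Hh Hp) (sg : flip Tph Thp) (sg' : flip Thp Tph).

Lemma sg_lin : linear sg. Proof. by have [] := fl_unitary sg. Qed.
Lemma sg'_lin : linear sg'. Proof. by have [] := fl_unitary sg'. Qed.

Lemma graph_alpha_flip X t : bact_graph X t ->
  graph_alpha Thp rho pi alpha prhd X (sg t.1, sg t.2).
Proof.
move: t; apply: lspan_ind => [_ [v [y [ay ->]]]||c t t' Ht Ht'] /=.
- apply: lspan_in; exists v, y; split=> //; rewrite fl_tn (lin_sum _ _ _ sg_lin).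
  by congr pair; apply: eq_bigr => s _; rewrite fl_tn.
- by rewrite (lin0 sg_lin); exact: lspan0.
- by rewrite !sg_lin; exact: (lspan_lin c Ht Ht').
Qed.

Lemma flip_graph_alpha X t : graph_alpha Thp rho pi alpha prhd X t ->
  bact_graph X (sg' t.1, sg' t.2).
Proof.
move: t; apply: lspan_ind => [_ [v [y [ay ->]]]||c t t' Ht Ht'] /=.
- apply: lspan_in; exists v, y; split=> //; rewrite fl_tn (lin_sum _ _ _ sg'_lin).
  by congr pair; apply: eq_bigr => s _; rewrite fl_tn.
- by rewrite (lin0 sg'_lin); exact: lspan0.
- by rewrite !sg'_lin; exact: (lspan_lin c Ht Ht').
Qed.

Lemma flipK (H K : hilbert R) (T1 : htensor H K) (T2 : htensor K H)
  (s : flip T1 T2) (s' : flip T2 T1) : cancel s s'.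
Proof.
move=> u; have [_ si _] := fl_unitary s; have [_ s'i _] := fl_unitary s'.
apply: (total_eq (tensor_total (T := T1) (S := setT) (S' := setT) _ _)).
- exact: closureT.
- exact: closureT.
move=> _ [x [y [_ _ ->]]].
by rewrite -{1}(fl_tn s' y x) -(fl_tn s x y) s'i si.
Qed.

Lemma cu_adjK : cancel Vh (cu_adj Vh).
Proof.
move=> u; have [_ iso _] := cu_unitary Vh.
apply: (@total_eq _ _ setT) => [t tS|t _].
  by apply: (inner_eq0 (hipI T0h)); exact: tS.
by rewrite -(cu_adjP Vh) iso.
Qed.

Lemma cuK : cancel (cu_adj Vh) Vh.
Proof. by move=> y; have [_ _ /(_ y) [x <-]] := cu_unitary Vh; rewrite cu_adjK. Qed.

Lemma pair_continuous (H K : hilbert R) (f : H -> K) : continuous f ->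
  continuous (fun z : (H * H)%type => (f z.1, f z.2)).
Proof.
move=> fc z; apply: cvg_pair => /=.
  by apply: (@continuous_comp _ _ _ fst f); [exact: cvg_fst|exact: fc].
by apply: (@continuous_comp _ _ _ snd f); [exact: cvg_snd|exact: fc].
Qed.

(** An elementary tensor over the closed graph is approximated in two stages: its first leg by
    [ampc] vectors, its pair of second legs by points of [graph_pi]. *)
Lemma one_tensor_core X :
  one_tensor T0h (closure (graph_pi Hh rho pi X)) = closure (core_graph X).
Proof.
apply/seteqP; split=> z.
  rewrite -(closure_idem (core_graph X)) => zc.
  apply: (closure_map (f := id) _ zc) => // => [? //|]; apply: lspan_ind.
  - move=> _ [x [v [v' [vv' ->]]]]; apply: subset_closure.
    have cx u : continuous (fun x : H0 => (tn T0h x (u : (Hh * Hh)%type).1, tn T0h x u.2)).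
      by move=> y; apply: cvg_pair; exact: tn_continuousl.
    apply: (closure_map (S := emb H0 @` @ampc _ _ _ _ _ _ _ F0) (cx (v, v'))).
      by rewrite emb_dense.
    move=> _ [a aa <-] /=.
    apply: (closure_map (pair_continuous (@tn_continuousr _ _ _ T0h (emb H0 a))) vv').
    move=> _ [u ->]; apply: subset_closure; apply: lspan_in.
    by exists a, u.
  - apply: subset_closure; apply: subset_closure; exact: lspan0.
  - move=> c t t' Ht Ht'; apply: closure_lin => // ? ? ?.
    apply: closure_lin => ? ? ?; exact: lspan_lin.
apply: closureS; apply: lspan_ind => [_ [a [v [aa ->]]]||c t t' Ht Ht'].
- apply: lspan_in; exists (emb H0 a), (emb Hh v), (emb Hh (act0 X v)); split=> //.
  by apply: subset_closure; exists v.
- exact: lspan0.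
- exact: lspan_lin.
Qed.

(** The unitary and its inverse are continuous and exchange the two algebraic graphs, so they
    exchange the closures. *)
Lemma Ad_gamma_core X :
  Ad_gamma sg sg' Vh (closure (graph_pi Hh rho pi X)) =
  closure (graph_alpha Thp rho pi alpha prhd X).
Proof.
have [sgl sgi _] := fl_unitary sg; have [cul cui _] := cu_unitary Vh.
have fc : continuous (fun v => sg (Vh v)).
  apply: isometry_continuous => [c x y|x y]; first by rewrite cul sgl.
  by rewrite sgi cui.
have fK : cancel (fun v => cu_adj Vh (sg' v)) (fun v => sg (Vh v)).
  by move=> v; rewrite cuK (flipK sg').
have f'K : cancel (fun v => sg (Vh v)) (fun v => cu_adj Vh (sg' v)).
  by move=> v; rewrite (flipK sg) cu_adjK.
have f'c : continuous (fun v => cu_adj Vh (sg' v)).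
  apply: isometry_continuous => [c x y|x y]; last by rewrite -[LHS]cui -sgi !fK.
  by apply: (can_inj f'K); rewrite /= cul sgl !fK.
rewrite /Ad_gamma /conj_graph one_tensor_core; apply/seteqP; split=> [[z1 z2] /= [v [zv ->]]|z zc].
  have := closure_map (S' := graph_alpha Thp rho pi alpha prhd X) (pair_continuous fc) zv.
  rewrite /= fK; apply=> d Hd; apply: subset_closure.
  exact: (graph_alpha_flip (core_graph_bact (@intertwinesT X) Hd)).
exists (cu_adj Vh (sg' z.2)); split; last by rewrite /= fK.
apply: (closure_map (f := fun z => (cu_adj Vh (sg' z.1), cu_adj Vh (sg' z.2))) _ zc).
  exact: pair_continuous f'c.
move=> t /flip_graph_alpha /(bact_graph_core (@intertwinesT X)) [[d1 d2] Hd] [-> ->].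
by rewrite !cu_adjK; exact: subset_closure.
Qed.

Lemma closure_graph_pi_fun X : is_operator (closure (graph_pi Hh rho pi X)).
Proof.
have := @closable_adjoint _ Hh _ (graph_pi Hh rho pi X) (dense_total (emb_dense Hh)); apply.
move=> _ [u _ <-]; exists (emb Hh (act0 (star X) u)) => _ [v ->] /=.
exact: act0_adj.
Qed.

(** Closability is transported through [Ad_gamma_core] from the core graph, where the formal adjoint
    is explicit. *)
Lemma closure_graph_alpha_fun X : is_operator (closure (graph_alpha Thp rho pi alpha prhd X)).
Proof.
rewrite -Ad_gamma_core /Ad_gamma one_tensor_core => x y y' [v /= [xv ->]] [v' /= [xv' ->]].
by rewrite (closure_core_graph_fun xv xv').
Qed.

End Core.

Theorem theorem9p14
  (R : realType) (q : R) (q_gt0 : 0 < q) (q_lt1 : q < 1)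
  (L : rootDatum R) (w0 : longestWord L)
  (U : uqK q L) (U0 : uqZero q L) (Up : uqPlus q L) (alpha : rightCoaction U0 Up)
  (V : forall w : domw L, irrep U (val w)) (A : polK V) (psi : haar A)
  (T : lusztigT V) (S : forall r, su2Restriction A r)
  (Pe : polExt A T w0) (Fe : funExt Pe) (pi : piMap Fe U0) (rho : extRep S Fe)
  (Fp : funPlus A) (psip : ampState psi Fp) (Hp : L2plus psip)
  (F0 : funZero A) (psi0 : ampState psi F0) (H0 : L2zero psi0)
  (Hh : L2h w0) (rho0 : zeroRep w0 S F0) (prhd : pirhd Fp Up)
  (T00 : htensor H0 H0) (Tp0 : htensor Hp H0)
  (T0h : htensor H0 Hh) (Tph : htensor Hp Hh) (Thp : htensor Hh Hp)
  (sg : flip Tph Thp) (sg' : flip Thp Tph)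
  (W : gammaUnitary T00 Tp0) (Phi : identLinf H0 Hh rho0)
  (Vh : coactUnitary T0h Tph W Phi) :
  forall X : U0,
    let bX := closure (graph_pi Hh rho pi X) in
    let aX := closure (graph_alpha Thp rho pi alpha prhd X) in
    [/\ is_operator bX, is_operator aX & Ad_gamma sg sg' Vh bX = aX].
Proof.
move=> X; split.
- exact: closure_graph_pi_fun.
- apply: (closure_graph_alpha_fun q_gt0 q_lt1 Vh sg sg').
- apply: (Ad_gamma_core q_gt0 q_lt1).
Qed.
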